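(* Let $S_N=\sum_{n=1}^N X_n$ be a random walk on $\mathbb{Z}$ (so $d=1$) with i.i.d. steps satisfying the non-degeneracy and aperiodicity assumptions of the context. Suppose that $\mathbb{E}(X_1)=0$ and $\mathrm{Var}(X_1)<\infty$. Then for every $F\in\mathbf{G}_\pm$, with $T_N=\sum_{n=1}^N F(S_n)$, the random variables $\frac{T_N}{N}$ converge in law as $N\to\infty$. In particular, if $\bar F_-=0$ and $\bar F_+=1$, then the limiting law is the arcsine distribution: for every $z\in[0,1]$, $$\lim_{N\to\infty}\mathbb{P}\left(\frac{T_N}{N}\le z\right)=\frac{2}{\pi}\arcsin\sqrt{z}.$$
   Context: $X_1,X_2,\dots$ are i.i.d. $\mathbb{Z}$-valued random variables, $S_0=0$, $S_N=\sum_{n=1}^N X_n$. Standing assumptions: (non-degeneracy) the smallest group supporting the range of $X_1$ is $\mathbb{Z}$; (aperiodicity) $\gcd\{n>0:\mathbb{P}(S_n=0)>0\}=1$. For a bounded function $F:\mathbb{Z}\to\mathbb{R}$ and a non-empty finite $V\subset\mathbb{Z}$, $\bar F_V=\frac1{|V|}\sum_{x\in V}F(x)$; intervals are understood as sets of integers. $\mathbf{G}_+$ is the space of bounded $F$ such that $\bar F_+=\lim_{v\to\infty}\bar F_{[0,v]}$ exists; $\mathbf{G}_-$ is the space of bounded $F$ such that $\bar F_-=\lim_{v\to\infty}\bar F_{[-v,0]}$ exists; $\mathbf{G}_\pm=\mathbf{G}_+\cap\mathbf{G}_-$. *)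

(* Defs.v *)
From HB Require Import structures.
From mathcomp Require Import all_boot all_order all_algebra.
From mathcomp Require Import finmap.
From mathcomp Require Import all_classical all_reals all_analysis.

Set Implicit Arguments.
Unset Strict Implicit.
Unset Printing Implicit Defensive.

Import Order.TTheory GRing.Theory Num.Theory.
Import numFieldNormedType.Exports.

Local Open Scope classical_set_scope.
Local Open Scope ring_scope.

HB.instance Definition _ := isPointed.Build int 0%R.

(* The integers carry the discrete sigma-algebra, so that {RV P >-> int} is the
   type of Z-valued random variables. *)
HB.instance Definition _ := @isMeasurable.Build default_measure_display
  int discrete_measurable discrete_measurable0
  discrete_measurableC discrete_measurableU.

Section iid.
Context d d' (T : measurableType d) (T' : measurableType d') (R : realType)
  (P : probability T R).
Implicit Types X : {RV P >-> T'}^nat.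

Definition mutually_independent X :=
  forall (J : {fset nat}) (A : nat -> set T'), (forall j, measurable (A j)) ->
    P (\bigcap_(j in [set` J]) (X j @^-1` A j)) =
    (\prod_(j <- J) P (X j @^-1` A j))%E.

Definition identically_distributed X :=
  forall i (A : set T'), measurable A ->
    distribution P (X i) A = distribution P (X 0%N) A.

Definition iid X := mutually_independent X /\ identically_distributed X.

End iid.

Arguments iid {d d' T T' R} P X.

Section random_walk.
Context d (T : measurableType d) (R : realType) (P : probability T R).
Implicit Types (X : {RV P >-> int}^nat) (F : int -> R).

(* X 0, X 1, ... are the steps X_1, X_2, ...; thus walk X n is S_n. *)
Definition walk X (n : nat) (w : T) : int :=
  \sum_(0 <= i < n) X i w.

Definition additive_functional F X (N : nat) (w : T) : R :=
  \sum_(1 <= n < N.+1) F (walk X n w).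

Definition smallest_supporting_group (Y : {RV P >-> int}) : set int :=
  \bigcap_(H in [set H : set int | zmod_closed [pred x | x \in H] /\
                                   P (Y @^-1` H) = 1%E]) H.

Definition nondegenerate_walk X :=
  smallest_supporting_group (X 0%N) = setT.

(* The gcd as greatest lower bound for divisibility; only 0 is a gcd of the
   empty set. *)
Definition is_gcd (A : set nat) (g : nat) :=
  (forall n, A n -> (g %| n)%N) /\
  (forall k, (forall n, A n -> (k %| n)%N) -> (k %| g)%N).

Definition aperiodic_walk X :=
  is_gcd [set n | (0 < n)%N /\ (0 < P [set w | walk X n w = 0%R])%E] 1.

End random_walk.

Arguments nondegenerate_walk {d T R} P X.
Arguments aperiodic_walk {d T R} P X.

Section averages.
Context (R : realType).
Implicit Types (F : int -> R).

(* Meaningful for non-empty finite V only. *)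
Definition average F (V : set int) : R :=
  (\sum_(x \in V) F x) / #|` fset_set V|%:R.

Definition averages_pos F (v : nat) : R := average F `[0, v%:Z].
Definition averages_neg F (v : nat) : R := average F `[- v%:Z, 0].

Definition G_pos F := bounded_fun F /\ cvgn (averages_pos F).
Definition G_neg F := bounded_fun F /\ cvgn (averages_neg F).
Definition G_both F := G_pos F /\ G_neg F.

Definition mean_pos F : R := limn (averages_pos F).
Definition mean_neg F : R := limn (averages_neg F).

End averages.

(* Weak convergence of the laws of the Y n to mu, tested on bounded continuous
   functions. *)
Definition cvg_in_law d (T : measurableType d) (R : realType)
    (P : probability T R) (Y : nat -> T -> R)
    (mu : probability R R) :=
  forall f : R -> R, continuous f -> bounded_fun f ->
    ('E_P[f \o Y n])%E @[n --> \oo] --> (\int[mu]_x (f x)%:E)%E.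

(* Main.v *)
(* Subtracting from F the function equal to mean_pos F on x >= 0 and to mean_neg F
   on x < 0 reduces the statement to two facts.

   (1) If G is bounded with zero averages on both sides, then T_N(G) / N -> 0 in L^1.
   The second moment of T_N is controlled by the potentials sum_(m < k) P^m g; when
   g is the second difference of h, P h - h is close to (variance / 2) g and the
   potential telescopes to P^k h - h, which is o(N) because h is o(sqrt N)-Lipschitz
   when the averages of G vanish. Here g is G averaged over blocks of fixed length,
   which is harmless because the walk forgets its starting point in total variation.

   (2) The fraction A_N / N of time spent in x >= 0 converges to the arcsine law. Let
   u be exponential on each half-line, with rates of order N^(-1/2), solving
   approximately (variance / 2) u'' = N^(-1) ((a + b 1_(x >= 0)) u - 1). Telescoping
   E (exp (- (a n + b A_n) / N) u (S_n)) shows that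
   N^(-1) sum_n e^(-a n / N) E e^(-b A_n / N) -> u(0) = 1 / sqrt (a (a + b)), which is
   also E 1 / (a + b Y) for Y = sin^2 (pi U / 2) with U uniform on [0, 1]. Since
   n |-> E e^(-b A_n / N) is Lipschitz at scale N, the Laplace transform in n / N can
   be inverted at n = N, so E e^(-b A_N / N) -> E e^(-b Y), and polynomials in e^(-x)
   are dense. *)

From HB Require Import structures.
Require Import Defs.
From mathcomp Require Import all_boot all_order all_algebra.
From mathcomp Require Import finmap.
From mathcomp Require Import all_classical all_reals all_analysis.
From mathcomp Require Import measurable_realfun.
From mathcomp Require Import zify ring lra.

Set Implicit Arguments.
Unset Strict Implicit.
Unset Printing Implicit Defensive.

Import Order.TTheory GRing.Theory Num.Theory.
Import numFieldNormedType.Exports.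

Local Open Scope classical_set_scope.
Local Open Scope ring_scope.

(** * Discrete calculus *)

(** A finite variance gives neither a third moment for a Taylor remainder nor a rate in the limit
    theorems. Every estimate rests on one expansion: [P h - h] is half the variance times
    [second_difference h], up to the oscillation of the latter on a window of fixed size [Z] and the
    second moment of the steps beyond [Z]. The functions fed into it must therefore have slowly
    varying second differences. A general [G] may oscillate at every scale, so it is block averaged;
    loss of memory, hence aperiodicity, enters only there and in the escape from bounded sets. The
    second difference of [u] jumps at the origin, so the expansion fails in a window around 0, whose
    total weight is shown to vanish. Moreover [G] has to be cut off at a distance of order sqrt N:
    its double primitive has slopes o(sqrt N) only up to that distance, and Chebyshev's inequality
    takes care of the rest. The arcsine density never appears: the law is the image of a uniform
    variable, for which the mean of 1 / (a + b Y) is an elementary integral. *)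

Section discrete_calculus.
Context (R : realType).
Implicit Types (h g : int -> R) (x y z : int) (B w : R).

Definition second_difference h x : R := h (x + 1) - 2 * h x + h (x - 1).

Lemma lipschitz_of_steps h B : (forall x, `|h (x + 1) - h x| <= B) ->
  forall x y, `|h (x + y) - h x| <= B * `|y|%N%:R.
Proof.
move=> hB.
have nat_case x (n : nat) : `|h (x + n%:Z) - h x| <= B * n%:R.
  elim: n => [|n IHn]; first by rewrite addr0 subrr normr0 mulr0.
  have -> : h (x + n.+1%:Z) - h x =
      (h (x + n%:Z + 1) - h (x + n%:Z)) + (h (x + n%:Z) - h x).
    rewrite (_ : n.+1%:Z = n%:Z + 1); last by lia.
    by rewrite addrA; ring.
  rewrite (le_trans (ler_normD _ _))// -natr1 mulrDr mulr1 addrC.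
  exact: lerD.
move=> x [n|n]; first exact: nat_case.
have := nat_case (x + Negz n) n.+1.
by rewrite NegzE subrK distrC abszN.
Qed.

(** The centred slope makes the remainder vanish at distance 1. Its second differences are the
    deviations of [second_difference h] from its value at [x], and summing them twice gives at most
    [w] times n (n - 1) / 2. *)
Lemma taylor_nat h x w (n : nat) :
  (forall m : nat, (m <= n)%N ->
    `|second_difference h (x + m%:Z) - second_difference h x| <= w) ->
  `|h (x + n%:Z) - h x - n%:R * ((h (x + 1) - h (x - 1)) / 2)
    - n%:R ^+ 2 / 2 * second_difference h x| <= w * (n%:R ^+ 2 / 2).
Proof.
move=> gw.
pose k (m : nat) := h (x + m%:Z) - h x - m%:R * ((h (x + 1) - h (x - 1)) / 2)
    - m%:R ^+ 2 / 2 * second_difference h x.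
have kS (m : nat) : (m <= n)%N -> `|k m.+1 - k m| <= w * m%:R.
  elim: m => [_|m IHm mn].
    rewrite mulr0 normr_le0 /k /second_difference.
    by rewrite addr0 mulr0n expr1n; apply/eqP; field.
  have -> : k m.+2 - k m.+1 = (k m.+1 - k m) +
      (second_difference h (x + m.+1%:Z) - second_difference h x).
    have -> : second_difference h (x + m.+1%:Z) =
        h (x + m.+2%:Z) - 2 * h (x + m.+1%:Z) + h (x + m%:Z).
      by rewrite /second_difference; congr (h _ - _ + h _); lia.
    by rewrite /k; field.
  rewrite (le_trans (ler_normD _ _))// -natr1 mulrDr mulr1.
  by apply: lerD; [apply: IHm; lia|exact: gw].
have w0 : 0 <= w by apply: le_trans (gw 0%N _) => //; exact: normr_ge0.
suff kb (m : nat) : (m <= n)%N -> `|k m| <= w * (m%:R ^+ 2 / 2) by exact: kb.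
elim: m => [_|m IHm mn].
  by rewrite /k addr0 subrr !mul0r expr0n/= !mul0r !subr0 normr0 mulr0.
have -> : k m.+1 = (k m.+1 - k m) + k m by rewrite subrK.
apply: (le_trans (ler_normD _ _)).
apply: (le_trans (lerD (kS m (ltnW mn)) (IHm (ltnW mn)))).
rewrite -mulrDr ler_wpM2l// -natr1 -subr_ge0.
by rewrite (_ : _ - _ = 1 / 2 :> R); [lra|field].
Qed.

Lemma taylor h x w y :
  (forall z, (`|z| <= `|y|)%N ->
    `|second_difference h (x + z) - second_difference h x| <= w) ->
  `|h (x + y) - h x - y%:~R * ((h (x + 1) - h (x - 1)) / 2)
    - y%:~R ^+ 2 / 2 * second_difference h x| <= w * (y%:~R ^+ 2 / 2).
Proof.
case: y => n gw.
  by apply: taylor_nat => m mn; exact: gw.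
pose k z := h (- z).
have sdk z : second_difference k z = second_difference h (- z).
  by rewrite /second_difference /k !opprD !opprK; ring.
have := @taylor_nat k (- x) w n.+1; rewrite (sdk (- x)) opprK => H.
have {H} : (forall m : nat, (m <= n.+1)%N -> `|second_difference k (- x + m%:Z)
      - second_difference h x| <= w) ->
    `|h (x - n.+1%:Z) - h x - n.+1%:R * ((h (x - 1) - h (x + 1)) / 2) -
      n.+1%:R ^+ 2 / 2 * second_difference h x| <= w * (n.+1%:R ^+ 2 / 2).
  by move/H; rewrite /k !opprD !opprK.
move=> H.
rewrite (_ : (Negz n)%:~R = - n.+1%:R :> R)// sqrrN.
have -> : h (x + Negz n) - h x - (- (n.+1%:R : R)) * ((h (x + 1) - h (x - 1)) / 2) -
    (n.+1%:R : R) ^+ 2 / 2 * second_difference h x =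
  h (x - n.+1%:Z) - h x - n.+1%:R * ((h (x - 1) - h (x + 1)) / 2)
    - n.+1%:R ^+ 2 / 2 * second_difference h x.
  by rewrite NegzE; field.
apply: H => m mn.
by rewrite sdk opprD opprK; apply: gw; rewrite abszN.
Qed.

(** The discrete primitive that vanishes at 0. Since [Negz n] is -(n + 1), the sum on the negative
    side runs over -1, ..., -(n + 1). *)
Definition antidifference (f : int -> R) x : R :=
  match x with
  | Posz n => \sum_(i < n) f (Posz i)
  | Negz n => - \sum_(i < n.+1) f (Negz i)
  end.

Lemma antidifferenceS f x : antidifference f (x + 1) - antidifference f x = f x.
Proof.
case: x => [n|[|n]].
- rewrite -PoszD addn1 /= big_ord_recr/=.
  by rewrite [LHS]addrC addKr.
- by rewrite /= big_ord0 sub0r opprK big_ord_recr/= big_ord0 add0r.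
- have -> : Negz n.+1 + 1 = Negz n by lia.
  by rewrite /= (big_ord_recr n.+1)/= opprK addrC opprD addrK || rewrite /= (big_ord_recr n.+1)/= opprK addKr.
Qed.

End discrete_calculus.

(** * Weierstrass approximation *)

(** Compactness is used for [x] only, and [y] may leave the segment. This serves the final
    comparison, where T_N / N is known to stay in a segment but its approximation is not. *)
Lemma uniform_continuity_segment (R : realType) (f : R -> R) (a b e : R) :
  continuous f -> 0 < e ->
  exists2 D : R, 0 < D & forall x y, a <= x <= b -> `|x - y| < D ->
    `|f x - f y| <= e.
Proof.
move=> cf e0.
have e20 : 0 < e / 2 by rewrite divr_gt0.
have /compact_near_coveringP ncov := @segment_compact R a b.
pose Q (D : R) (x : R) := forall y, `|x - y| < D -> `|f x - f y| <= e.
have : \forall D \near 0^'+, `[a, b] `<=` Q D.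
  apply: ncov => x _.
  have /cvgr_dist_lt/(_ _ e20) [r/= r0 fr] := cf x.
  have r20 : 0 < r / 2 by rewrite divr_gt0.
  exists (ball x (r / 2), [set D : R | 0 < D] `&` [set D : R | D < r / 2]).
    split; first exact: nbhsx_ballx.
    by apply: filterI; [exact: nbhs_right_gt|exact: nbhs_right_lt].
  move=> [x' D] /= [xx' [D0 Dr]] y x'y.
  rewrite /ball/= in xx'.
  have fx' : `|f x - f x'| < e / 2 by apply: fr => /=; lra.
  have fy : `|f x - f y| < e / 2.
    apply: fr => /=; rewrite (_ : x - y = (x - x') + (x' - y)); last by ring.
    by rewrite (le_lt_trans (ler_normD _ _))//; lra.
  rewrite (_ : f x' - f y = (f x - f y) - (f x - f x')); last by ring.
  by rewrite (le_trans (ler_normB _ _))//; lra.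
move=> H.
have [D [HD D0]] : exists D, `[a, b] `<=` Q D /\ 0 < D.
  near (0:R)^'+ => D; exists D; split; last by [].
  by near: D.
by exists D => // x y xab; apply: HD; rewrite /= in_itv.
Unshelve. all: by end_near. Qed.

Section bernstein.
Context (R : realType).
Implicit Types (phi psi : nat -> R) (x c : R) (n : nat).

(* \sum_k phi k 'C(n, k) X^k (1 - X)^(n - k), by conditioning on the first of
   n Bernoulli trials. *)
Fixpoint bernstein n phi : {poly R} :=
  if n is n'.+1 then (1 - 'X) * bernstein n' phi + 'X * bernstein n' (phi \o succn)
  else (phi 0%N)%:P.

Lemma bernsteinS n phi x : (bernstein n.+1 phi).[x] =
  (1 - x) * (bernstein n phi).[x] + x * (bernstein n (phi \o succn)).[x].
Proof. by rewrite /= !hornerE. Qed.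

Lemma le_bernstein n phi psi x : 0 <= x <= 1 ->
  (forall k, (k <= n)%N -> phi k <= psi k) ->
  (bernstein n phi).[x] <= (bernstein n psi).[x].
Proof.
move=> /andP[x0 x1].
elim: n phi psi => [|n IHn] phi psi le_phi; first by rewrite !hornerC le_phi.
rewrite !bernsteinS lerD// ler_wpM2l//; first by rewrite subr_ge0.
  by apply: IHn => k kn; apply: le_phi; exact: leqW.
by apply: IHn => k kn; exact: le_phi.
Qed.

Lemma bernstein_linear n phi psi x (a b : R) :
  (bernstein n (fun k => a * phi k + b * psi k)).[x] =
  a * (bernstein n phi).[x] + b * (bernstein n psi).[x].
Proof.
elim: n phi psi => [|n IHn] phi psi; first by rewrite !hornerC.
rewrite !bernsteinS IHn (_ : _ \o _ =
  fun k => a * (phi \o succn) k + b * (psi \o succn) k)// IHn; ring.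
Qed.

Lemma bernstein_cst n c x : (bernstein n (fun=> c)).[x] = c.
Proof.
elim: n => [|n IHn]; first by rewrite hornerC.
by rewrite bernsteinS (_ : _ \o _ = fun=> c)// IHn; ring.
Qed.

(** Squared bias plus variance of a binomial variable with parameters [n] and [x]. *)
Lemma bernstein_square n c x :
  (bernstein n (fun k => (k%:R - c) ^+ 2)).[x] =
  (n%:R * x - c) ^+ 2 + n%:R * x * (1 - x).
Proof.
elim: n c => [|n IHn] c; first by rewrite hornerC; ring.
rewrite bernsteinS IHn.
rewrite (_ : _ \o _ = fun k => (k%:R - (c - 1)) ^+ 2); last first.
  by apply/funext => k /=; rewrite -natr1; ring.
by rewrite IHn -natr1; ring.
Qed.

(** Bernstein's proof: |f(x) - f(k/n)| is at most e / 2 when k / n is within [D] of [x], and at most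
    2 M (x - k/n)^2 / D^2 otherwise. The binomial mean of the sum of both bounds is at most e / 2 +
    K / n. *)
Lemma weierstrass_unit_interval (f : R -> R) (e : R) : continuous f -> 0 < e ->
  exists p : {poly R}, forall x, 0 <= x <= 1 -> `|f x - p.[x]| <= e.
Proof.
move=> cf e0.
have e20 : 0 < e / 2 by rewrite divr_gt0.
have [D D0 fD] := @uniform_continuity_segment R f 0 1 _ cf e20.
have [M fM] : exists M : R, forall x, 0 <= x <= 1 -> `|f x| <= M.
  have /compact_bounded [M [_ HM]] : compact (f @` `[0, 1]).
    by apply: continuous_compact; [exact: continuous_subspaceT|
      exact: segment_compact].
  exists (M + 1) => x x01; apply: (HM (M + 1)); first by rewrite ltrDl.
  by exists x => //=; rewrite in_itv.
have M0 : 0 <= M by rewrite (le_trans _ (fM 0 _))// lexx ler01.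
pose K := 2 * M / D ^+ 2.
have K0 : 0 <= K by apply: divr_ge0; [exact: mulr_ge0|exact: sqr_ge0].
pose n := (Num.truncn (K / (e / 2))).+1.
have n0 : 0 < n%:R :> R by rewrite ltr0n.
have Kn : K / n%:R <= e / 2.
  by rewrite ler_pdivrMr// mulrC -ler_pdivrMr// ltW// truncnS_gt.
exists (bernstein n (fun k => f (k%:R / n%:R))) => x x01.
have near_f k : (k <= n)%N ->
    `|f x - f (k%:R / n%:R)| <= e / 2 + K / n%:R ^+ 2 * (k%:R - n%:R * x) ^+ 2.
  move=> kn; have [xk|xk] := ltP `|x - k%:R / n%:R| D.
    rewrite (le_trans (fD _ _ x01 xk))// lerDl mulr_ge0// ?sqr_ge0//.
    by rewrite divr_ge0 ?sqr_ge0.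
  have fk : `|f (k%:R / n%:R)| <= M.
    by apply: fM; rewrite divr_ge0//= ler_pdivrMr// mul1r ler_nat.
  rewrite (le_trans (ler_normB _ _))//.
  have -> : K / n%:R ^+ 2 * (k%:R - n%:R * x) ^+ 2 =
      2 * M * ((x - k%:R / n%:R) ^+ 2 / D ^+ 2).
    by rewrite /K; field; rewrite !gt_eqF.
  have : 1 <= (x - k%:R / n%:R) ^+ 2 / D ^+ 2.
    rewrite ler_pdivlMr ?exprn_gt0// mul1r -[leRHS]real_normK ?num_real//.
    by rewrite lerXn2r// nnegrE ltW.
  move=> /(ler_wpM2l (mulr_ge0 (ler0n R 2) M0)); have := fM _ x01; lra.
have var_n : (bernstein n (fun k => e / 2 * 1 +
    K / n%:R ^+ 2 * (k%:R - n%:R * x) ^+ 2)).[x] <= e.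
  rewrite bernstein_linear bernstein_cst bernstein_square.
  have -> : K / n%:R ^+ 2 * ((n%:R * x - n%:R * x) ^+ 2 + n%:R * x * (1 - x)) =
    K / n%:R * (x * (1 - x)) by field; rewrite gt_eqF.
  have Kn0 : 0 <= K / n%:R by rewrite divr_ge0.
  have xx : x * (1 - x) <= 1 by case/andP: x01 => ? ?; nra.
  have := ler_wpM2l Kn0 xx; lra.
move: var_n; set V := (V in bernstein n V) => var_n.
have VE (phi : nat -> R) c : (bernstein n (fun k => c + phi k)).[x] =
    c + (bernstein n phi).[x].
  have -> : (fun k => c + phi k) = (fun k => 1 * (fun=> c) k + 1 * phi k).
    by apply/funext => k; rewrite !mul1r.
  by rewrite bernstein_linear bernstein_cst !mul1r.
set phi := fun k => _.
have up : (bernstein n phi).[x] <= f x + (bernstein n V).[x].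
  rewrite -VE; apply: le_bernstein => // k /near_f.
  by rewrite /V /phi mulr1 ler_norml => /andP[]; lra.
have down : f x <= (bernstein n (fun k => 1 * V k + 1 * phi k)).[x].
  rewrite -{1}(bernstein_cst n (f x) x); apply: le_bernstein => // k /near_f.
  by rewrite /V /phi mulr1 ler_norml => /andP[]; lra.
move: down; rewrite bernstein_linear ler_norml => down.
by apply/andP; split; lra.
Qed.

End bernstein.

(** * The law of the walk and the Markov property *)

HB.instance Definition _ := isPointed.Build (seq int) [::].

HB.instance Definition _ := @isMeasurable.Build default_measure_display
  (seq int) discrete_measurable discrete_measurable0
  discrete_measurableC discrete_measurableU.

Lemma measurable_countable_codomain d (T : measurableType d) d'
    (U : measurableType d') (f : T -> U) :
  countable [set: U] -> (forall u, measurable (f @^-1` [set u])) ->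
  measurable_fun setT f.
Proof.
move=> cU mf _ A _; rewrite setTI.
have -> : f @^-1` A = \bigcup_u (if `[< A u >] then f @^-1` [set u] else set0).
  apply/seteqP; split => [x Afx|x [u _]].
    by exists (f x) => //; rewrite asboolT.
  by case: asboolP => // Au /= ->.
by apply: countable_bigcupT_measurable => // u; case: asboolP.
Qed.

Lemma measurable_countable_domain d (T : measurableType d) d'
    (U : measurableType d') (f : T -> U) :
  countable [set: T] -> (forall t : T, measurable [set t]) ->
  measurable_fun setT f.
Proof.
move=> cT mT _ A _; rewrite setTI.
by apply: countable_measurable => //; exact: sub_countable (subset_card_le _) cT.
Qed.

(** Independence on atoms extends by countable additivity: an injection [g] into the naturals splits
    [A] into pieces of at most one point. *)
Lemma indep_countable_codomain d (T : measurableType d) (R : realType)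
    (P : probability T R) d' (U : measurableType d') (f : T -> U) (E : set T) :
  countable [set: U] -> measurable E ->
  (forall u, measurable (f @^-1` [set u])) ->
  (forall u, P (f @^-1` [set u] `&` E) = (P (f @^-1` [set u]) * P E)%E) ->
  forall A, P (f @^-1` A `&` E) = (P (f @^-1` A) * P E)%E.
Proof.
move=> /countable_injP[g injg] mE mf f1 A.
pose F k := [set u | A u /\ g u = k].
have F1 k : F k = set0 \/ exists u, F k = [set u].
  have [->|/set0P[u [Au gu]]] := eqVneq (F k) set0; [by left|right].
  exists u; apply/seteqP; split => [v [Av gv]|v ->//].
  by apply: injg; rewrite ?inE// gv.
have mF k : measurable (f @^-1` F k).
  by case: (F1 k) => [->|[u ->]//]; rewrite preimage_set0.
have AE : f @^-1` A = \bigcup_k (f @^-1` F k).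
  by apply/seteqP; split=> [w Aw|w [k _ []//]]; exists (g (f w)).
have tF : trivIset setT (fun k => f @^-1` F k).
  by move=> i j _ _ [w [[_ <-] [_ <-]]].
rewrite AE setI_bigcupl !measure_bigcup//; last 2 first.
- by move=> k _; exact: measurableI.
- by move=> i j _ _ [w [[[_ <-] _] [[_ <-] _]]].
rewrite muleC -[P E]fineK ?fin_num_measure// -nneseriesZl//; apply: eq_eseriesr => k _.
rewrite fineK ?fin_num_measure//; case: (F1 k) => [->|[u ->]].
  by rewrite preimage_set0 set0I !measure0 mule0.
by rewrite muleC; exact: f1.
Qed.

Section walk_law.
Context d (T : measurableType d) (R : realType) (P : probability T R).
Context (X : nat -> {RV P >-> int}).
Hypothesis X_iid : iid P X.

Definition steps n (w : T) : seq int := mkseq (X ^~ w) n.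

Lemma size_steps n w : size (steps n w) = n.
Proof. exact: size_mkseq. Qed.

Lemma take_steps m n w : (m <= n)%N -> take m (steps n w) = steps m w.
Proof. by move=> mn; rewrite /steps /mkseq -map_take take_iota (minn_idPl mn). Qed.

Lemma walk_steps n w : walk X n w = \sum_(x <- steps n w) x.
Proof. by rewrite /walk big_map /index_iota subn0. Qed.

Lemma walkS n w : walk X n.+1 w = walk X n w + X n w.
Proof. by rewrite /walk big_nat_recr. Qed.

Lemma steps_eq n (s : seq int) : size s = n ->
  steps n @^-1` [set s] = \bigcap_(i in `I_n) (X i @^-1` [set nth 0 s i]).
Proof.
move=> sn; apply/seteqP; split => [w /= sw i /= iltn|w /= Xs].
  by rewrite -sw nth_mkseq.
apply: (@eq_from_nth _ 0); first by rewrite size_steps.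
by move=> i; rewrite size_steps => iltn; rewrite nth_mkseq//; exact: Xs.
Qed.

Lemma measurable_steps n : measurable_fun setT (steps n).
Proof.
apply: measurable_countable_codomain => [|s]; first exact: countableP.
have [sn|sn] := eqVneq (size s) n.
  rewrite steps_eq//; apply: bigcap_measurableType => i _.
  exact: measurable_funPTI.
rewrite (_ : _ @^-1` _ = set0)//.
by apply/seteqP; split => // w /= sw; move: sn; rewrite -sw size_steps eqxx.
Qed.

Lemma indep_prefix n (A : nat -> set int) :
  P (\bigcap_(i in `I_n) (X i @^-1` A i)) = (\prod_(i < n) P (X i @^-1` A i))%E.
Proof.
have := X_iid.1 [fset i in iota 0 n]%fset A (fun=> I).
rewrite (_ : [set` _] = `I_n); last first.
  by apply/seteqP; split => i /=; rewrite !inE mem_iota.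
move=> ->; rewrite -(big_mkord xpredT (fun i => P (X i @^-1` A i))).
apply: perm_big; apply: uniq_perm; [exact: fset_uniq|exact: iota_uniq|].
by move=> i; rewrite !inE /index_iota subn0.
Qed.

(** An atom of the past is an intersection of events on single steps, so mutual independence applies
    to [n + 1] coordinates at once. [A'] lists these events with [B] in position [n]. *)
Lemma indep_next n (A : set (seq int)) (B : set int) :
  P (steps n @^-1` A `&` X n @^-1` B) =
  (P (steps n @^-1` A) * P (X n @^-1` B))%E.
Proof.
have mB : measurable (X n @^-1` B) by exact: measurable_funPTI.
apply: indep_countable_codomain => // [|s|s].
- exact: countableP.
- by rewrite -[X in measurable X]setTI; exact: measurable_steps.
have [sn|sn] := eqVneq (size s) n; last first.
  rewrite (_ : _ @^-1` [set s] = set0) ?set0I ?measure0 ?mul0e//.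
  by apply/seteqP; split => // w /= sw; move: sn; rewrite -sw size_steps eqxx.
pose A' i := if (i < n)%N then [set nth 0 s i] else B.
have E1 : steps n @^-1` [set s] = \bigcap_(i in `I_n) (X i @^-1` A' i).
  rewrite steps_eq//; apply: eq_bigcapr => i /= iltn.
  by rewrite /A' iltn.
have E2 : steps n @^-1` [set s] `&` X n @^-1` B =
    \bigcap_(i in `I_n.+1) (X i @^-1` A' i).
  rewrite E1; apply/seteqP; split => [w [/= H Bw] i /= iltn|w /= H].
    have [ltn|gtn|->] := ltngtP i n; [exact: H|by rewrite ltnNge -ltnS iltn in gtn|].
    by rewrite /A' ltnn.
  split; first by move=> i /= iltn; apply: H => /=; exact: ltnW.
  by have := H n (ltnSn n); rewrite /A' ltnn.
have A'n : A' n = B by rewrite /A' ltnn.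
by rewrite E2 E1 !indep_prefix big_ord_recr/= A'n.
Qed.

End walk_law.

Section fubini_next.
Context d (T : measurableType d) (R : realType) (P : probability T R).
Context (X : nat -> {RV P >-> int}).
Hypothesis X_iid : iid P X.

HB.instance Definition _ n :=
  isMeasurableFun.Build _ _ _ _ (steps X n) (measurable_steps X n).

Let steps_next n (w : T) := (steps X n w, X n w).

Let measurable_steps_next n : measurable_fun setT (steps_next n).
Proof. by apply/measurable_fun_pairP; split; exact: measurable_funP. Qed.

HB.instance Definition _ n :=
  isMeasurableFun.Build _ _ _ _ (steps_next n) (measurable_steps_next n).

Let measurable_pair_fun d' (U : measurableType d')
    (K : (seq int * int)%type -> U) : measurable_fun setT K.
Proof.
apply: measurable_countable_domain; first exact: countableP.
move=> [s x]; rewrite (_ : [set (s, x)] = [set s] `*` [set x]).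
  exact: measurableX.
by apply/seteqP; split => [[? ?] [-> ->]|[? ?] [/= -> ->]].
Qed.

(** The past can be frozen while the next step is integrated: their joint law is the product law,
    and Fubini's theorem applies. Identical distribution then replaces [X n] by [X 0], so that the
    inner integral no longer depends on [n]. *)
Lemma integral_next n (K : seq int -> int -> R) :
  P.-integrable setT (fun w => (K (steps X n w) (X n w))%:E) ->
  (forall s, P.-integrable setT (fun v => (K s (X 0%N v))%:E)) ->
  (\int[P]_w (K (steps X n w) (X n w))%:E =
   \int[P]_w \int[P]_v (K (steps X n w) (X 0%N v))%:E)%E.
Proof.
move=> intK intK0.
pose K' (sx : seq int * int) : \bar R := (K sx.1 sx.2)%:E.
have m12 A : measurable A -> (distribution P (steps X n) \x
    distribution P (X n))%E A = distribution P (steps_next n) A.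
  move=> mA; apply: (product_measure_unique (m' := distribution P (steps_next n))) => //.
  by move=> B C _ _; exact: (indep_next X_iid).
have intK' : (distribution P (steps X n) \x
    distribution P (X n))%E.-integrable setT K'.
  apply/integrableP; split; first exact: measurable_pair_fun.
  rewrite (eq_measure_integral (distribution P (steps_next n))) => [|A mA _].
    rewrite ge0_integral_distribution//; first by case/integrableP: intK.
    exact: measurable_pair_fun.
  exact: m12.
rewrite (_ : (\int[P]_w (K (steps X n w) (X n w))%:E)%E =
    (\int[distribution P (steps_next n)]_z K' z)%E); last first.
  by rewrite integral_distribution//; exact: measurable_pair_fun.
rewrite -(eq_measure_integral _ (fun A mA _ => m12 A mA)).
rewrite -integral12_prod_meas1//.
pose F s := (\int[distribution P (X n)]_y K' (s, y))%E.
have FE s : F s = (\int[P]_v (K s (X 0%N v))%:E)%E.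
  rewrite /F (eq_measure_integral (distribution P (X 0%N))) => [|A mA _].
    by rewrite integral_distribution//; exact: intK0.
  exact: X_iid.2.
have intF := integrable_fubini_F intK'.
rewrite -[LHS]/(\int[distribution P (steps X n)]_s F s)%E.
rewrite integral_distribution//; last first.
  case/integrableP: intF => _ intF; apply/integrableP; split.
    by apply: measurableT_comp => //; exact: measurable_funP.
  by move: intF; rewrite ge0_integral_distribution.
by apply: eq_integral => w _; rewrite /= FE.
Qed.

End fubini_next.

Section integrable_real.
Context d (T : measurableType d) (R : realType) (P : probability T R).
Implicit Types (Y Z : T -> R).

Lemma integrable_RD Y Z : P.-integrable setT (EFin \o Y) ->
  P.-integrable setT (EFin \o Z) ->
  P.-integrable setT (EFin \o (fun w => Y w + Z w)).
Proof. by move=> iY iZ; exact: (integrableD measurableT iY iZ). Qed.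

Lemma integrable_RB Y Z : P.-integrable setT (EFin \o Y) ->
  P.-integrable setT (EFin \o Z) ->
  P.-integrable setT (EFin \o (fun w => Y w - Z w)).
Proof. by move=> iY iZ; exact: (integrableB measurableT iY iZ). Qed.

Lemma integrable_RZ c Y : P.-integrable setT (EFin \o Y) ->
  P.-integrable setT (EFin \o (fun w => c * Y w)).
Proof. by move=> iY; exact: (integrableZl measurableT c iY). Qed.

Lemma integrable_Rcst (c : R) : P.-integrable setT (EFin \o (fun=> c)).
Proof. exact: finite_measure_integrable_cst. Qed.

Lemma Rintegral_prob_cst (c : R) : \int[P]_w c = c.
Proof. by rewrite Rintegral_cst//= [P _]probability_setT mulr1. Qed.

End integrable_real.

(** * The transition operator on functions of quadratic growth *)

Section transition.
Context d (T : measurableType d) (R : realType) (P : probability T R).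
Context (X : nat -> {RV P >-> int}).
Hypothesis X_iid : iid P X.
Hypothesis X_centered : ('E_P[fun w => (X 0%N w)%:~R] = 0)%E.
Hypothesis X_finite_variance : ('V_P[fun w => (X 0%N w)%:~R] < +oo)%E.
Implicit Types (f : int -> R) (n : nat) (x y : int) (C B : R).

Let L1 (Y : T -> R) := P.-integrable setT (EFin \o Y).

Let sqr_ler (a b : R) : (a + b) ^+ 2 <= 2 * (a ^+ 2 + b ^+ 2).
Proof. by have := sqr_ge0 (a - b); nra. Qed.

Lemma integrable_step_sqr n : L1 (fun w => (X n w)%:~R ^+ 2).
Proof.
have mf : measurable_fun setT (fun x : int => ((x%:~R : R) ^+ 2)%:E).
  by [].
apply/integrableP; split.
  by apply: (measurableT_comp mf); exact: measurable_funP.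
rewrite (eq_integral ((fun x : int => ((x%:~R : R) ^+ 2)%:E) \o X n)); last first.
  by move=> w _; rewrite /= ger0_norm// sqr_ge0.
rewrite -(@ge0_integral_distribution _ _ _ _ _ P (X n))//; last first.
  by move=> y; rewrite lee_fin sqr_ge0.
rewrite (eq_measure_integral (distribution P (X 0%N))) => [|A mA _]; last first.
  exact: X_iid.2.
rewrite ge0_integral_distribution//; last by move=> y; rewrite lee_fin sqr_ge0.
move: X_finite_variance; rewrite /variance unlock X_centered /=.
rewrite unlock; congr (_ < _)%E; apply: eq_integral => w _ /=.
by congr EFin; rewrite -[LHS]/(((X 0%N w)%:~R - 0) * ((X 0%N w)%:~R - 0)) subr0.
Qed.

Lemma integrable_walk_sqr n : L1 (fun w => (walk X n w)%:~R ^+ 2).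
Proof.
elim: n => [|n IHn].
  apply: (eq_integrable measurableT (cst 0%:E)) => [w _|]; last exact: integrable0.
  by rewrite /= /walk big_nil expr0n.
apply: (@le_integrable _ _ _ P _ measurableT _ (EFin \o
    (fun w => 2 * ((walk X n w)%:~R ^+ 2 + (X n w)%:~R ^+ 2)))).
- apply/measurable_EFinP.
  rewrite (_ : (fun w => _) = (fun s => (\sum_(x <- s) x)%:~R ^+ 2) \o steps X n.+1).
    by apply: measurableT_comp => //; exact: measurable_steps.
  by apply/funext => w; rewrite /= walk_steps.
- move=> w _ /=; rewrite lee_fin walkS intrD ger0_norm ?sqr_ge0// ger0_norm.
    exact: sqr_ler.
  by rewrite mulr_ge0// addr_ge0// sqr_ge0.
- by apply: integrable_RZ; apply: integrable_RD => //; exact: integrable_step_sqr.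
Qed.

Lemma integrable_steps n (g : seq int -> R) C :
  (forall s, `|g s| <= C * (1 + (\sum_(x <- s) x)%:~R ^+ 2)) ->
  L1 (fun w => g (steps X n w)).
Proof.
move=> gC.
have C0 : 0 <= C.
  have := le_trans (normr_ge0 _) (gC [::]).
  by rewrite big_nil expr0n addr0 mulr1.
apply: (@le_integrable _ _ _ P _ measurableT _ (EFin \o
    (fun w => C * (1 + (walk X n w)%:~R ^+ 2)))).
- apply/measurable_EFinP.
  by apply: (@measurableT_comp _ _ _ _ _ _ g) => //; exact: measurable_steps.
- move=> w _ /=; rewrite lee_fin [leRHS]ger0_norm; last first.
    by rewrite mulr_ge0// addr_ge0// sqr_ge0.
  by rewrite walk_steps; exact: gC.
- apply/integrable_RZ/integrable_RD; first exact: integrable_Rcst.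
  exact: integrable_walk_sqr.
Qed.

(** A class on which a finite variance makes all expectations finite. It is stable under translation
    and under one step of the walk, and it contains the double primitives of bounded functions; the
    constant [C] never matters. *)
Definition quadratic_growth C f := forall x, `|f x| <= C * (1 + x%:~R ^+ 2).

Lemma quadratic_growth_ge0 C f : quadratic_growth C f -> 0 <= C.
Proof.
by move=> /(_ 0)/(le_trans (normr_ge0 _)); rewrite expr0n addr0 mulr1.
Qed.

Lemma quadratic_growth_bounded B f :
  (forall x, `|f x| <= B) -> quadratic_growth B f.
Proof.
move=> fB x; rewrite (le_trans (fB x))// ler_peMr ?lerDl ?sqr_ge0//.
exact: le_trans (normr_ge0 _) (fB 0).
Qed.

Lemma quadratic_growth_shift C f y : quadratic_growth C f ->
  quadratic_growth (2 * C * (1 + y%:~R ^+ 2)) (fun x => f (x + y)).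
Proof.
move=> fC x; rewrite (le_trans (fC _))//.
have -> : 2 * C * (1 + y%:~R ^+ 2) * (1 + x%:~R ^+ 2) =
    C * (2 * (1 + y%:~R ^+ 2) * (1 + x%:~R ^+ 2)) by ring.
rewrite ler_wpM2l ?(quadratic_growth_ge0 fC)//.
rewrite intrD; have := sqr_ler x%:~R y%:~R.
have : 0 <= (x%:~R : R) ^+ 2 * y%:~R ^+ 2 by rewrite mulr_ge0// sqr_ge0.
by have := sqr_ge0 (x%:~R : R); have := sqr_ge0 (y%:~R : R); nra.
Qed.

Lemma integrable_bounded_steps n (Phi : seq int -> R) B f C :
  (forall s, `|Phi s| <= B) -> quadratic_growth C f ->
  L1 (fun w => Phi (steps X n w) * f (walk X n w)).
Proof.
move=> PhiB fC.
under eq_fun do rewrite walk_steps.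
apply: (@integrable_steps n (fun s => Phi s * f (\sum_(x <- s) x)) (B * C)) => s.
rewrite normrM -mulrA; apply: ler_pM => //; exact: fC.
Qed.

Lemma integrable_walk n f C : quadratic_growth C f ->
  L1 (fun w => f (walk X n w)).
Proof.
move=> fC; under eq_fun do rewrite walk_steps.
by apply: (@integrable_steps n (fun s => f (\sum_(x <- s) x)) C) => s; exact: fC.
Qed.

(** This is P^n f for the Markov operator P of the walk. *)
Definition transition n f x : R := \int[P]_w f (x + walk X n w).

Lemma integrable_transition n f C x : quadratic_growth C f ->
  L1 (fun w => f (x + walk X n w)).
Proof.
move=> /(quadratic_growth_shift x)/integrable_walk => /(_ n).
by apply: eq_integrable => // w _; rewrite /= addrC.
Qed.

(** The second moment is the variance because the steps are centred. *)
Definition step_variance : R := \int[P]_w (X 0%N w)%:~R ^+ 2.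

Lemma step_variance_ge0 : 0 <= step_variance.
Proof. by apply: Rintegral_ge0 => w _; exact: sqr_ge0. Qed.

Lemma walk1 w : walk X 1 w = X 0%N w.
Proof. by rewrite /walk big_nat1. Qed.

Lemma quadratic_growth_transition1 C f : quadratic_growth C f ->
  quadratic_growth (2 * C * (1 + step_variance)) (transition 1 f).
Proof.
move=> fC x.
have C0 := quadratic_growth_ge0 fC.
rewrite /transition (le_trans (le_normr_Rintegral _ _))//.
  exact: (integrable_transition _ _ fC).
pose g (y : int) : R := 2 * C * (1 + x%:~R ^+ 2) + 2 * C * y%:~R ^+ 2.
have gC : quadratic_growth (2 * C * (1 + x%:~R ^+ 2)) g.
  move=> y; rewrite ger0_norm /g.
    have : 0 <= C * ((x%:~R : R) ^+ 2 * y%:~R ^+ 2).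
      by apply: mulr_ge0 => //; apply: mulr_ge0; exact: sqr_ge0.
    by lra.
  have := mulr_ge0 C0 (sqr_ge0 (x%:~R : R)).
  by have := mulr_ge0 C0 (sqr_ge0 (y%:~R : R)); lra.
apply: (@le_trans _ _ (\int[P]_w g (walk X 1 w))).
  apply: le_Rintegral => //.
  - have /integrable_norm := integrable_transition 1 x fC.
    by apply.
  - exact: integrable_walk gC.
  move=> w _; rewrite (le_trans (fC _))// /g intrD.
  have := sqr_ler x%:~R (walk X 1 w)%:~R => /(ler_wpM2l C0).
  by lra.
have -> : \int[P]_w g (walk X 1 w) =
    2 * C * (1 + x%:~R ^+ 2) + 2 * C * step_variance.
  rewrite /g RintegralD//.
  - rewrite Rintegral_prob_cst RintegralZl//; last exact: integrable_walk_sqr.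
    by congr (_ + _ * _); apply: eq_Rintegral => w _; rewrite walk1.
  - exact: integrable_Rcst.
  - by apply: integrable_RZ; exact: integrable_walk_sqr.
have : 0 <= C * (step_variance * (x%:~R : R) ^+ 2).
  by apply: mulr_ge0 => //; apply: mulr_ge0; [exact: step_variance_ge0|exact: sqr_ge0].
by lra.
Qed.

End transition.

Section markov.
Context d (T : measurableType d) (R : realType) (P : probability T R).
Context (X : nat -> {RV P >-> int}).
Hypothesis X_iid : iid P X.
Hypothesis X_centered : ('E_P[fun w => (X 0%N w)%:~R] = 0)%E.
Hypothesis X_finite_variance : ('V_P[fun w => (X 0%N w)%:~R] < +oo)%E.
Implicit Types (f : int -> R) (n : nat) (x y : int) (C B : R).

Let int_walk := integrable_walk X_iid X_centered X_finite_variance.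
Let int_trans := integrable_transition X_iid X_centered X_finite_variance.
Let int_bounded := integrable_bounded_steps X_iid X_centered X_finite_variance.
Let int_sqr := integrable_walk_sqr X_iid X_centered X_finite_variance.
Let qgt1 := quadratic_growth_transition1 X_iid X_centered X_finite_variance.

(** The factor [Phi] may depend on the whole past, which is what the discount by the occupation time
    requires. *)
Lemma markov_step n (Phi : seq int -> R) B f C :
  (forall s, `|Phi s| <= B) -> quadratic_growth C f ->
  \int[P]_w (Phi (steps X n w) * f (walk X n.+1 w)) =
  \int[P]_w (Phi (steps X n w) * transition X 1 f (walk X n w)).
Proof.
move=> PhiB fC; congr fine.
pose K s x := Phi s * f (\sum_(y <- s) y + x).
have intK0 s : P.-integrable setT (EFin \o (fun v => f (\sum_(y <- s) y + X 0%N v))).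
  have := int_trans 1 (\sum_(y <- s) y) fC; apply: eq_integrable => // w _.
  by rewrite /= walk1.
rewrite (eq_integral (fun w => (K (steps X n w) (X n w))%:E)); last first.
  by move=> w _; rewrite /K walkS walk_steps.
rewrite (integral_next X_iid) => [|//|s].
- apply: eq_integral => w _; rewrite /K walk_steps.
  rewrite (_ : transition X 1 f _ =
    \int[P]_v f (\sum_(y <- steps X n w) y + X 0%N v)); last first.
    by apply: eq_Rintegral => v _; rewrite walk1.
  rewrite -RintegralZl// fineK//; apply: integrable_fin_num => //.
  exact: integrable_RZ.
- have := @int_bounded n.+1 (fun s => Phi (take n s)) B f C (fun s => PhiB _) fC.
  apply: eq_integrable => // w _; rewrite /= take_steps// /K.
  by rewrite walkS walk_steps.
- exact: integrable_RZ.
Qed.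

Lemma transition0 f x : transition X 0 f x = f x.
Proof.
rewrite /transition; under eq_Rintegral do rewrite /walk big_nil addr0.
exact: Rintegral_prob_cst.
Qed.

Lemma transition_shift n f x y :
  transition X n (fun z => f (y + z)) x = transition X n f (y + x).
Proof. by apply: eq_Rintegral => w _; rewrite addrA. Qed.

Lemma transitionSr n f C x : quadratic_growth C f ->
  transition X n.+1 f x = transition X n (transition X 1 f) x.
Proof.
move=> fC; have fxC := quadratic_growth_shift x fC.
have := @markov_step n (fun=> 1) 1 (fun y => f (x + y)) _
  (fun s => _) _.
rewrite normr1 => /(_ _ (fun=> lexx _)) H.
transitivity (\int[P]_w (1 * f (x + walk X n.+1 w))).
  by apply: eq_Rintegral => w _; rewrite mul1r.
rewrite (H (2 * C * (1 + x%:~R ^+ 2))); last by move=> y; rewrite addrC; exact: fxC.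
by apply: eq_Rintegral => w _; rewrite mul1r transition_shift.
Qed.

Lemma markov_property m n (Phi : seq int -> R) B f C :
  (forall s, `|Phi s| <= B) -> quadratic_growth C f ->
  \int[P]_w (Phi (steps X m w) * f (walk X (m + n) w)) =
  \int[P]_w (Phi (steps X m w) * transition X n f (walk X m w)).
Proof.
move=> PhiB; elim: n f C => [|n IHn] f C fC.
  by rewrite addn0; apply: eq_Rintegral => w _; rewrite transition0.
(* A function of the first [m] steps is read, through [take m], as a function of the longer past, to
   which the one-step property applies. *)
transitivity (\int[P]_w (Phi (take m (steps X (m + n) w)) *
    transition X 1 f (walk X (m + n) w))).
  rewrite addnS -(@markov_step _ (fun s => Phi (take m s)) B f C)//.
  by apply: eq_Rintegral => w _; rewrite take_steps// leq_addr.
transitivity (\int[P]_w (Phi (steps X m w) *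
    transition X 1 f (walk X (m + n) w))).
  by apply: eq_Rintegral => w _; rewrite take_steps// leq_addr.
rewrite (IHn _ _ (qgt1 fC)); apply: eq_Rintegral => w _.
by rewrite -(transitionSr _ _ fC).
Qed.

Lemma Rintegral_step : \int[P]_w (X 0%N w)%:~R = 0 :> R.
Proof. by rewrite /Rintegral; move: X_centered; rewrite unlock => ->. Qed.

Lemma integrable_walk_id n : P.-integrable setT (EFin \o (fun w => (walk X n w)%:~R : R)).
Proof.
apply: (@int_walk n (fun x => x%:~R) 1) => x.
rewrite mul1r -(real_normK (num_real x%:~R)).
by have := sqr_ge0 (`|x%:~R : R| - 1); have := normr_ge0 (x%:~R : R); nra.
Qed.

Lemma Rintegral_walk_sqr n :
  \int[P]_w (walk X n w)%:~R ^+ 2 = n%:R * step_variance X.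
Proof.
pose f x : R := x%:~R ^+ 2.
have fC : quadratic_growth 1 f.
  by move=> x; rewrite mul1r ger0_norm ?sqr_ge0// lerDr.
elim: n => [|n IHn].
  rewrite mul0r; under eq_Rintegral do rewrite /walk big_nil expr0n/=.
  exact: Rintegral_prob_cst.
have t1 x : transition X 1 f x = f x + step_variance X.
  rewrite /transition.
  transitivity (\int[P]_w ((f x + 2 * x%:~R * (walk X 1 w)%:~R) + (walk X 1 w)%:~R ^+ 2)).
    by apply: eq_Rintegral => w _; rewrite /f intrD; ring.
  have iC := integrable_Rcst P (f x).
  have iW := integrable_walk_id 1.
  have iZ := integrable_RZ (2 * x%:~R) iW.
  rewrite (RintegralD _ (integrable_RD iC iZ) (int_sqr 1))//.
  rewrite (RintegralD _ iC iZ)// RintegralZl// Rintegral_prob_cst.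
  under eq_Rintegral do rewrite walk1.
  rewrite Rintegral_step mulr0 addr0; congr (_ + _).
  by apply: eq_Rintegral => w _; rewrite walk1.
rewrite -[LHS]/(\int[P]_w f (walk X n.+1 w)).
transitivity (\int[P]_w (1 * f (walk X n.+1 w))).
  by apply: eq_Rintegral => w _; rewrite mul1r.
rewrite (@markov_step n (fun=> 1) 1 f 1) => [|s|//]; last by rewrite normr1.
transitivity (\int[P]_w (f (walk X n w) + step_variance X)).
  by apply: eq_Rintegral => w _; rewrite mul1r t1.
rewrite RintegralD//; [|exact: int_sqr|exact: integrable_Rcst].
by rewrite Rintegral_prob_cst IHn -natr1 mulrDl mul1r.
Qed.

(** The elementary bound |y| <= a + y^2 / a replaces the Cauchy-Schwarz inequality; with [a] of
    order sqrt n the right-hand side is of order sqrt n. *)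
Lemma Rintegral_norm_walk n (a : R) : 0 < a ->
  \int[P]_w `|(walk X n w)%:~R : R| <= a + n%:R * step_variance X / a.
Proof.
move=> a0.
have -> : a + n%:R * step_variance X / a =
    \int[P]_w (a + a^-1 * (walk X n w)%:~R ^+ 2).
  rewrite (RintegralD _ (integrable_Rcst P a) (integrable_RZ a^-1 (int_sqr n)))//.
  rewrite RintegralZl//.
  by rewrite Rintegral_prob_cst Rintegral_walk_sqr mulrC [a^-1 * _]mulrC.
apply: le_Rintegral => //.
- exact: (integrable_norm (integrable_walk_id n)).
- apply: integrable_RD; first exact: integrable_Rcst.
  by apply: integrable_RZ; exact: int_sqr.
move=> w _; set y : R := (walk X n w)%:~R.
rewrite -(real_normK (num_real y)) -(ler_pM2l a0) mulrDr mulVKf ?gt_eqF//.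
by have := sqr_ge0 (`|y| - a); have := normr_ge0 y; nra.
Qed.

Lemma chebyshev_walk n (J : nat) : (0 < J)%N ->
  \int[P]_w (J < `|walk X n w|)%N%:R <= n%:R * step_variance X / J%:R ^+ 2 :> R.
Proof.
move=> J0.
have J0R : 0 < J%:R ^+ 2 :> R by rewrite exprn_gt0// ltr0n.
have -> : n%:R * step_variance X / J%:R ^+ 2 =
    \int[P]_w ((J%:R ^+ 2)^-1 * (walk X n w)%:~R ^+ 2).
  rewrite RintegralZl//.
  by rewrite Rintegral_walk_sqr mulrC.
apply: le_Rintegral => //.
- apply: (@int_walk n (fun x => (J < `|x|)%N%:R) 1); apply: quadratic_growth_bounded.
  by move=> x; rewrite normr_nat; case: ltnP.
- by apply: integrable_RZ; exact: int_sqr.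
move=> w _; case: ltnP => [Jw|_]; last first.
  by rewrite mulr_ge0 ?sqr_ge0// invr_ge0 ltW.
rewrite mulrC ler_pdivlMr// mul1r -[leRHS]real_normK ?num_real//.
rewrite lerXn2r ?nnegrE// -intr_norm -abszE -pmulrn ler_nat; exact: ltnW.
Qed.

End markov.

(** * Loss of memory of the starting point *)

Section coupling.
Context d (T : measurableType d) (R : realType) (P : probability T R).
Context (X : nat -> {RV P >-> int}).
Hypothesis X_iid : iid P X.
Hypothesis X_centered : ('E_P[fun w => (X 0%N w)%:~R] = 0)%E.
Hypothesis X_finite_variance : ('V_P[fun w => (X 0%N w)%:~R] < +oo)%E.
Implicit Types (f g h : int -> R) (k m n : nat) (a b x y z : int) (C B : R).

Let int_walk := integrable_walk X_iid X_centered X_finite_variance.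
Let int_trans := integrable_transition X_iid X_centered X_finite_variance.
Let markov := markov_property X_iid X_centered X_finite_variance.

Lemma transitionB n f g C C' x :
  quadratic_growth C f -> quadratic_growth C' g ->
  transition X n (fun y => f y - g y) x = transition X n f x - transition X n g x.
Proof.
by move=> fC gC; rewrite /transition RintegralB//; exact: int_trans.
Qed.

Lemma transitionZ n f c C x : quadratic_growth C f ->
  transition X n (fun y => c * f y) x = c * transition X n f x.
Proof.
by move=> fC; rewrite /transition RintegralZl//; exact: int_trans.
Qed.

Lemma transition_cst n c x : transition X n (fun=> c) x = c.
Proof. exact: Rintegral_prob_cst. Qed.

Lemma le_transition n f g C C' x :
  quadratic_growth C f -> quadratic_growth C' g -> (forall y, f y <= g y) ->
  transition X n f x <= transition X n g x.
Proof.
by move=> fC gC fg; apply: le_Rintegral => //; exact: int_trans.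
Qed.

Lemma transition_bounded n f B x : (forall y, `|f y| <= B) ->
  `|transition X n f x| <= B.
Proof.
move=> fB; have fC := quadratic_growth_bounded fB.
have cC : quadratic_growth `|B| (fun=> B) by apply: quadratic_growth_bounded.
have ncC : quadratic_growth `|B| (fun=> - B).
  by apply: quadratic_growth_bounded => y; rewrite normrN.
rewrite ler_norml -{1}(transition_cst n (- B) x) -{2}(transition_cst n B x).
by apply/andP; split; [apply: le_transition ncC fC _|apply: le_transition fC cC _]
  => y; have := fB y; rewrite ler_norml => /andP[].
Qed.

Lemma transition_add m n f C x : quadratic_growth C f ->
  transition X (m + n) f x = transition X m (transition X n f) x.
Proof.
move=> fC; have fxC := quadratic_growth_shift x fC.
have := @markov m n (fun=> 1) 1 (fun y => f (x + y)) (2 * C * (1 + x%:~R ^+ 2)).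
rewrite normr1 => /(_ (fun=> lexx _)) H.
transitivity (\int[P]_w (1 * f (x + walk X (m + n) w))).
  by apply: eq_Rintegral => w _; rewrite mul1r.
rewrite H; last by move=> y; rewrite addrC; exact: fxC.
by apply: eq_Rintegral => w _; rewrite mul1r transition_shift.
Qed.

Definition point_mass n x : R := \int[P]_w (walk X n w == x)%:R.

Let bounded_pt x y : `|(y == x)%:R : R| <= 1.
Proof. by case: eqP; rewrite ?normr1 ?normr0. Qed.

Let qg_pt x := quadratic_growth_bounded (bounded_pt x).

Lemma point_mass_probability n x :
  (point_mass n x)%:E = P [set w | walk X n w = x].
Proof.
have mE : measurable [set w | walk X n w = x].
  rewrite (_ : [set _ | _] = steps X n @^-1` [set s | \sum_(y <- s) y = x]).
    by rewrite -[X in measurable X]setTI; exact: measurable_steps.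
  by apply/seteqP; split => w /=; rewrite walk_steps.
rewrite -[RHS]fineK ?fin_num_measure//; congr EFin.
rewrite /point_mass /Rintegral; congr fine.
rewrite -[in RHS](setIT [set w | _]) -integral_indic//.
apply: eq_integral => w _; rewrite indicE; congr (_%:R%:E).
by case: eqP => [?|?]; [rewrite mem_set|rewrite memNset].
Qed.

Lemma point_mass_ge0 n x : 0 <= point_mass n x.
Proof. exact: Rintegral_ge0. Qed.

Lemma point_mass_gt0 n x :
  (0 < point_mass n x) = (0 < P [set w | walk X n w = x])%E.
Proof. by rewrite -lte_fin point_mass_probability. Qed.

Lemma point_massD m n x y :
  point_mass m x * point_mass n y <= point_mass (m + n) (x + y).
Proof.
pose Phi s : R := (\sum_(z <- s) z == x)%:R.
have PhiB s : `|Phi s| <= 1 by exact: bounded_pt.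
have PhiE w : Phi (steps X m w) = (walk X m w == x)%:R by rewrite /Phi walk_steps.
have := @markov m n _ _ _ _ PhiB (qg_pt (x + y)).
rewrite (_ : \int[P]_w _ = \int[P]_w ((walk X m w == x)%:R *
    (walk X (m + n) w == x + y)%:R)); last first.
  by apply: eq_Rintegral => w _; rewrite PhiE.
rewrite (_ : \int[P]_w (_ * transition _ _ _ _) =
    point_mass m x * point_mass n y); last first.
  rewrite /point_mass -RintegralZr//; last exact: (@int_walk m _ _ (qg_pt x)).
  apply: eq_Rintegral => w _; rewrite PhiE; case: eqP => [->|_]; last by rewrite !mul0r.
  rewrite !mul1r; apply: eq_Rintegral => v _.
  by rewrite (inj_eq (addrI x)).
move=> <-; apply: le_Rintegral => //; last 2 first.
- exact: (int_walk _ (qg_pt (x + y))).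
- by move=> w _; case: eqP; rewrite ?mul0r ?mul1r.
have := integrable_bounded_steps X_iid X_centered X_finite_variance (m + n)
  (Phi := fun s => Phi (take m s)) (fun s => PhiB _) (qg_pt (x + y)).
by apply: eq_integrable => // w _; rewrite /= take_steps ?leq_addr// PhiE.
Qed.

Lemma point_massM k (j : nat) x : point_mass k x ^+ j <=
  point_mass (j * k) (x *+ j).
Proof.
elim: j => [|j IHj].
  rewrite expr0 mulr0n -[leLHS](Rintegral_prob_cst P) le_eqVlt; apply/orP; left.
  by apply/eqP/eq_Rintegral => w _; rewrite mul0n /walk big_nil eqxx.
rewrite exprS mulSn mulrS; apply: le_trans (point_massD _ _ _ _).
by rewrite ler_wpM2l// point_mass_ge0.
Qed.

(** The supremum of this set is the total variation distance, normalised to lie between 0 and 2, of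
    the laws at time [n] of the walk started at 0 and at [z]. *)
Definition gap_set n z : set R := [set r | exists2 f, forall x, `|f x| <= 1 &
  r = transition X n f 0 - transition X n f z].

Definition gap n z : R := sup (gap_set n z).

Lemma has_sup_gap n z : has_sup (gap_set n z).
Proof.
split.
  exists 0, (fun=> 0); first by move=> x; rewrite normr0.
  by rewrite !transition_cst subrr.
exists 2 => _ [f f1 ->]; rewrite (le_trans (ler_norm _))//.
rewrite (le_trans (ler_normB _ _))// (_ : 2 = 1 + 1)// lerD//;
exact: transition_bounded.
Qed.

Lemma gap_ub n f x z : (forall y, `|f y| <= 1) ->
  transition X n f x - transition X n f (x + z) <= gap n z.
Proof.
move=> f1; apply: sup_upper_bound; first exact: has_sup_gap.
by exists (fun y => f (x + y)) => //; rewrite !transition_shift addr0.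
Qed.

Lemma gap_norm n f x z : (forall y, `|f y| <= 1) ->
  `|transition X n f x - transition X n f (x + z)| <= gap n z.
Proof.
move=> f1; rewrite ler_norml gap_ub// andbT lerNl.
have := @gap_ub n (fun y => -1 * f y) x z.
rewrite !(transitionZ _ _ _ (quadratic_growth_bounded f1)) => H.
by apply: le_trans (H _); [lra|move=> y; rewrite mulN1r normrN].
Qed.

Lemma gap_ge0 n z : 0 <= gap n z.
Proof.
by have := @gap_ub n (fun=> 0) 0 z; rewrite !transition_cst subrr; apply => y;
  rewrite normr0.
Qed.

Lemma gap_le n z e : (forall f, (forall y, `|f y| <= 1) ->
  transition X n f 0 - transition X n f z <= e) -> gap n z <= e.
Proof.
by move=> H; apply: ge_sup; [case: (has_sup_gap n z)|move=> _ [f f1 ->]; exact: H].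
Qed.

Lemma le_gap m n z : (m <= n)%N -> gap n z <= gap m z.
Proof.
move=> mn; apply: gap_le => f f1; have fC := quadratic_growth_bounded f1.
rewrite -(subnKC mn) !(transition_add m (n - m) _ fC).
have := @gap_ub m (transition X (n - m) f) 0 z; rewrite add0r; apply.
by move=> y; exact: transition_bounded.
Qed.

Lemma gapD n y z : gap n (y + z) <= gap n y + gap n z.
Proof.
apply: gap_le => f f1; have := gap_ub n 0 y f1; have := gap_ub n y z f1.
by rewrite add0r; lra.
Qed.

Lemma gapN n z : gap n (- z) <= gap n z.
Proof.
apply: gap_le => f f1; have := gap_norm n (- z) z f1.
by rewrite addNr distrC; apply: le_trans; exact: ler_norm.
Qed.

Lemma point_mass_le_transition n y f B : (forall x, 0 <= f x <= B) ->
  point_mass n y * f y <= transition X n f 0.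
Proof.
move=> fB; have fC : quadratic_growth B f.
  by apply: quadratic_growth_bounded => x; case/andP: (fB x) => f0 ?; rewrite ger0_norm.
rewrite /point_mass -RintegralZr//; last exact: (@int_walk n _ _ (qg_pt y)).
apply: le_Rintegral => //.
- rewrite (_ : _ \o _ = EFin \o (fun w => f y * (walk X n w == y)%:R)).
    by apply: integrable_RZ; exact: (@int_walk n _ _ (qg_pt y)).
  by apply/funext => w /=; rewrite mulrC.
- exact: int_trans fC.
move=> w _; rewrite add0r; case: eqP => [->|_]; first by rewrite mul1r.
by rewrite mul0r; case/andP: (fB (walk X n w)).
Qed.

Lemma point_mass_le1 n x : point_mass n x <= 1.
Proof.
rewrite -lee_fin point_mass_probability; apply: probability_le1.
rewrite (_ : [set _ | _] = steps X n @^-1` [set s | \sum_(y <- s) y = x]).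
  by rewrite -[X in measurable X]setTI; exact: measurable_steps.
by apply/seteqP; split => w /=; rewrite walk_steps.
Qed.

(* If P^n f nearly attains its largest possible increment along z = a - b at
   some point, then it does so too at the points Jb + jz, j <= J, which the walk
   reaches with positive probability at time Jk; the increments add up to at
   most 2. *)
Lemma gap_vanishes k a b : 0 < point_mass k a -> 0 < point_mass k b ->
  forall e : R, 0 < e -> exists n, gap n (a - b) <= e.
Proof.
move=> pa0 pb0 e e0; pose z : int := a - b; rewrite -/z.
pose D := [set gap n z | n in [set: nat]].
have infD : has_inf D.
  split; first by exists (gap 0 z), 0%N.
  by exists 0 => _ [n _ <-]; exact: gap_ge0.
(* As [J] is arbitrary, the infimum lies below every [e > 0]. The 3 is the largest possible
   increment 2 of a function bounded by 1, plus a total defect of 1. *)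
suff Dle (J : nat) : J.+1%:R * inf D <= 3.
  have infe : inf D < e.
    pose J := Num.truncn (3 / e).
    have : 3 / e < J.+1%:R by exact: truncnS_gt.
    rewrite ltr_pdivrMr// => He; have := le_lt_trans (Dle J) He.
    by rewrite ltr_pM2l// ltr0n.
  have [_ [n _ <-] nD] := inf_adherent (ltac:(rewrite subr_gt0; exact: infe) : 0 < e - inf D) infD.
  by exists n; rewrite ltW// (lt_le_trans nD)// addrC subrK.
(* [c] bounds from below the probability of each point [y j] at time [J k]. A defect whose mean is
   at most [2 eta] is then at most 1 / (J + 1) at each of these points. *)
pose c := (point_mass k a * point_mass k b) ^+ J.
have c0 : 0 < c by rewrite exprn_gt0// mulr_gt0.
pose eta := c / (2 * J.+1%:R).
have eta0 : 0 < eta by rewrite divr_gt0// mulr_gt0.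
have [_ [n0 _ <-] n0D] := inf_adherent eta0 infD.
have : inf D <= gap (J * k + n0) z by apply: ge_inf => //; [case: infD|exists (J * k + n0)%N].
have [_ [f f1 ->] fD] := sup_adherent eta0 (has_sup_gap (J * k + n0) z).
rewrite -/(gap _ _) in fD => Dgap.
have fC := quadratic_growth_bounded f1.
pose G := transition X n0 f.
have G1 x : `|G x| <= 1 by exact: transition_bounded.
pose g x := G x - G (x + z).
pose M := inf D + eta.
have gM x : `|g x| <= M by rewrite (le_trans (gap_norm n0 x z f1))// ltW.
have gC := quadratic_growth_bounded gM.
have GC := quadratic_growth_bounded G1.
have GzC : quadratic_growth 1 (fun x => G (x + z)) by exact: quadratic_growth_bounded.
have gD : inf D - eta <= transition X (J * k) g 0.
  rewrite (transitionB _ _ GC GzC).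
  rewrite (_ : (fun x => G (x + z)) = fun x => G (z + x)); last first.
    by apply/funext => x; rewrite addrC.
  rewrite transition_shift addr0 /G -!(transition_add (J * k) n0 _ fC); lra.
have near_max y : c <= point_mass (J * k) y -> M - J.+1%:R^-1 <= g y.
  move=> cy.
  have u2M x : 0 <= M - g x <= 2 * M.
    by have := gM x; rewrite ler_norml => /andP[]; lra.
  have := point_mass_le_transition (J * k) y u2M.
  rewrite (@transitionB _ (fun=> M) g `|M| M)//; last first.
    by apply: quadratic_growth_bounded.
  rewrite transition_cst => H.
  have : c * (M - g y) <= 2 * eta.
    have /andP[Mg _] := u2M y; have := ler_wpM2r Mg cy; rewrite /M in H *; lra.
  rewrite -ler_pdivlMl// /eta.
  have -> : c^-1 * (2 * (c / (2 * J.+1%:R))) = J.+1%:R^-1.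
    by field; rewrite gt_eqF//= gt_eqF// ltr0n.
  by rewrite lerBlDl -lerBlDr.
pose y (j : nat) : int := b *+ J + z *+ j.
have yD j : (j <= J)%N -> M - J.+1%:R^-1 <= g (y j).
  move=> jJ; apply: near_max.
  have -> : y j = a *+ j + b *+ (J - j).
    by rewrite /y /z mulrnBl mulrnBr//; ring.
  rewrite -{1}(subnKC jJ) mulnDl; apply: le_trans (point_massD _ _ _ _).
  apply: (@le_trans _ _ (point_mass k a ^+ j * point_mass k b ^+ (J - j))).
    rewrite /c exprMn_comm; last exact: mulrC.
    by apply: ler_pM; rewrite ?exprn_ge0 ?point_mass_ge0//;
      apply: ler_wiXn2l; rewrite ?point_mass_ge0 ?point_mass_le1// leq_subr.
  by apply: ler_pM; rewrite ?exprn_ge0 ?point_mass_ge0// point_massM.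
have tele : \sum_(0 <= j < J.+1) g (y j) = G (y 0%N) - G (y J.+1).
  rewrite (eq_bigr (fun j => - (G (y j.+1) - G (y j)))) => [|j _].
    by rewrite sumrN telescope_sumr// opprB.
  have yS : y j + z = y j.+1 by rewrite /y -addrA -mulrSr.
  by rewrite opprB /g yS.
have Jg : J.+1%:R * (M - J.+1%:R^-1) <= \sum_(0 <= j < J.+1) g (y j).
  rewrite big_mkord mulr_natl -[X in _ *+ X]card_ord -sumr_const.
  by apply: ler_sum => j _; apply: yD; rewrite -ltnS.
have G2 : G (y 0%N) - G (y J.+1) <= 2.
  rewrite (le_trans (ler_norm _))// (le_trans (ler_normB _ _))//.
  by have := G1 (y 0%N); have := G1 (y J.+1); lra.
move: Jg; rewrite tele mulrBr mulfV ?pnatr_eq0// => Jg.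
have : J.+1%:R * inf D <= J.+1%:R * M by rewrite ler_wpM2l// /M lerDl ltW.
by lra.
Qed.

Context (X_nondegenerate : nondegenerate_walk P X).
Context (X_aperiodic : aperiodic_walk P X).

(** Since [gap] does not increase with [n], this says that the laws started at 0 and at [z] merge.
    By subadditivity of [gap] such [z] form a subgroup, which is to be shown equal to Z. *)
Let forgets z := forall e : R, 0 < e -> exists n, gap n z <= e.

Let forgetsD y z : forgets y -> forgets z -> forgets (y + z).
Proof.
move=> fy fz e e0; have e20 : 0 < e / 2 by rewrite divr_gt0.
have [n ny] := fy _ e20; have [m mz] := fz _ e20.
exists (n + m)%N; rewrite (le_trans (gapD _ _ _))//.
have := le_gap y (leq_addr m n); have := le_gap z (leq_addl n m); lra.
Qed.

Let forgetsN z : forgets z -> forgets (- z).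
Proof. by move=> fz e /fz[n nz]; exists n; exact: le_trans (gapN _ _) nz. Qed.

Let forgets0 : forgets 0.
Proof.
move=> e e0; exists 0%N; apply: gap_le => f f1; rewrite subrr; exact: ltW.
Qed.

Let forgetsMn z (n : nat) : forgets z -> forgets (z *+ n).
Proof.
by move=> fz; elim: n => [|n IHn]; rewrite ?mulr0n ?mulrS//; exact: forgetsD.
Qed.

(* Return times n satisfy n x \in forgets, and their gcd is 1. *)
Let forgets_step x : 0 < point_mass 1 x -> forgets x.
Proof.
move=> px0.
(* At time [n] the walk can be at n x, by [n] equal steps, and also at 0: two points charged at the
   same time, as [gap_vanishes] requires. *)
have return_time n : (0 < n)%N -> (0 < P [set w | walk X n w = 0%R])%E ->
    forgets (x *+ n).
  move=> n0; rewrite -point_mass_gt0 => pn0; rewrite -[_ *+ n]subr0.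
  apply: (@gap_vanishes n) => //.
  by have := point_massM 1 n x; rewrite muln1; apply: lt_le_trans; rewrite exprn_gt0.
have [A1 A2] := X_aperiodic.
have [m m0 fm] : exists2 m : nat, (0 < m)%N & forgets (x *+ m).
  have [[n [n0 pn]]|/forallNP nA] := pselect (exists n, (0 < n)%N /\
      (0 < P [set w | walk X n w = 0%R])%E).
    by exists n => //; exact: return_time.
  (* If there were no return time, 0 would be a common divisor and would have to divide 1. *)
  by have := A2 0%N; rewrite dvd0n => /(_ (fun n An => False_ind _ (nA n An))).
(* The least positive [m] with [x *+ m] in the subgroup divides every return time, by division with
   remainder; as a common divisor it divides 1. *)
pose Q m := (0 < m)%N && `[< forgets (x *+ m) >].
have exQ : exists m, Q m by exists m; rewrite /Q m0/=; exact/asboolP.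
case: (ex_minnP exQ) => g /andP[g0 /asboolP fg] gmin.
suff : (g %| 1)%N by rewrite dvdn1 => /eqP g1; move: fg; rewrite g1.
apply: A2 => n [n0 pn].
have fr : forgets (x *+ (n %% g)).
  have := forgetsD (return_time n n0 pn) (forgetsN (forgetsMn (n %/ g) fg)).
  by rewrite {1}(divn_eq n g) mulrnDr -mulrnA mulnC addrC addrA addNr add0r.
rewrite /dvdn; apply: contrapT => /negP; rewrite -lt0n => r0.
have := gmin (n %% g)%N; rewrite /Q r0/= => /(_ (asboolT fr)).
by rewrite leqNgt ltn_mod g0.
Qed.

(** The subgroup contains every atom of the step law. The steps outside it form a countable union of
    null events, so it supports the step, and non-degeneracy makes it all of Z. *)
Let forgets_all x : forgets x.
Proof.
have : smallest_supporting_group (X 0%N) `<=` [set z | forgets z].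
  apply: bigcap_inf; split.
    split => [|y z]; rewrite !inE /= ?inE; first exact: forgets0.
    by move=> fy fz; exact: forgetsD (forgetsN fz).
  have mX A : measurable (X 0%N @^-1` A) by exact: measurable_funPTI.
  suff : P (X 0%N @^-1` (~` [set z | forgets z])) = 0%E.
    move=> H0; rewrite -[_ @^-1` [set z | _]]setCK preimage_setC.
    by rewrite probability_setC// H0 sube0.
  pose F n : set T := if @choice.unpickle int n is Some z then
    X 0%N @^-1` (~` [set z | forgets z] `&` [set z]) else set0.
  have PF n : P (F n) = 0%E.
    rewrite /F; case: choice.unpickle => [z|]; last exact: measure0.
    have [fz|nfz] := pselect (forgets z).
      rewrite (_ : _ @^-1` _ = set0) ?measure0//.
      by apply/seteqP; split => // w [/= nf Xz]; apply: nf; rewrite Xz.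
    have : ~~ (0 < point_mass 1 z) by apply/negP => /forgets_step.
    rewrite point_mass_gt0 -leNgt measure_le0 => /eqP <-; congr (P _).
    apply/seteqP; split => [w [_ <-]|w /=]; first by rewrite /= walk1.
    by rewrite walk1 => wz; split => //=; rewrite wz.
  have -> : X 0%N @^-1` (~` [set z | forgets z]) = \bigcup_n F n.
    apply/seteqP; split => [w nf|w [n _]].
      by exists (choice.pickle (X 0%N w)) => //; rewrite /F choice.pickleK.
    by rewrite /F; case: choice.unpickle => // z [].
  have mF n : measurable (F n) by rewrite /F; case: choice.unpickle.
  apply/eqP; rewrite -measure_le0.
  have mUF : measurable (\bigcup_n F n) by exact: bigcup_measurable.
  apply: (le_trans (measure_sigma_subadditive P mF mUF (@subset_refl _ _))).
  by rewrite eseries0 => [|n _ _]; [|exact: PF].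
by rewrite X_nondegenerate; exact.
Qed.

Theorem walk_forgets_start (e : R) : 0 < e -> exists M : nat,
  forall n f B x, (M <= n)%N -> (forall y, `|f y| <= B) ->
    `|transition X n f x - transition X n f (x + 1)| <= e * B.
Proof.
move=> /(forgets_all 1)[M gM]; exists M => n f B x Mn fB.
have [B0|B0] := leP B 0.
  have f0 : f = fun=> 0.
    by apply/funext => y; apply/eqP; rewrite -normr_le0 (le_trans (fB y)).
  have -> : B = 0 by apply/eqP; rewrite eq_le B0 (le_trans (normr_ge0 _) (fB 0)).
  by rewrite mulr0 f0 !transition_cst subrr normr0.
pose f' y := B^-1 * f y.
have f'1 y : `|f' y| <= 1.
  by rewrite normrM gtr0_norm ?invr_gt0// ler_pdivrMl// mulr1.
have fC := quadratic_growth_bounded fB.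
have := gap_norm n x 1 f'1.
rewrite /f' !(transitionZ _ _ _ fC) -mulrBr normrM gtr0_norm ?invr_gt0//.
rewrite ler_pdivrMl// mulrC => /le_trans; apply; rewrite ler_wpM2r ?(ltW B0)//.
exact: le_trans (le_gap _ Mn) gM.
Qed.

End coupling.

Section bounded_integrals.
Context d (T : measurableType d) (R : realType) (P : probability T R).

Lemma integrable_bounded (Y : T -> R) (B : R) : measurable_fun setT Y ->
  (forall w, `|Y w| <= B) -> P.-integrable setT (EFin \o Y).
Proof.
move=> mY YB; apply: measurable_bounded_integrable => //.
  by rewrite (le_lt_trans (probability_le1 P measurableT))// ltry.
exists B; split; first exact: num_real.
by move=> x Bx w _ /=; exact: le_trans (YB w) (ltW Bx).
Qed.

Lemma integrable_Rsum (I : Type) (s : seq I) (Y : I -> T -> R) :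
  (forall i, P.-integrable setT (EFin \o Y i)) ->
  P.-integrable setT (EFin \o (fun w => \sum_(i <- s) Y i w)).
Proof.
move=> iY; elim: s => [|i s IHs].
  by under eq_fun do rewrite big_nil; exact: integrable_Rcst.
by under eq_fun do rewrite big_cons; exact: integrable_RD.
Qed.

Lemma Rintegral_sum (I : Type) (s : seq I) (Y : I -> T -> R) :
  (forall i, P.-integrable setT (EFin \o Y i)) ->
  \int[P]_w (\sum_(i <- s) Y i w) = \sum_(i <- s) \int[P]_w Y i w.
Proof.
move=> iY; elim: s => [|i s IHs].
  by under eq_Rintegral do rewrite big_nil; rewrite big_nil Rintegral_prob_cst.
under eq_Rintegral do rewrite big_cons.
by rewrite RintegralD// ?big_cons ?IHs//; exact: integrable_Rsum.
Qed.

Lemma Rintegral_le_cst (Y : T -> R) (B : R) : P.-integrable setT (EFin \o Y) ->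
  (forall w, Y w <= B) -> \int[P]_w Y w <= B.
Proof.
move=> iY YB; rewrite -[leRHS](Rintegral_prob_cst P).
by apply: le_Rintegral => //; exact: integrable_Rcst.
Qed.

Lemma Rintegral_dist_le (Y Z : T -> R) (B : R) :
  P.-integrable setT (EFin \o Y) -> P.-integrable setT (EFin \o Z) ->
  (forall w, `|Y w - Z w| <= B) -> `|\int[P]_w Y w - \int[P]_w Z w| <= B.
Proof.
move=> iY iZ YZ; rewrite -RintegralB//.
rewrite (le_trans (le_normr_Rintegral _ _))//; first exact: integrable_RB.
apply: Rintegral_le_cst => //.
by have /integrable_norm := integrable_RB iY iZ; apply.
Qed.

End bounded_integrals.

(** * Second moment of additive functionals, and escape from bounded sets *)

Section second_moment.
Context d (T : measurableType d) (R : realType) (P : probability T R).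
Context (X : nat -> {RV P >-> int}).
Hypothesis X_iid : iid P X.
Hypothesis X_centered : ('E_P[fun w => (X 0%N w)%:~R] = 0)%E.
Hypothesis X_finite_variance : ('V_P[fun w => (X 0%N w)%:~R] < +oo)%E.
Implicit Types (f g h : int -> R) (k m n : nat) (a b x y z : int) (C B D : R).

Let markov := markov_property X_iid X_centered X_finite_variance.

Lemma measurable_walk_fun n f : measurable_fun setT (fun w => f (walk X n w)).
Proof.
under eq_fun do rewrite walk_steps.
apply: (@measurableT_comp _ _ _ _ _ _ (fun s : seq int => f (\sum_(x <- s) x))) => //.
Qed.

Lemma transition_sum (I : Type) (s : seq I) (g : I -> int -> R) n B x :
  (forall i y, `|g i y| <= B) ->
  transition X n (fun y => \sum_(i <- s) g i y) x =
  \sum_(i <- s) transition X n (g i) x.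
Proof.
move=> gB; rewrite /transition (@Rintegral_sum _ _ _ _ _ _ (fun i w => g i (x + walk X n w)))// => i.
by apply: (@integrable_bounded _ _ _ _ _ B) => //; exact: (measurable_walk_fun n (fun y => g i (x + y))).
Qed.

(** For the tail sums A_i = f(S_i) + A_(i+1) one has A_i^2 = A_(i+1)^2 + 2 f(S_i) A_i - f(S_i)^2,
    and the last term may be dropped. By the Markov property E f(S_i) A_i is the mean of f(S_i)
    times a potential at S_i, hence at most B D; [N] such steps are added. *)
Lemma additive_functional_sqr f B D N :
  (forall x, `|f x| <= B) ->
  (forall k x, (k <= N)%N -> `|\sum_(m < k) transition X m f x| <= D) ->
  \int[P]_w (additive_functional f X N w) ^+ 2 <= 2 * N%:R * B * D.
Proof.
move=> fB fD.
have B0 : 0 <= B := le_trans (normr_ge0 _) (fB 0).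
pose A i w := \sum_(i <= m < N.+1) f (walk X m w).
have mA i : measurable_fun setT (A i).
  by apply: measurable_sum => m; exact: measurable_walk_fun.
have AB i w : `|A i w| <= N.+1%:R * B.
  rewrite (le_trans (ler_norm_sum _ _ _))// (@le_trans _ _ (\sum_(i <= m < N.+1) B))//.
    exact: ler_sum.
  by rewrite sumr_const_nat mulr_natl; apply: ler_wpMn2l => //; lia.
have iA2 i : P.-integrable setT (EFin \o (fun w => A i w ^+ 2)).
  apply: (@integrable_bounded _ _ _ _ _ ((N.+1%:R * B) ^+ 2)).
    exact: measurable_funX.
  by move=> w; rewrite normrX lerXn2r ?nnegrE ?mulr_ge0.
have ifA i : P.-integrable setT (EFin \o (fun w => f (walk X i w) * A i w)).
  apply: (@integrable_bounded _ _ _ _ _ (B * (N.+1%:R * B))).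
    by apply: measurable_funM => //; exact: measurable_walk_fun.
  by move=> w; rewrite normrM ler_pM.
have fA i : (0 < i <= N)%N -> \int[P]_w (f (walk X i w) * A i w) <= B * D.
  move=> iN.
  have -> : \int[P]_w (f (walk X i w) * A i w) =
      \int[P]_w (f (walk X i w) * \sum_(j < N.+1 - i) transition X j f (walk X i w)).
    have E j : \int[P]_w (f (walk X i w) * f (walk X (i + j) w)) =
        \int[P]_w (f (walk X i w) * transition X j f (walk X i w)).
      have := @markov i j (fun s => f (\sum_(x <- s) x)) B f B (fun s => fB _)
        (quadratic_growth_bounded fB).
      by under eq_Rintegral do rewrite -walk_steps; under [in RHS]eq_Rintegral do rewrite -walk_steps.
    have AE w : A i w = \sum_(0 <= j < N.+1 - i) f (walk X (j + i) w).
      by rewrite -(big_addn 0 N.+1 i xpredT (fun m => f (walk X m w))) add0n.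
    under eq_Rintegral => w _ do rewrite AE mulr_sumr.
    under [in RHS]eq_Rintegral => w _ do
      rewrite -(big_mkord xpredT (fun j => transition X j f (walk X i w))) mulr_sumr.
    rewrite (@Rintegral_sum _ _ _ _ _ _ (fun j w => f (walk X i w) * f (walk X (j + i) w))).
      rewrite (@Rintegral_sum _ _ _ _ _ _ (fun j w => f (walk X i w) * transition X j f (walk X i w))).
        by apply: eq_bigr => j _; rewrite addnC E.
      move=> j; apply: (@integrable_bounded _ _ _ _ _ (B * B)).
        by apply: measurable_funM; exact: measurable_walk_fun.
      by move=> w; rewrite normrM ler_pM//; exact: transition_bounded.
    move=> j; apply: (@integrable_bounded _ _ _ _ _ (B * B)).
      by apply: measurable_funM; exact: measurable_walk_fun.
    by move=> w; rewrite normrM ler_pM.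
  have bd w : `|f (walk X i w) * \sum_(j < N.+1 - i) transition X j f (walk X i w)| <= B * D.
    by rewrite normrM ler_pM//; apply: fD; lia.
  apply: Rintegral_le_cst.
    apply: (@integrable_bounded _ _ _ _ _ (B * D)) => //.
    apply: measurable_funM; first exact: measurable_walk_fun.
    exact: (measurable_walk_fun i (fun x => \sum_(j < N.+1 - i) transition X j f x)).
  by move=> w; rewrite (le_trans (ler_norm _)).
have step i : (0 < i <= N)%N ->
    \int[P]_w A i w ^+ 2 <= \int[P]_w A i.+1 w ^+ 2 + 2 * (B * D).
  move=> iN; apply: (@le_trans _ _ (\int[P]_w (A i.+1 w ^+ 2 + 2 * (f (walk X i w) * A i w)))).
    apply: le_Rintegral => //; first exact: integrable_RD (iA2 _) (integrable_RZ _ (ifA i)).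
    move=> w _; have -> : A i w = f (walk X i w) + A i.+1 w.
      by rewrite /A big_ltn//; lia.
    by have := sqr_ge0 (f (walk X i w)); nra.
  rewrite (RintegralD _ (iA2 _) (integrable_RZ _ (ifA i)))// RintegralZl//.
  by rewrite lerD2l ler_pM2l// fA.
(* Backward induction, from the empty tail [A N.+1] to the whole sum [A 1]. *)
have main j : (j <= N)%N ->
    \int[P]_w A (N.+1 - j)%N w ^+ 2 <= j%:R * (2 * (B * D)).
  elim: j => [_|j IHj jN].
    rewrite subn0 mul0r -[leRHS](Rintegral_prob_cst P) le_eqVlt; apply/orP; left.
    by apply/eqP/eq_Rintegral => w _; rewrite /A big_geq// expr0n.
  have -> : (N.+1 - j.+1)%N = (N - j)%N by [].
  rewrite (le_trans (step _ _))//; first lia.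
  have -> : (N - j).+1 = (N.+1 - j)%N by rewrite subSn// ltnW.
  by have := IHj (ltnW jN); rewrite -[j.+1%:R]natr1; lra.
have := main N (leqnn N).
by rewrite subSn// subnn /A /additive_functional; lra.
Qed.

Context (X_nondegenerate : nondegenerate_walk P X).
Context (X_aperiodic : aperiodic_walk P X).

Let forget := walk_forgets_start X_iid X_centered X_finite_variance
  X_nondegenerate X_aperiodic.

Lemma walk_forgets_shift (e : R) (L : nat) : 0 < e -> exists M : nat,
  forall n (j : nat) f B x, (M <= n)%N -> (j <= L)%N -> (forall y, `|f y| <= B) ->
    `|transition X n f x - transition X n f (x + j%:Z)| <= e * B.
Proof.
move=> e0; have [|M HM] := @forget (e / L.+1%:R); first by rewrite divr_gt0.
exists M => n j f B x Mn jL fB.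
have B0 : 0 <= B := le_trans (normr_ge0 _) (fB 0).
suff H (i : nat) : `|transition X n f x - transition X n f (x + i%:Z)| <=
    i%:R * (e / L.+1%:R * B).
  rewrite (le_trans (H j))// mulrA ler_wpM2r// mulrA ler_pdivrMr// mulrC.
  by rewrite ler_pM2l// ler_nat ltnW.
elim: i => [|i IHi]; first by rewrite addr0 subrr normr0 mul0r.
rewrite -natr1 mulrDl mul1r.
have -> : x + i.+1%:Z = x + i%:Z + 1 by lia.
have := HM n f B (x + i%:Z) Mn fB; move: IHi.
set u := transition _ _ _ x; set v := transition _ _ _ (x + i%:Z).
set t := transition _ _ _ _; move=> H1 H2.
rewrite (_ : u - t = (u - v) + (v - t)); last by ring.
by rewrite (le_trans (ler_normD _ _))// lerD.
Qed.

(** The translates of the window by multiples of L = 2 Z + 1 are disjoint, so the probabilities of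
    [J] of them add up to at most 1. By loss of memory they differ from that of the window itself by
    at most e / 2, which leaves at most 1 / J + e / 2. *)
Lemma walk_escapes (Z : nat) (e : R) : 0 < e -> exists M : nat, forall n, (M <= n)%N ->
  \int[P]_w (`|walk X n w| <= Z)%N%:R <= e.
Proof.
move=> e0.
pose f x : R := (`|x| <= Z)%N%:R.
have f01 x : 0 <= f x <= 1 by rewrite /f ler0n/=; case: leqP.
have f1 x : `|f x| <= 1 by have /andP[? ?] := f01 x; rewrite ger0_norm.
pose J := (Num.truncn (2 / e)).+1.
have J0 : 0 < J%:R :> R by rewrite ltr0n.
have Je : 1 / J%:R <= e / 2.
  rewrite ler_pdivrMr// -ler_pdivrMl ?divr_gt0// mulr1 invf_div.
  by rewrite ltW// truncnS_gt.
pose L := (2 * Z).+1.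
have e20 : 0 < e / 2 by rewrite divr_gt0.
have [M HM'] := walk_forgets_shift (L * J) e20; exists M => n Mn.
have HM (j : nat) : (j < J)%N ->
    `|transition X n f 0 - transition X n f (L * j)%N%:Z| <= e / 2.
  move=> jJ; have := HM' n (L * j)%N f 1 0 Mn; rewrite add0r mulr1; apply => //.
  by rewrite leq_mul2l ltnW.
have sum1 x : \sum_(j < J) f ((L * j)%N%:Z + x) <= 1.
  have [[j fj]|] := pselect (exists j : 'I_J, (absz ((L * j)%N%:Z + x)%R <= Z)%N).
    rewrite (bigD1 j)//= big1 ?addr0; first by have /andP[] := f01 ((L * j)%N%:Z + x).
    move=> i ij; rewrite /f; case: leqP => // fi; exfalso; move/eqP: ij; apply.
    apply: val_inj => /=; move: fi fj; rewrite /L => fi fj; nia.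
  move=> /forallNP nf; rewrite big1// => j _.
  by rewrite /f; case: leqP => // fj; exfalso; exact: nf fj.
have : J%:R * transition X n f 0 <= 1 + J%:R * (e / 2).
  apply: (@le_trans _ _ (\sum_(j < J) (transition X n f (L * j)%N%:Z + e / 2))).
    rewrite mulr_natl -[X in _ *+ X]card_ord -sumr_const; apply: ler_sum => j _.
    by have := HM j (ltn_ord j); rewrite ler_norml => /andP[]; lra.
  rewrite big_split/= sumr_const card_ord [J%:R * _]mulr_natl lerD2r.
  have -> : \sum_(j < J) transition X n f (L * j)%N%:Z =
      transition X n (fun x => \sum_(j < J) f ((L * j)%N%:Z + x)) 0.
    rewrite (@transition_sum _ _ (fun j : 'I_J => fun x => f ((L * j)%N%:Z + x)) n 1)//.
    by apply: eq_bigr => j _; rewrite transition_shift addr0.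
  apply: Rintegral_le_cst => //.
  apply: (@integrable_bounded _ _ _ _ _ 1).
    exact: (measurable_walk_fun n (fun y => \sum_(j < J) f ((L * j)%N%:Z + (0 + y)))).
  move=> w; rewrite ger0_norm//; apply: sumr_ge0 => j _.
  by have /andP[] := f01 ((L * j)%N%:Z + (0 + walk X n w)).
rewrite -ler_pdivlMl// mulrDr mulKf ?gt_eqF// mulr1 -[J%:R^-1]mul1r => tn.
have -> : \int[P]_w (`|walk X n w| <= Z)%N%:R = transition X n f 0.
  by apply: eq_Rintegral => w _; rewrite add0r.
by lra.
Qed.

End second_moment.

(** * Additive functionals with zero averages *)

Section generator.
Context d (T : measurableType d) (R : realType) (P : probability T R).
Context (X : nat -> {RV P >-> int}).
Hypothesis X_iid : iid P X.
Hypothesis X_centered : ('E_P[fun w => (X 0%N w)%:~R] = 0)%E.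
Hypothesis X_finite_variance : ('V_P[fun w => (X 0%N w)%:~R] < +oo)%E.
Implicit Types (f g h : int -> R) (k m n Z : nat) (a b x y z : int) (C B D S w : R).

Let int_walk := integrable_walk X_iid X_centered X_finite_variance.
Let int_trans := integrable_transition X_iid X_centered X_finite_variance.
Let int_sqr := integrable_walk_sqr X_iid X_centered X_finite_variance.
Let int_id := integrable_walk_id X_iid X_centered X_finite_variance.

(** This takes the place of a moment of order higher than 2: it tends to 0 by dominated convergence,
    without a rate. *)
Definition step_tail Z : R := \int[P]_v ((Z < `|walk X 1 v|)%N%:R * (walk X 1 v)%:~R ^+ 2).

Let integrable_tail Z :
  P.-integrable setT (EFin \o (fun v => (Z < `|walk X 1 v|)%N%:R * (walk X 1 v)%:~R ^+ 2 : R)).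
Proof.
apply: (@int_walk 1 (fun x => (Z < `|x|)%N%:R * x%:~R ^+ 2) 1) => x.
rewrite mul1r normrM normr_nat [ `|_ ^+ 2|]ger0_norm ?sqr_ge0//.
by case: leqP => _; rewrite ?mul1r ?mul0r ?lerDr// addr_ge0 ?sqr_ge0.
Qed.

Lemma step_tail_ge0 Z : 0 <= step_tail Z.
Proof. by apply: Rintegral_ge0 => v _; rewrite mulr_ge0 ?sqr_ge0. Qed.

Lemma step_tail_small (e : R) : 0 < e -> exists Z, step_tail Z <= e.
Proof.
move=> e0.
pose F (Z : nat) v : R := (Z < `|walk X 1 v|)%N%:R * (walk X 1 v)%:~R ^+ 2.
have : (\int[P]_v (F Z v)%:E)%E @[Z --> \oo] --> (\int[P]_v (cst 0 v))%E.
  have [//|||||] := @dominated_convergence _ _ _ P setT measurableT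
    (fun Z v => (F Z v)%:E) (cst 0%E) (fun v => ((walk X 1 v)%:~R ^+ 2)%:E).
  - by move=> Z; have /measurable_int := integrable_tail Z.
  - exact: measurable_cst.
  - apply: aeW => v _; apply: cvg_near_cst; exists `|walk X 1 v|%N => // Z /= vZ.
    by rewrite /F ltnNge vZ mul0r.
  - exact: int_sqr.
  - apply: aeW => v Z _; rewrite /= lee_fin normrM normr_nat ger0_norm ?sqr_ge0//.
    by case: leqP => _; rewrite ?mul1r ?mul0r ?sqr_ge0.
  by [].
rewrite integral0 => /fine_cvgP[_ /cvgrPdist_le/(_ _ e0)[Z _ /(_ Z (leqnn Z))]].
rewrite /= sub0r normrN => H; exists Z; apply: le_trans (ler_norm _) _.
exact: H.
Qed.

Lemma quadratic_growth_second_difference h B :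
  (forall x, `|second_difference h x| <= B) -> exists C, quadratic_growth C h.
Proof.
move=> hB; pose b := (h 1 - h (-1)) / 2.
have B0 : 0 <= B := le_trans (normr_ge0 _) (hB 0).
exists (`|h 0| + `|b| + 2 * B) => y.
have := @taylor _ h 0 (2 * B) y.
rewrite !add0r -/b => H; have {}H := H _.
have sd0 z : `|second_difference h z - second_difference h 0| <= 2 * B.
  by rewrite (le_trans (ler_normB _ _))//; have := hB z; have := hB 0; lra.
have /H {}H : forall z, (`|z| <= `|y|)%N ->
  `|second_difference h (0 + z) - second_difference h 0| <= 2 * B.
  by move=> z _; rewrite add0r.
have y2 : `|y%:~R : R| <= 1 + y%:~R ^+ 2.
  rewrite -(real_normK (num_real (y%:~R : R))).
  by have := sqr_ge0 (`|y%:~R : R| - 1); have := normr_ge0 (y%:~R : R); nra.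
have -> : h y = (h y - h 0 - y%:~R * b - y%:~R ^+ 2 / 2 * second_difference h 0) +
  (h 0 + (y%:~R * b + y%:~R ^+ 2 / 2 * second_difference h 0)) by ring.
rewrite (le_trans (ler_normD _ _))// (le_trans (lerD H (ler_normD _ _)))//.
have := ler_normD (y%:~R * b) (y%:~R ^+ 2 / 2 * second_difference h 0).
have y20 := sqr_ge0 (y%:~R : R).
rewrite [ `|_ * b|]normrM [ `|_ * second_difference h 0|]normrM.
rewrite [ `|_ ^+ 2 / 2|]ger0_norm ?divr_ge0//.
have := ler_wpM2r (normr_ge0 b) y2.
have := ler_wpM2l y20 (hB 0).
have := mulr_ge0 (normr_ge0 (h 0)) y20.
by have := mulr_ge0 B0 y20; lra.
Qed.

(** Integrate the discrete Taylor formula over one step; the linear term vanishes by centring. Steps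
    of size at most [Z] see a deviation [w] of the second difference, longer ones the trivial
    deviation [2 * B], paid for by the tail. *)
Lemma generator_estimate h B w Z x :
  (forall y, `|second_difference h y| <= B) ->
  (forall z, (`|z| <= Z)%N ->
    `|second_difference h (x + z) - second_difference h x| <= w) ->
  `|transition X 1 h x - h x - step_variance X / 2 * second_difference h x| <=
    w * (step_variance X / 2) + B * step_tail Z.
Proof.
move=> hB hw; have [C hC] := quadratic_growth_second_difference hB.
have B0 : 0 <= B := le_trans (normr_ge0 _) (hB 0).
have w0 : 0 <= w by apply: le_trans (hw 0 _); rewrite ?absz0.
set sd := second_difference h x; set b := (h (x + 1) - h (x - 1)) / 2.
pose y v : R := (walk X 1 v)%:~R.
have iy : P.-integrable setT (EFin \o y) := int_id 1.
have iy2 : P.-integrable setT (EFin \o (fun v => y v ^+ 2)) := int_sqr 1.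
have ih := int_trans 1 x hC.
have Ey : \int[P]_v y v = 0.
  rewrite -(Rintegral_step X_centered); apply: eq_Rintegral => v _.
  by rewrite /y walk1.
have Ey2 : \int[P]_v y v ^+ 2 = step_variance X.
  by rewrite /y (Rintegral_walk_sqr X_iid X_centered X_finite_variance 1) mul1r.
have -> : transition X 1 h x - h x - step_variance X / 2 * sd =
    \int[P]_v (h (x + walk X 1 v) + (- h x + (- b * y v + - (sd / 2) * y v ^+ 2))).
  have i3 := integrable_RD (integrable_RZ (- b) iy) (integrable_RZ (- (sd / 2)) iy2).
  have i2 := integrable_RD (integrable_Rcst P (- h x)) i3.
  rewrite (RintegralD _ ih i2)// (RintegralD _ (integrable_Rcst P (- h x)) i3)//.
  rewrite (RintegralD _ (integrable_RZ (- b) iy) (integrable_RZ (- (sd / 2)) iy2))//.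
  by rewrite !RintegralZl// Ey Ey2 Rintegral_prob_cst /transition; ring.
have i3 := integrable_RD (integrable_RZ (- b) iy) (integrable_RZ (- (sd / 2)) iy2).
have i2 := integrable_RD (integrable_Rcst P (- h x)) i3.
have i1 := integrable_RD ih i2.
rewrite (le_trans (le_normr_Rintegral _ i1))//.
have -> : w * (step_variance X / 2) + B * step_tail Z =
    \int[P]_v (w / 2 * y v ^+ 2 + B * ((Z < `|walk X 1 v|)%N%:R * y v ^+ 2)).
  rewrite (RintegralD _ (integrable_RZ (w / 2) iy2) (integrable_RZ B (integrable_tail Z)))//.
  by rewrite !RintegralZl// Ey2 /step_tail mulrA mulrAC.
apply: le_Rintegral => //; first exact: (integrable_norm i1).
  exact: integrable_RD (integrable_RZ (w / 2) iy2) (integrable_RZ B (integrable_tail Z)).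
move=> v _; set z := walk X 1 v.
have -> : h (x + z) + (- h x + (- b * y v + - (sd / 2) * y v ^+ 2)) =
    h (x + z) - h x - z%:~R * b - z%:~R ^+ 2 / 2 * sd by rewrite /y -/z; field.
case: (leqP `|z| Z) => zZ.
  rewrite mul0r mulr0 addr0 (le_trans (taylor (w := w) _))//; last by rewrite /y -/z; lra.
  by move=> z' z'z; apply: hw; exact: leq_trans z'z zZ.
rewrite mul1r (le_trans (taylor (w := 2 * B) _))//; last first.
  by rewrite /y -/z; have := mulr_ge0 w0 (sqr_ge0 (z%:~R : R)); lra.
move=> z' _; rewrite (le_trans (ler_normB _ _))//.
by have := hB (x + z'); have := hB x; lra.
Qed.

Lemma transition_lipschitz h C S (r : R) k x : quadratic_growth C h -> 0 < r ->
  (forall x, `|h (x + 1) - h x| <= S) ->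
  `|transition X k h x - h x| <= S * (r + k%:R * step_variance X / r).
Proof.
move=> hC r0 hS; have S0 : 0 <= S := le_trans (normr_ge0 _) (hS 0).
have ih := int_trans k x hC.
rewrite -[X in _ - X](Rintegral_prob_cst P) /transition.
rewrite -(RintegralB _ ih (integrable_Rcst P (h x)))//.
have ihB := integrable_RB ih (integrable_Rcst P (h x)).
rewrite (le_trans (le_normr_Rintegral _ ihB))//.
apply: (@le_trans _ _ (\int[P]_v (S * `|(walk X k v)%:~R : R|))).
  apply: le_Rintegral => //; first exact: (integrable_norm ihB).
    by apply: integrable_RZ; exact: (integrable_norm (int_id k)).
  move=> v _; rewrite (le_trans (lipschitz_of_steps hS _ _))//.
  by rewrite -intr_norm -abszE.
rewrite RintegralZl//; last exact: (integrable_norm (int_id k)).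
by rewrite ler_wpM2l//; exact: Rintegral_norm_walk.
Qed.

(* The sum of P^m (P h - h) telescopes. *)
Lemma potential_estimate h B S w (r : R) Z k x : 0 < r ->
  (forall y, `|second_difference h y| <= B) ->
  (forall y, `|h (y + 1) - h y| <= S) ->
  (forall y z, (`|z| <= Z)%N ->
    `|second_difference h (y + z) - second_difference h y| <= w) ->
  step_variance X / 2 * `|\sum_(m < k) transition X m (second_difference h) x| <=
  S * (r + k%:R * step_variance X / r) +
  k%:R * (w * (step_variance X / 2) + B * step_tail Z).
Proof.
move=> r0 hB hS hw; have [C hC] := quadratic_growth_second_difference hB.
have s0 : 0 <= step_variance X / 2 by rewrite divr_ge0 ?step_variance_ge0.
set E := w * _ + _.
have sdC := quadratic_growth_bounded hB.
have PhC := quadratic_growth_transition1 X_iid X_centered X_finite_variance hC.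
set C1 := 2 * C * _ in PhC.
pose s := step_variance X / 2.
pose e y := transition X 1 h y - h y - s * second_difference h y.
have eE y : `|e y| <= E by apply: generator_estimate => // z; exact: hw.
have hN1 : quadratic_growth (C1 + C) (fun y => transition X 1 h y - h y).
  move=> y; rewrite mulrDl (le_trans (ler_normB _ _))// lerD//.
have hN2 : quadratic_growth (s * B) (fun y => s * second_difference h y).
  by apply: quadratic_growth_bounded => y; rewrite normrM ger0_norm// ler_wpM2l.
have eE' m : s * transition X m (second_difference h) x =
    (transition X m.+1 h x - transition X m h x) - transition X m e x.
  rewrite /e (transitionB X_iid X_centered X_finite_variance _ _ hN1 hN2).
  rewrite (transitionB X_iid X_centered X_finite_variance _ _ PhC hC).
  rewrite (transitionZ X_iid X_centered X_finite_variance _ _ _ sdC).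
  by rewrite -(transitionSr X_iid X_centered X_finite_variance _ _ hC); ring.
rewrite -[X in X * _]ger0_norm// -normrM mulr_sumr.
under eq_bigr do rewrite eE'.
rewrite sumrB -(big_mkord xpredT (fun m => transition X m.+1 h x - transition X m h x)).
rewrite telescope_sumr// transition0 (le_trans (ler_normB _ _))// lerD//.
  exact: (transition_lipschitz k x hC r0 hS).
rewrite (le_trans (ler_norm_sum _ _ _))//.
apply: (@le_trans _ _ (\sum_(m < k) E)); last by rewrite sumr_const card_ord mulr_natl.
apply: ler_sum => m _.
by apply: (transition_bounded X_iid X_centered X_finite_variance).
Qed.

Context (X_nondegenerate : nondegenerate_walk P X).

(** With zero variance the step would be almost surely 0, and the trivial group would support it. *)
Lemma step_variance_gt0 : 0 < step_variance X.
Proof.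
rewrite lt_neqAle step_variance_ge0 andbT; apply/negP => /eqP/esym s0.
have P0 : point_mass X 1 0 = 1.
  apply/eqP; rewrite eq_le (point_mass_le1 _ _ 0)/=.
  (* On the integers 1 - x^2 is at most the indicator of 0. *)
  have -> : 1 = \int[P]_w (1 - (walk X 1 w)%:~R ^+ 2) :> R.
    rewrite (RintegralB _ (integrable_Rcst P 1) (int_sqr 1))// Rintegral_prob_cst.
    by rewrite (Rintegral_walk_sqr X_iid X_centered X_finite_variance) s0 mulr0 subr0.
  apply: le_Rintegral => //.
  - exact: integrable_RB (integrable_Rcst P 1) (int_sqr 1).
  - by apply: (@int_walk 1 (fun x => (x == 0)%:R) 1);
      apply: quadratic_growth_bounded => x; case: eqP; rewrite ?normr1 ?normr0.
  move=> w _; case: eqP => [->|/eqP w0]; first by rewrite expr0n subr0.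
  rewrite subr_le0 -[leRHS]real_normK ?num_real// exprn_ege1//.
  by rewrite -intr_norm -abszE ler1n absz_gt0.
have : smallest_supporting_group (X 0%N) `<=` [set 0].
  apply: bigcap_inf; split.
    split => [|y z]; first by rewrite inE.
    by rewrite !inE /= => -> ->; rewrite subr0.
  rewrite -[1%E]/(1%:E) -P0 point_mass_probability; congr (P _).
  by apply/seteqP; split => w; rewrite /= walk1.
by rewrite X_nondegenerate => /(_ 1 I).
Qed.

End generator.

Section truncation.
Context (R : realType).
Implicit Types (G : int -> R) (J L : nat) (x y : int).

Lemma ler_sum_ord_cst n (F : 'I_n -> R) (c : R) : (forall i, F i <= c) ->
  \sum_(i < n) F i <= n%:R * c.
Proof.
by move=> Fc; rewrite mulr_natl -[n in _ *+ n]card_ord -sumr_const; exact: ler_sum.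
Qed.

Definition truncation J G x : R := if (`|x| <= J)%N then G x else 0.

Lemma truncation_bounded J G B : (forall x, `|G x| <= B) ->
  forall x, `|truncation J G x| <= B.
Proof.
move=> GB x; rewrite /truncation; case: ifP => // _.
by rewrite normr0 (le_trans (normr_ge0 _) (GB 0)).
Qed.

Lemma sum_ord_prefix (a : nat -> R) (n m : nat) :
  \sum_(i < n) (if (i < m)%N then a i else 0) = \sum_(i < minn n m) a i.
Proof.
elim: n => [|n IHn]; first by rewrite min0n !big_ord0.
rewrite big_ord_recr/= IHn; case: ltnP => nm.
  by rewrite !(minn_idPl _)// ?big_ord_recr// ltnW.
by rewrite !(minn_idPr _)// ?addr0// ltnW.
Qed.

(** Beyond the cut-off the primitive stays constant, so the linear bound is never evaluated past
    [J + 1] terms, the number of integers from 0 to [J]. *)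
Lemma antidifference_truncation_le J G (e C : R) : 0 <= e ->
  (forall n : nat, `|\sum_(i < n) G (Posz i)| <= e * n%:R + C) ->
  (forall n : nat, `|\sum_(i < n) G (Negz i)| <= e * n%:R + C) ->
  forall x, `|antidifference (truncation J G) x| <= e * J.+1%:R + C.
Proof.
move=> e0 Gp Gn [n|n] /=.
  rewrite (eq_bigr (fun i : 'I_n => if (i < J.+1)%N then G (Posz i) else 0))//.
  rewrite (sum_ord_prefix (fun i => G (Posz i))) (le_trans (Gp _))// lerD2r.
  by rewrite ler_wpM2l// ler_nat geq_minr.
rewrite normrN (eq_bigr (fun i : 'I_n.+1 => if (i < J)%N then G (Negz i) else 0))//.
rewrite (sum_ord_prefix (fun i => G (Negz i))) (le_trans (Gn _))// lerD2r.
by rewrite ler_wpM2l// ler_nat (leq_trans (geq_minr _ _)).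
Qed.

Definition block_average L G x : R := L%:R^-1 * \sum_(j < L) G (x + j%:Z).

Lemma block_average_antidifference L G x : block_average L G x =
  L%:R^-1 * (antidifference G (x + L%:Z) - antidifference G x).
Proof.
congr (_ * _); elim: L => [|L IHL]; first by rewrite big_ord0 addr0 subrr.
rewrite big_ord_recr/= IHL -(antidifferenceS G (x + L%:Z)).
have -> : x + L%:Z + 1 = x + L.+1%:Z by lia.
by ring.
Qed.

(** [h] is the block average of a double primitive of [G]. Its slopes are averages of the first
    primitive of the unsmoothed [G], so smoothing costs nothing in the Lipschitz bound. *)
Lemma exists_block_average_second_difference L G :
  exists h : int -> R, [/\ second_difference h =1 block_average L G &
    forall S : R, (0 < L)%N -> (forall x, `|antidifference G x| <= S) ->
      forall x, `|h (x + 1) - h x| <= S].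
Proof.
(* The shift by 1 compensates for the centring of [second_difference]. *)
pose D x := antidifference G (x + 1).
exists (block_average L (antidifference D)); split => [x|S L0 GS x].
  rewrite /second_difference /block_average.
  have E j : antidifference D (x + 1 + j%:Z) - 2 * antidifference D (x + j%:Z)
      + antidifference D (x - 1 + j%:Z) = G (x + j%:Z).
    have := antidifferenceS D (x + j%:Z); have := antidifferenceS D (x - 1 + j%:Z).
    have := antidifferenceS G (x + j%:Z); rewrite /D.
    have -> : x - 1 + j%:Z + 1 = x + j%:Z by lia.
    have -> : x + 1 + j%:Z = x + j%:Z + 1 by lia.
    by lra.
  under [in RHS]eq_bigr do rewrite -E.
  by rewrite big_split/= sumrB -mulr_sumr; ring.
rewrite /block_average -mulrBr -sumrB normrM ger0_norm ?invr_ge0//.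
rewrite ler_pdivrMl ?ltr0n// (le_trans (ler_norm_sum _ _ _))//.
apply: ler_sum_ord_cst => j.
have -> : x + 1 + j%:Z = x + j%:Z + 1 by lia.
by rewrite antidifferenceS; exact: GS.
Qed.

End truncation.

Section zero_averages.
Context d (T : measurableType d) (R : realType) (P : probability T R).
Context (X : nat -> {RV P >-> int}).
Hypothesis X_iid : iid P X.
Hypothesis X_centered : ('E_P[fun w => (X 0%N w)%:~R] = 0)%E.
Hypothesis X_finite_variance : ('V_P[fun w => (X 0%N w)%:~R] < +oo)%E.
Hypothesis X_nondegenerate : nondegenerate_walk P X.
Hypothesis X_aperiodic : aperiodic_walk P X.
Implicit Types (f g h G : int -> R) (k m n N J L : nat) (x y z : int) (B e K : R).

Let forget := walk_forgets_shift X_iid X_centered X_finite_variance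
  X_nondegenerate X_aperiodic.

(** P^m of the block average is a mean of P^m f over [L] nearby starting points, among which the
    walk hardly distinguishes once m >= M. The first [M] terms cost the trivial 2 B each. *)
Lemma potential_block_average L e : (0 < L)%N -> 0 < e -> exists M : nat,
  forall f B k x, (forall y, `|f y| <= B) ->
  `|\sum_(m < k) transition X m f x -
    \sum_(m < k) transition X m (block_average L f) x| <= 2 * M%:R * B + k%:R * (e * B).
Proof.
move=> L0 /(forget L)[M HM]; exists M => f B k x fB.
have B0 : 0 <= B := le_trans (normr_ge0 _) (fB 0).
have L0R : 0 < L%:R :> R by rewrite ltr0n.
have fC := quadratic_growth_bounded fB.
have tavg m : transition X m f x - transition X m (block_average L f) x =
    L%:R^-1 * \sum_(j < L) (transition X m f x - transition X m f (x + j%:Z)).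
  have avgC : quadratic_growth (L%:R * B) (fun y => \sum_(j < L) f (y + j%:Z)).
    apply: quadratic_growth_bounded => y; rewrite (le_trans (ler_norm_sum _ _ _))//.
    exact: ler_sum_ord_cst.
  rewrite /block_average (transitionZ X_iid X_centered X_finite_variance _ _ _ avgC).
  rewrite (@transition_sum _ _ _ _ _ _ _ (fun j : 'I_L => fun y => f (y + j%:Z)) m B)//.
  rewrite sumrB sumr_const card_ord -[transition _ _ _ _ *+ L]mulr_natl mulrBr mulKf ?gt_eqF//.
  congr (_ - _ * _); apply: eq_bigr => j _.
  rewrite [in RHS]addrC -transition_shift; apply: eq_Rintegral => w _.
  by rewrite addrC.
have tle m : `|transition X m f x - transition X m (block_average L f) x| <=
    (m < M)%N%:R * (2 * B) + e * B.
  rewrite tavg normrM ger0_norm ?invr_ge0// ler_pdivrMl// (le_trans (ler_norm_sum _ _ _))//.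
  apply: ler_sum_ord_cst => j.
  case: ltnP => mM; last by rewrite mul0r add0r HM// ltnW.
  have eB0 : 0 <= e * B by apply: le_trans (HM M 0%N f B 0 (leqnn M) (leq0n L) fB).
  rewrite mul1r (le_trans (ler_normB _ _))//.
  have := transition_bounded X_iid X_centered X_finite_variance m x fB.
  have := transition_bounded X_iid X_centered X_finite_variance m (x + j%:Z) fB.
  by lra.
rewrite -sumrB (le_trans (ler_norm_sum _ _ _))//.
apply: (@le_trans _ _ (\sum_(m < k) ((m < M)%N%:R * (2 * B) + e * B))).
  by apply: ler_sum => m _; exact: tle.
rewrite big_split/= sumr_const card_ord [k%:R * _]mulr_natl lerD2r.
rewrite -mulr_suml.
have : \sum_(m < k) (m < M)%N%:R <= M%:R :> R.
  rewrite (eq_bigr (fun i : 'I_k => if (i < M)%N then 1 else 0)) => [|i _].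
    by rewrite (sum_ord_prefix (fun=> 1)) sumr_const card_ord ler_nat geq_minr.
  by case: ltnP.
by move=> /(ler_wpM2r (mulr_ge0 (ler0n R 2) B0)); lra.
Qed.

(* T_N(G_J) with G_J the restriction of G to [-J, J], J of order sqrt N: smooth
   G_J at a fixed scale L, and solve the discrete equation h'' = smoothed G_J;
   since the averages of G vanish, h is o(sqrt N)-Lipschitz. *)
Lemma potential_truncation G B K e : (forall x, `|G x| <= B) -> 0 < K -> 0 < e ->
  (forall a : R, 0 < a -> exists C : R, forall n,
    `|\sum_(i < n) G (Posz i)| <= a * n%:R + C /\
    `|\sum_(i < n) G (Negz i)| <= a * n%:R + C) ->
  exists N0, forall N J k x, (N0 <= N)%N -> (k <= N)%N ->
    J%:R <= K * Num.sqrt (N%:R : R) ->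
    `|\sum_(m < k) transition X m (truncation J G) x| <= e * N%:R.
Proof.
move=> GB' K0 e0 Gavg.
have B'0 : 0 <= B := le_trans (normr_ge0 _) (GB' 0).
pose B1 := B + 1.
have B0 : 0 < B1 by rewrite ltr_wpDl.
have GB x : `|G x| <= B1 by rewrite (le_trans (GB' x))// lerDl.
pose c := step_variance X.
have c0 : 0 < c := step_variance_gt0 X_iid X_centered X_finite_variance X_nondegenerate.
have [Z HZ] := step_tail_small X_iid X_centered X_finite_variance
  (divr_gt0 (mulr_gt0 e0 c0) (mulr_gt0 (ltr0Sn R 15) B0)).
(* [w] bounds the change of a block average of length [L] under a shift by at most [Z]; this [L]
   makes it at most e / 8. *)
pose L := (Num.truncn (16 * B1 * Z%:R / e)).+1.
have L0 : 0 < L%:R :> R by rewrite ltr0n.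
pose w := L%:R^-1 * (2 * (B1 * Z%:R)).
have wle : w <= e / 8.
  rewrite /w ler_pdivrMl// mulrC.
  have : 16 * B1 * Z%:R / e < L%:R by exact: truncnS_gt.
  by rewrite ltr_pdivrMr//; lra.
(* With the rate e2 = e c / (16 K (1 + c)) the slopes of [h] are about e2 K sqrt N; multiplied by
   the factor (1 + c) sqrt N of the telescoped bound, this gives e c N / 16. *)
have [C HC] := Gavg _ (divr_gt0 (mulr_gt0 e0 c0)
  (mulr_gt0 (mulr_gt0 (ltr0Sn R 15) K0) (addr_gt0 ltr01 c0))).
set e2 := e * c / _ in HC.
have e20 : 0 < e2 by rewrite divr_gt0// ?mulr_gt0// addr_gt0.
have [M HM] := potential_block_average (ltn0Sn _ : (0 < L)%N)
  (divr_gt0 e0 (mulr_gt0 (ltr0Sn R 7) B0)).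
(* The value of sqrt N from which the constant part e2 + |C| of the slope bound also contributes at
   most e c N / 16. *)
pose s1 := (e2 + `|C|) * (1 + c) * 16 / (e * c).
pose N0 := (Num.truncn (s1 ^+ 2 + 16 * M%:R * B1 / e + 1)).+1.
exists N0 => N J k x N0N kN JK.
have NR : s1 ^+ 2 + 16 * M%:R * B1 / e + 1 <= N%:R.
  by rewrite (le_trans (ltW (truncnS_gt _)))// ler_nat.
have s10 : 0 <= s1.
  apply: divr_ge0; last by rewrite ltW// mulr_gt0.
  by do 2 (apply: mulr_ge0 => //); apply: addr_ge0 => //; exact: ltW.
have MB0 : 0 <= 16 * M%:R * B1 / e.
  by apply: divr_ge0; [apply: mulr_ge0; [exact: mulr_ge0|exact: ltW]|exact: ltW].
pose s := Num.sqrt N%:R : R.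
have N1 : 1 <= N%:R :> R by have := sqr_ge0 s1; lra.
have s0 : 0 < s by rewrite sqrtr_gt0; lra.
have ss : s ^+ 2 = N%:R by rewrite sqr_sqrtr.
have s1s : s1 <= s.
  by rewrite -(@ler_pXn2r _ 2)// ?nnegrE// ?(ltW s0)// ss; lra.
have MB : 2 * M%:R * B1 <= e / 8 * N%:R.
  have : 16 * M%:R * B1 / e <= N%:R by have := sqr_ge0 s1; lra.
  by rewrite ler_pdivrMr//; lra.
pose GJ := truncation J G.
have GJB y : `|GJ y| <= B1 by exact: truncation_bounded.
have [h [sdh lip]] := exists_block_average_second_difference L GJ.
pose S := e2 * J.+1%:R + C.
have hS y : `|h (y + 1) - h y| <= S.
  apply: lip => // z; apply: antidifference_truncation_le; first exact: ltW.
    by move=> n; have [] := HC n.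
  by move=> n; have [] := HC n.
have hB y : `|second_difference h y| <= B1.
  rewrite sdh /block_average normrM ger0_norm ?invr_ge0// ler_pdivrMl//.
  rewrite (le_trans (ler_norm_sum _ _ _))//.
  exact: ler_sum_ord_cst.
have hw y z : (`|z| <= Z)%N ->
    `|second_difference h (y + z) - second_difference h y| <= w.
  move=> zZ; rewrite !sdh !block_average_antidifference -mulrBr normrM.
  rewrite ger0_norm ?invr_ge0// ler_wpM2l ?invr_ge0//.
  (* Two shifted blocks of equal length differ only near their two ends, each end contributing an
     increment of the primitive over [z]. *)
  have A1 u : `|antidifference GJ (u + z) - antidifference GJ u| <= B1 * Z%:R.
    rewrite (le_trans (@lipschitz_of_steps _ _ B1 _ _ _))//.
      by move=> v; rewrite antidifferenceS.
    by rewrite ler_wpM2l ?ler_nat// ltW.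
  rewrite (addrAC y z).
  have := A1 y; have := A1 (y + L%:Z).
  set a1 := antidifference _ (y + L%:Z + z); set a2 := antidifference _ (y + L%:Z).
  set a3 := antidifference _ (y + z); set a4 := antidifference _ y.
  move=> A2 A3; rewrite (_ : a1 - a3 - (a2 - a4) = (a1 - a2) - (a3 - a4)); last by ring.
  by rewrite (le_trans (ler_normB _ _))//; lra.
have := potential_estimate X_iid X_centered X_finite_variance k x s0 hB hS hw.
rewrite -/c.
have -> : second_difference h = block_average L GJ by apply/funext => y; exact: sdh.
set A := \sum_(m < k) transition X m (block_average L GJ) x => HA.
have kNR : k%:R <= N%:R :> R by rewrite ler_nat.
have S0 : 0 <= S := le_trans (normr_ge0 _) (hS 0).
have t1 : S * (s + k%:R * c / s) <= e * c / 16 * N%:R + e * c / 16 * N%:R.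
  have : s + k%:R * c / s <= s * (1 + c).
    rewrite mulrDr mulr1 lerD2l ler_pdivrMr// mulrAC -expr2 ss.
    by rewrite ler_wpM2r// ltW.
  move=> /(ler_wpM2l S0)/le_trans; apply.
  have : S <= e2 * (K * s) + (e2 + `|C|).
    rewrite /S -natr1 mulrDr mulr1 -addrA lerD ?lerD ?ler_norm//.
    by rewrite ler_wpM2l// ltW.
  have sc0 : 0 <= s * (1 + c) by rewrite mulr_ge0 ?addr_ge0// ltW.
  move=> /(ler_wpM2r sc0)/le_trans; apply.
  have -> : (e2 * (K * s) + (e2 + `|C|)) * (s * (1 + c)) =
      e2 * K * (1 + c) * s ^+ 2 + (e2 + `|C|) * (1 + c) * s by ring.
  rewrite ss; apply: lerD.
    rewrite ler_wpM2r// /e2 le_eqVlt; apply/orP; left; apply/eqP.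
    by field; rewrite !gt_eqF//= addr_gt0.
  have -> : (e2 + `|C|) * (1 + c) = e * c / 16 * s1.
    by rewrite /s1; field; rewrite !gt_eqF.
  rewrite -ss expr2 mulrA ler_wpM2r ?(ltW s0)// ler_wpM2l//.
  by rewrite divr_ge0// mulr_ge0// ltW.
have E0 : 0 <= w * (c / 2) + B1 * step_tail X Z.
  rewrite addr_ge0// mulr_ge0 ?step_tail_ge0 ?(ltW B0)// ?divr_ge0// ?(ltW c0)//.
  by rewrite /w mulr_ge0 ?invr_ge0// mulr_ge0// mulr_ge0// ltW.
have t2 : k%:R * (w * (c / 2) + B1 * step_tail X Z) <= N%:R * (e * c / 8).
  apply: (le_trans (ler_wpM2r E0 kNR)); rewrite ler_wpM2l//.
  have w1 := ler_wpM2r (ltW c0) wle.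
  have : B1 * step_tail X Z <= e * c / 16.
    move: HZ => /(ler_wpM2l (ltW B0))/le_trans; apply.
    rewrite le_eqVlt; apply/orP; left; apply/eqP.
    by field; rewrite gt_eqF.
  by lra.
have Ale : `|A| <= e / 2 * N%:R.
  rewrite -(ler_pM2l (divr_gt0 c0 (ltr0Sn R 1))) (le_trans HA)//.
  by rewrite (le_trans (lerD t1 t2))//; lra.
have := HM GJ B1 k x GJB; rewrite -/A.
have -> : k%:R * (e / (8 * B1) * B1) = e / 8 * k%:R by field; rewrite gt_eqF.
have e8k : e / 8 * k%:R <= e / 8 * N%:R by rewrite ler_wpM2l// divr_ge0// ltW.
move=> H; rewrite -[X in `|X|](subrK A) (le_trans (ler_normD _ _))//.
by rewrite (le_trans (lerD H Ale))//; have := mulr_gt0 e0 (lt_le_trans ltr01 N1); lra.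
Qed.

End zero_averages.

Section zero_average_limit.
Context d (T : measurableType d) (R : realType) (P : probability T R).
Context (X : nat -> {RV P >-> int}).
Hypothesis X_iid : iid P X.
Hypothesis X_centered : ('E_P[fun w => (X 0%N w)%:~R] = 0)%E.
Hypothesis X_finite_variance : ('V_P[fun w => (X 0%N w)%:~R] < +oo)%E.
Hypothesis X_nondegenerate : nondegenerate_walk P X.
Hypothesis X_aperiodic : aperiodic_walk P X.
Implicit Types (f g h G : int -> R) (k m n N J L : nat) (x y z : int) (B e K : R).

Lemma measurable_additive_functional f N :
  measurable_fun setT (additive_functional f X N).
Proof. by apply: measurable_sum => n; exact: measurable_walk_fun. Qed.

Lemma additive_functional_bounded f B N w : (forall x, `|f x| <= B) ->
  `|additive_functional f X N w| <= N%:R * B.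
Proof.
move=> fB; rewrite /additive_functional big_add1 big_mkord.
by rewrite (le_trans (ler_norm_sum _ _ _))//; exact: ler_sum_ord_cst.
Qed.

(** The times spent beyond J, about K sqrt N, are few by Chebyshev's inequality. For the truncated
    functional, |t| <= p + t^2 / p with p = e N / 3 turns the second moment bound into a first
    moment bound. *)
Lemma additive_functional_zero_average G B e : (forall x, `|G x| <= B) -> 0 < e ->
  (forall a : R, 0 < a -> exists C : R, forall n,
    `|\sum_(i < n) G (Posz i)| <= a * n%:R + C /\
    `|\sum_(i < n) G (Negz i)| <= a * n%:R + C) ->
  exists N0, forall N, (N0 <= N)%N ->
    \int[P]_w `|additive_functional G X N w| <= e * N%:R.
Proof.
move=> GB' e0 Gavg.
have B'0 : 0 <= B := le_trans (normr_ge0 _) (GB' 0).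
pose B1 := B + 1.
have B0 : 0 < B1 by rewrite ltr_wpDl.
have GB x : `|G x| <= B1 by rewrite (le_trans (GB' x))// lerDl.
pose c := step_variance X.
have c0 : 0 < c := step_variance_gt0 X_iid X_centered X_finite_variance X_nondegenerate.
(* Since K >= 1, K^2 is at least K, so that 4 B1 c / K^2 <= e / 3. This is the share of the times
   beyond [J]; the 4 comes from K sqrt N < J + 1 <= 2 J. *)
pose K := 12 * B1 * c / e + 1.
have Be0 : 0 <= 12 * B1 * c / e.
  by rewrite divr_ge0 ?(ltW e0)// mulr_ge0 ?(ltW c0)// mulr_ge0// ltW.
have K1 : 1 <= K by rewrite lerDr.
have K0 : 0 < K by exact: lt_le_trans K1.
have KB : 4 * B1 * c / K ^+ 2 <= e / 3.
  rewrite ler_pdivrMr ?exprn_gt0// expr2 mulrA.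
  have E : e / 3 * K = 4 * B1 * c + e / 3 by rewrite /K; field; rewrite gt_eqF.
  have eK0 : 0 <= e / 3 * K by rewrite mulr_ge0 ?(ltW K0)// divr_ge0// ltW.
  by have := ler_peMr eK0 K1; lra.
(* Chosen so that the second moment bound 2 N B1 (e' N) equals (e N / 3)^2. *)
pose e' := e ^+ 2 / (18 * B1).
have e'0 : 0 < e' by rewrite divr_gt0 ?exprn_gt0// mulr_gt0.
have [N0 HN0] := potential_truncation X_iid X_centered X_finite_variance
  X_nondegenerate X_aperiodic GB K0 e'0 Gavg.
exists (maxn N0 1) => N; rewrite geq_max => /andP[N0N N1].
have N1R : 1 <= N%:R :> R by rewrite ler1n.
have NR0 : 0 < N%:R :> R by exact: lt_le_trans N1R.
pose s : R := Num.sqrt N%:R.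
have ss : s ^+ 2 = N%:R by rewrite sqr_sqrtr.
have s1 : 1 <= s by rewrite -sqrtr1 ler_sqrt.
pose J := Num.truncn (K * s).
have Ks0 : 0 <= K * s by rewrite mulr_ge0 ?(ltW K0)// (le_trans ler01).
have /andP[JK JK1] : J%:R <= K * s < J.+1%:R by exact: truncn_itv.
have J0 : (0 < J)%N.
  by rewrite -ltnS -(ltr_nat R) (le_lt_trans _ JK1)//; nra.
have J0R : 1 <= J%:R :> R by rewrite ler1n.
have J2 : K ^+ 2 * N%:R <= 4 * J%:R ^+ 2.
  rewrite -ss -exprMn (_ : 4 * _ = (2 * J%:R) ^+ 2); last by ring.
  rewrite lerXn2r ?nnegrE// ?mulr_ge0//; move: JK1; rewrite -natr1; lra.
pose GJ := truncation J G.
have GJB y : `|GJ y| <= B1 by exact: truncation_bounded.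
have HT : \int[P]_w additive_functional GJ X N w ^+ 2 <= 2 * N%:R * B1 * (e' * N%:R).
  apply: (additive_functional_sqr X_iid X_centered X_finite_variance GJB).
  by move=> k x kN; apply: HN0.
pose q w : R := \sum_(1 <= n < N.+1) (J < `|walk X n w|)%N%:R.
have iq1 n : P.-integrable setT (EFin \o (fun w => (J < `|walk X n w|)%N%:R : R)).
  apply: (@integrable_bounded _ _ _ _ _ 1).
    exact: (measurable_walk_fun X n (fun x => (J < `|x|)%N%:R : R)).
  by move=> w; rewrite normr_nat; case: ltnP.
have iq : P.-integrable setT (EFin \o q).
  apply: (@integrable_bounded _ _ _ _ _ (N%:R * 1)).
    by apply: measurable_sum => n; exact: (measurable_walk_fun X n (fun x => (J < `|x|)%N%:R : R)).
  move=> w; rewrite /q big_add1 big_mkord (le_trans (ler_norm_sum _ _ _))//.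
  by apply: ler_sum_ord_cst => i; rewrite normr_nat; case: ltnP.
have Hq : \int[P]_w q w <= N%:R * (4 * c / K ^+ 2).
  rewrite /q Rintegral_sum// big_add1 big_mkord; apply: ler_sum_ord_cst => n.
  rewrite (le_trans (chebyshev_walk X_iid X_centered X_finite_variance _ J0))//.
  rewrite -/c ler_pdivrMr ?exprn_gt0 ?(lt_le_trans ltr01)// mulrAC ler_pdivlMr ?exprn_gt0//.
  have : n.+1%:R * c <= N%:R * c by rewrite ler_wpM2r ?(ltW c0)// ler_nat.
  move=> /(ler_wpM2r (sqr_ge0 K))/le_trans; apply.
  by have := ler_wpM2l (ltW c0) J2; lra.
have Tdecomp w : `|additive_functional G X N w| <=
    e / 3 * N%:R + (e / 3 * N%:R)^-1 * additive_functional GJ X N w ^+ 2 + B1 * q w.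
  have -> : additive_functional G X N w = additive_functional GJ X N w +
      \sum_(1 <= n < N.+1) (G (walk X n w) - GJ (walk X n w)).
    by rewrite /additive_functional -big_split/=; apply: eq_bigr => n _; rewrite addrC subrK.
  rewrite (le_trans (ler_normD _ _))// lerD//.
    set t := additive_functional _ _ _ _.
    have p0 : 0 < e / 3 * N%:R by rewrite mulr_gt0// divr_gt0.
    rewrite -(real_normK (num_real t)) -(ler_pM2l p0) mulrDr mulVKf ?gt_eqF//.
    by have := sqr_ge0 (`|t| - e / 3 * N%:R); have := normr_ge0 t; nra.
  rewrite (le_trans (ler_norm_sum _ _ _))// /q mulr_sumr ler_sum// => n _.
  rewrite /GJ /truncation; case: leqP => nJ; first by rewrite subrr normr0 mulr0.
  by rewrite subr0 mulr1.
have iT2 : P.-integrable setT (EFin \o (fun w => additive_functional GJ X N w ^+ 2)).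
  apply: (@integrable_bounded _ _ _ _ _ ((N%:R * B1) ^+ 2)).
    by apply: measurable_funX; exact: measurable_additive_functional.
  move=> w; rewrite normrX lerXn2r ?nnegrE ?mulr_ge0 ?(ltW B0)//.
  exact: additive_functional_bounded.
have i1 := integrable_RD (integrable_Rcst P (e / 3 * N%:R)) (integrable_RZ (e / 3 * N%:R)^-1 iT2).
have i2 := integrable_RD i1 (integrable_RZ B1 iq).
apply: (@le_trans _ _ (\int[P]_w (e / 3 * N%:R +
    (e / 3 * N%:R)^-1 * additive_functional GJ X N w ^+ 2 + B1 * q w))).
  apply: le_Rintegral => //.
  apply: (@integrable_bounded _ _ _ _ _ (N%:R * B1)).
    by apply: measurableT_comp => //; exact: measurable_additive_functional.
  by move=> w; rewrite normr_id; exact: additive_functional_bounded.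
rewrite (RintegralD _ i1 (integrable_RZ B1 iq))//.
rewrite (RintegralD _ (integrable_Rcst P (e / 3 * N%:R)) (integrable_RZ (e / 3 * N%:R)^-1 iT2))//.
rewrite Rintegral_prob_cst (RintegralZl _ _ iT2)// (RintegralZl _ _ iq)//.
have h1 : (e / 3 * N%:R)^-1 * \int[P]_w additive_functional GJ X N w ^+ 2 <= e / 3 * N%:R.
  rewrite ler_pdivrMl ?mulr_gt0 ?divr_gt0// (le_trans HT)// /e'.
  rewrite le_eqVlt; apply/orP; left; apply/eqP.
  by field; rewrite gt_eqF.
have h2 : B1 * \int[P]_w q w <= e / 3 * N%:R.
  rewrite (le_trans (ler_wpM2l (ltW B0) Hq))//.
  by have := ler_wpM2l (ltW NR0) KB; lra.
by lra.
Qed.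

End zero_average_limit.

(** * The resolvent of the occupation time of the half-line *)

Section exponential_bounds.
Context (R : realType).
Implicit Types (x a r : R) (n m M N : nat).

Lemma expRN_le x : 0 <= x -> expR (- x) <= (1 + x)^-1.
Proof.
move=> x0; rewrite expRN lef_pV2 ?posrE ?expR_gt0//; last by rewrite ltr_wpDr.
exact: expR_ge1Dx.
Qed.

Lemma expRN_01 x : 0 <= x -> 0 <= expR (- x) <= 1.
Proof. by move=> x0; rewrite expR_ge0/= -expR0 ler_expR oppr_le0. Qed.

Lemma expRN_taylor x : 0 <= x -> 0 <= expR (- x) - 1 + x <= x ^+ 2.
Proof.
move=> x0; have := expR_ge1Dx (- x); have := expRN_le x0.
have x10 : 0 < 1 + x by rewrite ltr_wpDr.
have : (1 + x)^-1 <= 1 - x + x ^+ 2.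
  rewrite -[X in X <= _]mul1r ler_pdivrMr//.
  by have := exprn_ge0 3 x0; nra.
by move=> ? ? ?; apply/andP; split; lra.
Qed.

(** A Riemann sum of mesh 1 / N for the integral of e^(-a t). The number [r] is its value for the
    whole half-line, N^(-1) / (1 - e^(-a / N)), framed by means of 1 - x <= e^(-x) <= 1 / (1 +
    x). *)
Lemma geometric_expR a N M : 0 < a -> (0 < N)%N ->
  exists2 r : R, a^-1 <= r <= a^-1 + N%:R^-1 &
  N%:R^-1 * \sum_(n < M) expR (- (a * n%:R / N%:R)) = r * (1 - expR (- (a * M%:R / N%:R))).
Proof.
move=> a0 N0; have NR0 : 0 < N%:R :> R by rewrite ltr0n.
pose x := a / N%:R; have x0 : 0 < x by rewrite divr_gt0.
pose y := expR (- x).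
have y1 : y < 1 by rewrite -expR0 ltr_expR oppr_lt0.
have yE n : expR (- (a * n%:R / N%:R)) = y ^+ n.
  by rewrite /y -expRM_natl; congr expR; rewrite /x; ring.
have y1' : 0 < 1 - y by rewrite subr_gt0.
exists (N%:R^-1 / (1 - y)).
  apply/andP; split.
    rewrite ler_pdivlMr// ler_pdivrMl// mulrC.
    by have := expR_ge1Dx (- x); rewrite -/y /x; lra.
  have := expRN_le (ltW x0); rewrite -/y => H.
  have x1 : 0 < 1 + x by rewrite addr_gt0.
  have H2 : x / (1 + x) <= 1 - y.
    have -> : x / (1 + x) = 1 - (1 + x)^-1 by field; rewrite gt_eqF.
    by rewrite lerD2l lerN2.
  rewrite ler_pdivrMr//.
  rewrite [leLHS](_ : _ = (a^-1 + N%:R^-1) * (x / (1 + x))); last first.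
    by rewrite /x; field; rewrite !gt_eqF//= ?addr_gt0// mulr_gt0// addr_gt0.
  by rewrite ler_wpM2l// addr_ge0// invr_ge0 ltW.
rewrite yE (eq_bigr (fun n : 'I_M => y ^+ n)) => [|n _]; last exact: yE.
set S := \sum_(n < M) _.
have -> : S = (1 - y ^+ M) / (1 - y).
  by rewrite -[1 - y ^+ M]opprB subrX1 -/S -mulNr opprB mulrC mulKf// gt_eqF.
by rewrite mulrA mulrAC.
Qed.

Lemma geometric_expR_le a N M : 0 < a -> (0 < N)%N ->
  N%:R^-1 * \sum_(n < M) expR (- (a * n%:R / N%:R)) <= a^-1 + 1.
Proof.
move=> a0 N0; have [r /andP[r1 r2] ->] := geometric_expR M a0 N0.
have NV : N%:R^-1 <= 1 :> R by rewrite invf_le1 ?ltr0n// ler1n.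
rewrite (@le_trans _ _ r)//; last by rewrite (le_trans r2)// lerD2l.
rewrite ler_piMr ?gerBl ?expR_ge0//.
by rewrite (le_trans _ r1)// invr_ge0 ltW.
Qed.

Lemma geometric_expR_dist a N M : 0 < a -> (0 < N)%N ->
  `|N%:R^-1 * \sum_(n < M) expR (- (a * n%:R / N%:R)) - a^-1| <=
  N%:R^-1 + expR (- (a * M%:R / N%:R)) * (a^-1 + 1).
Proof.
move=> a0 N0; have [r /andP[r1 r2] ->] := geometric_expR M a0 N0.
have NV : N%:R^-1 <= 1 :> R by rewrite invf_le1 ?ltr0n// ler1n.
have r0 : 0 <= r by rewrite (le_trans _ r1)// invr_ge0 ltW.
set q := expR _; have -> : r * (1 - q) - a^-1 = (r - a^-1) - q * r by ring.
rewrite (le_trans (ler_normB _ _))// lerD//.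
  by rewrite ger0_norm ?subr_ge0// lerBlDl.
rewrite normrM !ger0_norm ?expR_ge0// ler_wpM2l ?expR_ge0//.
by rewrite (le_trans r2)// lerD2l.
Qed.

Lemma expr_lipschitz r n m : 0 <= r <= 1 -> `|r ^+ (n + m) - r ^+ n| <= m%:R * (1 - r).
Proof.
move=> /andP[r0 r1]; elim: m => [|m IHm]; first by rewrite addn0 subrr normr0 mul0r.
rewrite -natr1 mulrDl mul1r.
have -> : r ^+ (n + m.+1) - r ^+ n = (r ^+ (n + m) - r ^+ n) - r ^+ (n + m) * (1 - r).
  by rewrite addnS exprSr; ring.
rewrite (le_trans (ler_normB _ _))// lerD// normrM.
rewrite [ `|1 - r|]ger0_norm ?subr_ge0// ler_piMl ?subr_ge0//.
by rewrite ger0_norm ?exprn_ge0// exprn_ile1.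
Qed.

Lemma expr_lipschitz_dist r n m Z : 0 <= r <= 1 -> (`|n%:Z - m%:Z| <= Z)%N ->
  `|r ^+ n - r ^+ m| <= Z%:R * (1 - r).
Proof.
move=> r01; have r1 : 0 <= 1 - r by case/andP: r01; lra.
wlog mn : n m / (m <= n)%N => [H|] nmZ.
  case/orP: (leq_total m n) => mn; first exact: H.
  by rewrite distrC; apply: H => //; lia.
rewrite -(subnKC mn) (le_trans (expr_lipschitz _ _ r01))//.
by rewrite ler_wpM2r// ler_nat; lia.
Qed.

End exponential_bounds.

Section two_sided_profile.
Context (R : realType).
Implicit Types (ap am cp cm rp rm : R) (x : int) (n : nat).

Definition profile ap am cp cm rp rm x : R :=
  match x with Posz n => ap + cp * rp ^+ n | Negz n => am + cm * rm ^+ n.+1 end.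

Definition curvature cp cm rp rm x : R :=
  match x with
  | Posz 0 => 0
  | Posz n.+1 => cp * (1 - rp) ^+ 2 * rp ^+ n
  | Negz n => cm * (1 - rm) ^+ 2 * rm ^+ n
  end.

(** The first hypothesis makes both branches agree at 0, so that the formula for the left branch
    stays valid at -1. The second one balances the slopes on the two sides of 0, hence the value 0
    of [curvature] there. *)
Lemma second_difference_profile ap am cp cm rp rm :
  ap + cp = am + cm -> cp * (1 - rp) + cm * (1 - rm) = 0 ->
  second_difference (profile ap am cp cm rp rm) =1 curvature cp cm rp rm.
Proof.
move=> glue flux [[|n]|n]; rewrite /second_difference.
- have -> : 0%:Z + 1 = Posz 1 by []. have -> : 0%:Z - 1 = Negz 0 by [].
  by rewrite /= !expr1 expr0; lra.
- have -> : n.+1%:Z + 1 = Posz n.+2 by lia. have -> : n.+1%:Z - 1 = Posz n by lia.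
  by rewrite /= !exprS; ring.
- have -> : Negz n - 1 = Negz n.+1 by lia.
  case: n => [|n].
    have -> : Negz 0 + 1 = Posz 0 by [].
    by rewrite /= !exprS expr0; rewrite (_ : ap + cp * 1 = am + cm); [ring|lra].
  have -> : Negz n.+1 + 1 = Negz n by lia.
  by rewrite /= !exprS; ring.
Qed.

Lemma profile_bounded ap am cp cm rp rm x : 0 <= rp <= 1 -> 0 <= rm <= 1 ->
  `|profile ap am cp cm rp rm x| <= `|ap| + `|am| + `|cp| + `|cm|.
Proof.
have side (A B r : R) n : 0 <= r <= 1 -> `|A + B * r ^+ n| <= `|A| + `|B|.
  move=> /andP[r0 r1]; rewrite (le_trans (ler_normD _ _))// lerD2l normrM.
  by rewrite [ `|r ^+ n|]ger0_norm ?exprn_ge0// ler_piMr// exprn_ile1.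
move=> rp01 rm01; have := normr_ge0 ap; have := normr_ge0 am.
have := normr_ge0 cp; have := normr_ge0 cm.
case: x => n /=; first by have := side ap cp _ n rp01; lra.
by have := side am cm _ n.+1 rm01; lra.
Qed.

Lemma curvature_le cp cm rp rm x : 0 <= rp <= 1 -> 0 <= rm <= 1 ->
  `|curvature cp cm rp rm x| <= `|cp| * (1 - rp) ^+ 2 + `|cm| * (1 - rm) ^+ 2.
Proof.
have side (A r : R) n : 0 <= r <= 1 -> `|A * (1 - r) ^+ 2 * r ^+ n| <= `|A| * (1 - r) ^+ 2.
  move=> /andP[r0 r1]; rewrite 2!normrM (ger0_norm (sqr_ge0 _)).
  rewrite [ `|r ^+ n|]ger0_norm ?exprn_ge0// ler_piMr ?exprn_ile1//.
  by rewrite mulr_ge0 ?sqr_ge0.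
move=> rp01 rm01.
have cp0 : 0 <= `|cp| * (1 - rp) ^+ 2 by rewrite mulr_ge0 ?sqr_ge0.
have cm0 : 0 <= `|cm| * (1 - rm) ^+ 2 by rewrite mulr_ge0 ?sqr_ge0.
case: x => [[|n]|n] /=; first by rewrite normr0 addr_ge0.
  by rewrite (le_trans (side _ _ _ rp01))// lerDl.
by rewrite (le_trans (side _ _ _ rm01))// lerDr.
Qed.

(** The condition Z < |x| keeps [x + z] strictly on the side of [x]: across the origin the curvature
    jumps, while on one side it is geometric with a ratio close to 1. *)
Lemma curvature_oscillation cp cm rp rm (D : R) (Z : nat) x z :
  0 <= rp <= 1 -> 0 <= rm <= 1 -> 1 - rp <= D -> 1 - rm <= D ->
  (Z < `|x|)%N -> (`|z| <= Z)%N ->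
  `|curvature cp cm rp rm (x + z) - curvature cp cm rp rm x| <=
  (`|cp| * (1 - rp) ^+ 2 + `|cm| * (1 - rm) ^+ 2) * (Z%:R * D).
Proof.
have side (A r C : R) (i j : nat) : 0 <= r <= 1 -> 1 - r <= D -> `|A| * (1 - r) ^+ 2 <= C ->
    (`|i%:Z - j%:Z| <= Z)%N ->
    `|A * (1 - r) ^+ 2 * r ^+ i - A * (1 - r) ^+ 2 * r ^+ j| <= C * (Z%:R * D).
  move=> r01 rD AC ijZ; rewrite -mulrBr normrM; apply: ler_pM => //.
    by rewrite normrM (ger0_norm (sqr_ge0 _)).
  by rewrite (le_trans (expr_lipschitz_dist r01 ijZ))// ler_wpM2l.
move=> rp01 rm01 rpD rmD.
have cp0 : 0 <= `|cp| * (1 - rp) ^+ 2 by rewrite mulr_ge0 ?sqr_ge0.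
have cm0 : 0 <= `|cm| * (1 - rm) ^+ 2 by rewrite mulr_ge0 ?sqr_ge0.
case: x => n Zx zZ.
  have [i [j [-> -> ij]]] : exists i j, [/\ Posz n = Posz i.+1,
      Posz n + z = Posz j.+1 & (`|j%:Z - i%:Z| <= Z)%N].
    by clear -Zx zZ; exists n.-1, `|Posz n + z|.-1; split; lia.
  by apply: side => //; rewrite lerDl.
have [j [-> jn]] : exists j, Negz n + z = Negz j /\ (`|j%:Z - n%:Z| <= Z)%N.
  by clear -Zx zZ; exists `|Negz n + z|.-1; split; lia.
by apply: side => //; rewrite lerDr.
Qed.

(* c/2 times the second difference of A r^n against t (k u - 1), for
   u = 1/k + A r^n. *)
Lemma profile_fit (c s A B k r rn : R) : 0 <= rn <= 1 -> 0 < k -> 0 <= B -> 0 <= s ->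
  1 - r = B * s -> c / 2 * B ^+ 2 = k ->
  `|c / 2 * (A * (1 - r) ^+ 2 * rn) - s ^+ 2 * (k * (k^-1 + A * (r * rn)) - 1)| <=
  s ^+ 2 * (s * (`|A| * k * B)).
Proof.
move=> /andP[rn0 rn1] k0 B0 s0 rB ck.
have -> : c / 2 * (A * (1 - r) ^+ 2 * rn) - s ^+ 2 * (k * (k^-1 + A * (r * rn)) - 1) =
    s ^+ 2 * (s * (A * k * B)) * rn.
  rewrite rB exprMn [k * (_ + _)]mulrDr mulfV ?gt_eqF//.
  have -> : r = 1 - B * s by rewrite -rB; ring.
  have -> : c / 2 * (A * (B ^+ 2 * s ^+ 2) * rn) = c / 2 * B ^+ 2 * (A * s ^+ 2 * rn) by ring.
  by rewrite ck; ring.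
rewrite normrM (ger0_norm rn0).
rewrite -[leRHS]mulr1; apply: ler_pM => //.
rewrite normrM (ger0_norm (sqr_ge0 _)) ler_wpM2l ?sqr_ge0//.
rewrite normrM (ger0_norm s0) ler_wpM2l// !normrM (gtr0_norm k0) (ger0_norm B0)//.
Qed.

(** The constants do not depend on [s], which stands for N^(-1/2). On each half-line the continuous
    solution is 1 / k plus an exponential of rate sqrt (2 k / c), where k is a + b or a; the
    discrete one uses powers of 1 - s sqrt (2 k / c), and [D * s <= 1] keeps these ratios in [0, 1].
    The equation is not claimed at 0, where the second difference vanishes. *)
Lemma exists_corrector (a b c : R) : 0 < a -> 0 <= b -> 0 < c ->
  exists U C D F : R, [/\ 0 <= U, 0 <= C, 0 <= D, 0 <= F &
  forall s : R, 0 < s -> D * s <= 1 -> exists u : int -> R,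
  [/\ u 0 = (Num.sqrt (a * (a + b)))^-1,
      forall x, `|u x| <= U,
      forall x, `|second_difference u x| <= s ^+ 2 * C,
      forall (Z : nat) x z, (Z < `|x|)%N -> (`|z| <= Z)%N ->
        `|second_difference u (x + z) - second_difference u x| <=
        s ^+ 2 * C * (Z%:R * (D * s)) &
      forall x, x != 0 -> `|c / 2 * second_difference u x -
        s ^+ 2 * ((a + b * (0 <= x)%R%:R) * u x - 1)| <= s ^+ 2 * (s * F)]].
Proof.
move=> a0 b0 c0.
have ab0 : 0 < a + b by rewrite ltr_wpDr.
have [m m0 mm] : exists2 m : R, 0 < m & m ^+ 2 = a.
  by exists (Num.sqrt a); rewrite ?sqrtr_gt0// sqr_sqrtr// ltW.
have [p p0 pp] : exists2 p : R, 0 < p & p ^+ 2 = a + b.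
  by exists (Num.sqrt (a + b)); rewrite ?sqrtr_gt0// sqr_sqrtr// ltW.
have [tau tau0 tautau] : exists2 tau : R, 0 < tau & tau ^+ 2 = 2 / c.
  by exists (Num.sqrt (2 / c)); rewrite ?sqrtr_gt0 ?divr_gt0// sqr_sqrtr// divr_ge0// ltW.
have -> : Num.sqrt (a * (a + b)) = m * p.
  by rewrite -pp -mm -exprMn sqrtr_sqr gtr0_norm// mulr_gt0.
have tau_half (q : R) : c / 2 * (tau * q) ^+ 2 = q ^+ 2.
  by rewrite exprMn tautau; field; rewrite gt_eqF.
have qp0 : 0 < tau * p by exact: mulr_gt0.
have qm0 : 0 < tau * m by exact: mulr_gt0.
(* Matching values and slopes at 0 forces u(0) (p + m) = 1 / p + 1 / m, so u(0) = 1 / (m p). This is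
   where the square root of a (a + b) comes from. *)
pose cp : R := (m * p)^-1 - (a + b)^-1; pose cm : R := (m * p)^-1 - a^-1.
have flux : cp * (tau * p) + cm * (tau * m) = 0.
  by rewrite /cp /cm -pp -mm; field; rewrite !gt_eqF.
pose F : R := `|cp| * (a + b) * (tau * p) + `|cm| * a * (tau * m).
have Fp0 : 0 <= `|cp| * (a + b) * (tau * p) by rewrite !mulr_ge0// ltW.
have Fm0 : 0 <= `|cm| * a * (tau * m) by rewrite !mulr_ge0// ltW.
exists (`|(a + b)^-1| + `|a^-1| + `|cp| + `|cm|).
exists (`|cp| * (tau * p) ^+ 2 + `|cm| * (tau * m) ^+ 2).
exists (tau * p + tau * m), F; split.
- by rewrite !addr_ge0.
- by rewrite addr_ge0// mulr_ge0// sqr_ge0.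
- by rewrite addr_ge0// ltW.
- by rewrite addr_ge0.
move=> s s0 Ds.
have s00 := ltW s0.
have sp0 : 0 <= tau * p * s by rewrite mulr_ge0// ltW.
have sm0 : 0 <= tau * m * s by rewrite mulr_ge0// ltW.
rewrite mulrDl in Ds.
pose rp := 1 - tau * p * s; pose rm := 1 - tau * m * s.
have rpE : 1 - rp = tau * p * s by rewrite /rp opprB addrC subrK.
have rmE : 1 - rm = tau * m * s by rewrite /rm opprB addrC subrK.
have rp01 : 0 <= rp <= 1 by apply/andP; rewrite /rp; clear -sp0 sm0 Ds; split; lra.
have rm01 : 0 <= rm <= 1 by apply/andP; rewrite /rm; clear -sp0 sm0 Ds; split; lra.
pose u := profile (a + b)^-1 a^-1 cp cm rp rm.
have sdu : second_difference u = curvature cp cm rp rm.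
  apply/funext; apply: second_difference_profile; first by rewrite /cp /cm addrC subrK addrC subrK.
  by rewrite rpE rmE !mulrA -mulrDl -!mulrA flux mul0r.
have CE : `|cp| * (1 - rp) ^+ 2 + `|cm| * (1 - rm) ^+ 2 =
    s ^+ 2 * (`|cp| * (tau * p) ^+ 2 + `|cm| * (tau * m) ^+ 2).
  by rewrite rpE rmE; ring.
exists u; split.
- by rewrite /u /= mulr1 /cp addrC subrK.
- by move=> x; exact: profile_bounded.
- by move=> x; rewrite sdu -CE; exact: curvature_le.
- move=> Z x z Zx zZ; rewrite sdu -CE.
  by apply: curvature_oscillation => //; rewrite ?rpE ?rmE mulrDl ?lerDl ?lerDr.
move=> x x0; rewrite sdu.
have rpn n : 0 <= rp ^+ n <= 1.
  by case/andP: rp01 => ? ?; rewrite exprn_ge0//= exprn_ile1.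
have rmn n : 0 <= rm ^+ n <= 1.
  by case/andP: rm01 => ? ?; rewrite exprn_ge0//= exprn_ile1.
case: x x0 => [[|n]|n] // _.
  rewrite (_ : (0 <= n.+1%:Z)%R = true)// mulr1 /u /= [rp ^+ n.+1]exprS.
  apply: le_trans (profile_fit cp (rpn n) ab0 (ltW qp0) s00 rpE _) _.
    by rewrite tau_half.
  by rewrite ler_wpM2l ?sqr_ge0// ler_wpM2l// /F lerDl.
rewrite (_ : (0 <= Negz n)%R = false)// mulr0 addr0 /u /= [rm ^+ n.+1]exprS.
apply: le_trans (profile_fit cm (rmn n) a0 (ltW qm0) s00 rmE _) _.
  by rewrite tau_half.
by rewrite ler_wpM2l ?sqr_ge0// ler_wpM2l// /F lerDr.
Qed.

End two_sided_profile.

Ltac nonneg := repeat first [by [] | exact: sqr_ge0 | by apply: ltW |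
  apply: addr_ge0 | apply: divr_ge0 | apply: mulr_ge0].

(** Expansion of the discount factor to first order in the time step [t]: it reduces the discounted
    equation to P u - u = t (k u - 1), with an error of order t^2. *)
Lemma discount_estimate (R : realType) (t k kmax u U Pu : R) :
  0 <= t -> 0 <= k <= kmax -> `|u| <= U ->
  `|expR (- (k * t)) * Pu - u + t| <=
  t ^+ 2 * (kmax ^+ 2 * U + kmax * (kmax * U + 1)) + `|Pu - u - t * (k * u - 1)|.
Proof.
move=> t0 /andP[k0 kmx] uU.
have kt0 : 0 <= k * t by exact: mulr_ge0.
have /andP[r2 r2'] := expRN_taylor kt0.
have r1 : expR (- (k * t)) <= 1 by rewrite -expR0 ler_expR oppr_le0.
have r0 := expR_gt0 (- (k * t)); set r := expR _ in r0 r1 r2 r2' *.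
have U0 : 0 <= U by exact: le_trans uU.
have km0 : 0 <= kmax by exact: le_trans kmx.
set E := Pu - u - _.
have -> : r * Pu - u + t = (r - 1 + k * t) * u + ((r - 1) * t * (k * u - 1) + r * E).
  by rewrite /E; ring.
have k2 : (k * t) ^+ 2 <= kmax ^+ 2 * t ^+ 2.
  by rewrite exprMn ler_wpM2r ?sqr_ge0// lerXn2r ?nnegrE.
have e1 : `|(r - 1 + k * t) * u| <= t ^+ 2 * (kmax ^+ 2 * U).
  rewrite normrM mulrA [t ^+ 2 * _]mulrC; apply: ler_pM => //.
  by rewrite ger0_norm// (le_trans r2').
have e2 : `|(r - 1) * t * (k * u - 1)| <= t ^+ 2 * (kmax * (kmax * U + 1)).
  rewrite normrM [leRHS]mulrA; apply: ler_pM => //.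
    rewrite normrM (ger0_norm t0) distrC ger0_norm ?subr_ge0//.
    have : 1 - r <= kmax * t by have := ler_wpM2r t0 kmx; lra.
    by move=> /(ler_wpM2r t0); lra.
  rewrite (le_trans (ler_normB _ _))// normr1 lerD2r normrM ger0_norm//.
  exact: ler_pM.
have e3 : `|r * E| <= `|E|.
  by rewrite normrM (ger0_norm (ltW r0)) ler_piMl.
move: e1 e2 e3; set A := _ * u; set B := _ * (k * u - 1); set D := r * E.
move=> e1 e2 e3; have := ler_normD A (B + D); have := ler_normD B D; lra.
Qed.

Section resolvent.
Context d (T : measurableType d) (R : realType) (P : probability T R).
Context (X : nat -> {RV P >-> int}).
Hypothesis X_iid : iid P X.
Hypothesis X_centered : ('E_P[fun w => (X 0%N w)%:~R] = 0)%E.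
Hypothesis X_finite_variance : ('V_P[fun w => (X 0%N w)%:~R] < +oo)%E.
Hypothesis X_nondegenerate : nondegenerate_walk P X.
Implicit Types (k m n N Z : nat) (x y z : int).

(** Away from the origin, P u - u is close to c / 2 times the second difference, hence to (k u - 1)
    / N. For |x| <= Z a step of size at most [Z] may cross the jump of the curvature, and only the
    crude bound C / N is available. *)
Lemma resolvent_corrector (a b eta : R) : 0 < a -> 0 <= b -> 0 < eta ->
  exists (U C : R) (Z N0 : nat), [/\ 0 <= U, 0 <= C & forall N, (N0 <= N)%N ->
  exists u : int -> R, [/\ u 0 = (Num.sqrt (a * (a + b)))^-1,
    forall x, `|u x| <= U &
    forall x, `|expR (- ((a + b * (0 <= x)%R%:R) * N%:R^-1)) * transition X 1 u x
                - u x + N%:R^-1| <=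
      N%:R^-1 * (eta + C * (`|x| <= Z)%N%:R)]].
Proof.
move=> a0 b0 eta0.
pose c := step_variance X.
have c0 : 0 < c := step_variance_gt0 X_iid X_centered X_finite_variance X_nondegenerate.
have ab0 : 0 < a + b by rewrite ltr_wpDr.
have [U [C2 [D [F [U0 C20 D0 F0 corr]]]]] := exists_corrector a0 b0 c0.
have [Z HZ] : exists Z, C2 * step_tail X Z <= eta / 3.
  have [|Z HZ] := step_tail_small X_iid X_centered X_finite_variance (e := eta / 3 / (C2 + 1)).
    by rewrite !divr_gt0// ltr_wpDl.
  exists Z; have t0 := step_tail_ge0 X Z; move: HZ.
  rewrite ler_pdivlMr ?ltr_wpDl// mulrDr mulr1 mulrC; apply: le_trans.
  by rewrite lerDl.
pose C4 : R := C2 * c + c / 2 * C2 + (a + b) * U + 1.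
pose C5 : R := (a + b) ^+ 2 * U + (a + b) * ((a + b) * U + 1).
have ab00 := ltW ab0.
have C40 : 0 <= C4 by rewrite /C4; nonneg.
have C50 : 0 <= C5 by rewrite /C5; nonneg.
(* [K6] collects the errors that carry an extra factor [s]: oscillation over the window, misfit of
   the geometric profile, second order of the discount. [S] will make s K6 at most eta / 3. *)
have [K6 K60 K6E] : exists2 K6, 0 <= K6 & K6 = C2 * Z%:R * D * c / 2 + F + C5.
  by eexists; [|reflexivity]; nonneg.
pose S : R := D + 3 * K6 / eta + 1.
have K6eta : 0 <= 3 * K6 / eta by nonneg.
have S1 : 1 <= S by rewrite /S lerDr addr_ge0.
pose N0 := (Num.truncn (S ^+ 2)).+1.
exists U, C4, Z, N0; split => // N N0N.
have NS : S ^+ 2 <= N%:R by rewrite (le_trans (ltW (truncnS_gt _)))// ler_nat.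
have NR1 : 1 <= N%:R :> R by rewrite (le_trans _ NS)// exprn_ege1.
have NR0 : 0 < N%:R :> R by exact: lt_le_trans NR1.
have [s [s0 ss sS]] : exists s : R, [/\ 0 < s, s ^+ 2 = N%:R^-1 & s * S <= 1].
  exists (Num.sqrt N%:R)^-1; split; first by rewrite invr_gt0 sqrtr_gt0.
    by rewrite exprVn sqr_sqrtr.
  rewrite ler_pdivrMl ?sqrtr_gt0// mulr1.
  rewrite -(@ler_pXn2r _ 2)// ?nnegrE ?sqrtr_ge0 ?(le_trans ler01 S1)//.
  by rewrite sqr_sqrtr.
have s00 := ltW s0.
have s1 : s <= 1 by have := ler_wpM2l s00 S1; rewrite mulr1 => /le_trans; apply.
have sD : D * s <= 1.
  rewrite mulrC (le_trans _ sS)// ler_wpM2l// /S -addrA lerDl.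
  by rewrite addr_ge0.
have s6 : s * K6 <= eta / 3.
  have : 3 * K6 / eta <= S by rewrite /S -addrA addrCA lerDl addr_ge0.
  rewrite ler_pdivrMr// => /(ler_wpM2l s00) H.
  have H2 := ler_wpM2r (ltW eta0) sS; clear -H H2; lra.
have [u [u0 uU sdC osc fit]] := corr s s0 sD.
exists u; split=> //.
move=> x; rewrite -ss.
set k := a + b * _.
have k0 : 0 <= k <= a + b.
  rewrite /k addr_ge0 ?mulr_ge0 ?(ltW a0)//= lerD2l.
  by rewrite ler_piMr// lern1 leq_b1.
have t0 : 0 <= s ^+ 2 by exact: sqr_ge0.
rewrite (le_trans (discount_estimate (transition X 1 u x) t0 k0 (uU x)))// -/C5.
set E1 := transition X 1 u x - u x - _.
have sdC' y : `|second_difference u y| <= s ^+ 2 * C2 by exact: sdC.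
set g := second_difference u x in sdC'.
have t4 : (s ^+ 2) ^+ 2 * C5 <= s ^+ 2 * (s * C5).
  rewrite expr2 -mulrA ler_wpM2l// ler_wpM2r// expr2.
  by rewrite -[leRHS]mulr1 ler_wpM2l.
have tailE : s ^+ 2 * C2 * step_tail X Z <= s ^+ 2 * (eta / 3).
  by rewrite -mulrA ler_wpM2l.
have E1E : E1 = (transition X 1 u x - u x - c / 2 * g) +
    (c / 2 * g - s ^+ 2 * (k * u x - 1)) by rewrite /E1; ring.
suff : `|E1| <= s ^+ 2 * (s * (C2 * Z%:R * D * c / 2 + F)) + s ^+ 2 * (eta / 3)
    + s ^+ 2 * (C4 * (`|x| <= Z)%N%:R).
  have := ler_wpM2l t0 s6; rewrite K6E; clear -t4 eta0 t0; move: (_%:R) => q.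
  by have := mulr_ge0 t0 (ltW eta0); lra.
rewrite E1E (le_trans (ler_normD _ _))//.
case: (leqP `|x| Z) => xZ; last first.
  have := generator_estimate X_iid X_centered X_finite_variance sdC'
    (fun z zZ => osc Z x z xZ zZ).
  have x0 : x != 0 by apply/eqP => x0; move: xZ; rewrite x0.
  have := fit x x0; rewrite -/k -/g -/c; clear -tailE.
  rewrite [C4 * _]mulr0 [s ^+ 2 * 0]mulr0 addr0.
  set A := `|_|; set B := `|_|; lra.
have osc2 z : (`|z| <= Z)%N -> `|second_difference u (x + z) - g| <= 2 * (s ^+ 2 * C2).
  move=> _; rewrite (le_trans (ler_normB _ _))//.
  have h1 := sdC' (x + z); have h2 := sdC x; clear -h1 h2; rewrite -/g in h2 *; lra.
have := generator_estimate X_iid X_centered X_finite_variance sdC' osc2.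
rewrite -/g -/c => G1.
have G2 : `|c / 2 * g - s ^+ 2 * (k * u x - 1)| <=
    c / 2 * (s ^+ 2 * C2) + s ^+ 2 * ((a + b) * U + 1).
  rewrite (le_trans (ler_normB _ _))// lerD//.
    by rewrite normrM ger0_norm ?ler_wpM2l ?sdC ?divr_ge0 ?(ltW c0)//; exact: sdC.
  rewrite normrM (ger0_norm t0) ler_wpM2l// (le_trans (ler_normB _ _))// normr1 lerD2r.
  by case/andP: k0 => k0 k1; rewrite normrM (ger0_norm k0) ler_pM.
have t3 : 0 <= s ^+ 2 * (s * (C2 * Z%:R * D * c / 2 + F)) by nonneg.
rewrite mulr1 /C4; clear -G1 G2 tailE t3.
move: G1 G2; set A := `|_|; set B := `|c / 2 * g - _|; lra.
Qed.

End resolvent.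

(** * The occupation time of the half-line and its discounted Laplace transform *)

Section occupation.
Context d (T : measurableType d) (R : realType) (P : probability T R).
Context (X : nat -> {RV P >-> int}).
Implicit Types (k m n N M Z : nat) (x y z : int) (a b t : R).

(** Time 0 is counted and time [n] is not, unlike in [additive_functional]: the discount at time [n]
    must not yet contain the factor of the site [walk X n], which comes in with the next step of the
    walk. *)
Definition occupation_time n w : nat := \sum_(k < n) (0 <= walk X k w)%R.

Lemma occupation_timeS n w :
  occupation_time n.+1 w = (occupation_time n w + (0 <= walk X n w)%R)%N.
Proof. by rewrite /occupation_time big_ord_recr. Qed.

Lemma occupation_time_le n w : (occupation_time n w <= n)%N.
Proof.
elim: n => [|n IHn]; rewrite ?/occupation_time ?big_ord0//.
by rewrite -/(occupation_time _ _) occupation_timeS; case: (0 <= _)%R; lia.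
Qed.

Let prefix_occupation (s : seq int) : nat :=
  \sum_(k < size s) (0 <= \sum_(x <- take k s) x)%R.

Let prefix_occupationE n w : prefix_occupation (steps X n w) = occupation_time n w.
Proof.
rewrite /prefix_occupation size_steps; apply: eq_bigr => k _.
by rewrite walk_steps take_steps// ltnW.
Qed.

Lemma measurable_occupation_time (f : nat -> R) n :
  measurable_fun setT (fun w => f (occupation_time n w)).
Proof.
under eq_fun do rewrite -prefix_occupationE.
exact: (@measurableT_comp _ _ _ _ _ _ (fun s : seq int => f (prefix_occupation s))).
Qed.

Definition occupation_laplace b N n : R :=
  \int[P]_w expR (- (b * (occupation_time n w)%:R / N%:R)).

Definition discount a b t n w : R :=
  expR (- ((a * n%:R + b * (occupation_time n w)%:R) * t)).

Lemma measurable_discount a b t n : measurable_fun setT (discount a b t n).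
Proof. exact: (measurable_occupation_time (fun o => expR (- ((a * n%:R + b * o%:R) * t)))). Qed.

Lemma discount_le a b t n w : 0 <= b -> 0 <= t -> discount a b t n w <= expR (- (a * n%:R * t)).
Proof.
by move=> b0 t0; rewrite ler_expR lerN2 ler_wpM2r// lerDl mulr_ge0.
Qed.

Lemma discountS a b t n w : discount a b t n.+1 w =
  discount a b t n w * expR (- ((a + b * (0 <= walk X n w)%R%:R) * t)).
Proof.
rewrite /discount -expRD; congr expR.
by rewrite occupation_timeS natrD -natr1; ring.
Qed.

Hypothesis X_iid : iid P X.
Hypothesis X_centered : ('E_P[fun w => (X 0%N w)%:~R] = 0)%E.
Hypothesis X_finite_variance : ('V_P[fun w => (X 0%N w)%:~R] < +oo)%E.

Lemma discount_step a b t n u (U : R) : 0 <= a -> 0 <= b -> 0 <= t ->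
  (forall x, `|u x| <= U) ->
  \int[P]_w (discount a b t n.+1 w * u (walk X n.+1 w)) =
  \int[P]_w (discount a b t n w *
    (expR (- ((a + b * (0 <= walk X n w)%R%:R) * t)) * transition X 1 u (walk X n w))).
Proof.
move=> a0 b0 t0 uU.
pose Phi s : R := expR (- ((a * n%:R + b * (prefix_occupation s)%:R) * t)) *
  expR (- ((a + b * (0 <= \sum_(x <- s) x)%R%:R) * t)).
have Phi1 s : `|Phi s| <= 1.
  rewrite /Phi -expRD ger0_norm ?expR_ge0// -expR0 ler_expR -opprD oppr_le0.
  by rewrite addr_ge0// mulr_ge0// addr_ge0// mulr_ge0.
have PhiE w : Phi (steps X n w) = discount a b t n w *
    expR (- ((a + b * (0 <= walk X n w)%R%:R) * t)).
  by rewrite /Phi prefix_occupationE walk_steps.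
under eq_Rintegral do rewrite discountS -PhiE.
rewrite (markov_step X_iid X_centered X_finite_variance n Phi1 (quadratic_growth_bounded uU)).
by apply: eq_Rintegral => w _; rewrite PhiE mulrA.
Qed.

Hypothesis X_nondegenerate : nondegenerate_walk P X.
Hypothesis X_aperiodic : aperiodic_walk P X.

(* With u the corrector, E (discount n * u (S_n)) telescopes. The defect of u near
   the origin is negligible, because the walk escapes from bounded sets. *)
Lemma occupation_laplace_resolvent a b (e : R) : 0 < a -> 0 <= b -> 0 < e ->
  exists N0, forall N, (N0 <= N)%N -> exists M0, forall M, (M0 <= M)%N ->
  `|N%:R^-1 * \sum_(n < M) expR (- (a * n%:R / N%:R)) * occupation_laplace b N n
     - (Num.sqrt (a * (a + b)))^-1| <= e.
Proof.
move=> a0 b0 e0.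
have a1 : 0 < a^-1 + 1 by rewrite addr_gt0 ?invr_gt0.
pose eta := e / 4 / (a^-1 + 1).
have eta0 : 0 < eta by rewrite !divr_gt0.
have [U [C [Z [N1 [U0 C0 corr]]]]] := resolvent_corrector X_iid X_centered
  X_finite_variance X_nondegenerate a0 b0 eta0.
have C1 : 0 < C + 1 by rewrite ltr_wpDl.
have [M1 escM1] := walk_escapes X_iid X_centered X_finite_variance
  X_nondegenerate X_aperiodic Z (divr_gt0 eta0 C1).
(* Before time [M1] nothing is known about the visits to the window; they cost at most C M1 / N,
   hence at most e / 4. Later their probability is at most eta / (C + 1), so the defect is absorbed
   by a second [eta]. *)
pose N2 := (Num.truncn (C * M1%:R / (e / 4))).+1.
exists (maxn N1 N2) => N; rewrite geq_max => /andP[N1N N2N].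
have NR0 : 0 < N%:R :> R by rewrite ltr0n; exact: leq_trans N2N.
have N0 : (0 < N)%N by exact: leq_trans N2N.
have CM1 : N%:R^-1 * (C * M1%:R) <= e / 4.
  rewrite ler_pdivrMl// -ler_pdivrMr ?divr_gt0// (le_trans (ltW (truncnS_gt _)))//.
  by rewrite ler_nat.
have [u [u0 uU uE]] := corr N N1N.
pose t : R := N%:R^-1.
have t0 : 0 < t by rewrite invr_gt0.
pose V := discount a b t.
have V0 n w : 0 <= V n w by exact: expR_ge0.
have Vle n w : V n w <= expR (- (a * n%:R / N%:R)) by apply: discount_le => //; exact: ltW.
have g1 n : expR (- (a * n%:R / N%:R)) <= 1 :> R.
  by rewrite -expR0 ler_expR oppr_le0 !mulr_ge0// ltW.
have V1 n w : `|V n w| <= 1 by rewrite ger0_norm// (le_trans (Vle _ _)).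
have mV n := measurable_discount a b t n.
have intV n (f : int -> R) (B : R) : (forall x, `|f x| <= B) ->
    P.-integrable setT (EFin \o (fun w => V n w * f (walk X n w))).
  move=> fB; apply: (@integrable_bounded _ _ _ _ _ (1 * B)).
    by apply: measurable_funM => //; exact: measurable_walk_fun.
  by move=> w; rewrite normrM ler_pM.
have iV n : P.-integrable setT (EFin \o V n).
  exact: (@integrable_bounded _ _ _ _ _ 1).
pose p n := \int[P]_w (`|walk X n w| <= Z)%N%:R : R.
pose chi x : R := (`|x| <= Z)%N%:R.
have chi01 x : 0 <= chi x <= 1 by rewrite /chi ler0n lern1 leq_b1.
have chi1 x : `|chi x| <= 1 by have /andP[? ?] := chi01 x; rewrite ger0_norm.
have ichi n : P.-integrable setT (EFin \o (fun w => chi (walk X n w))).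
  by apply: (@integrable_bounded _ _ _ _ _ 1) => //; exact: measurable_walk_fun.
have p0 n : 0 <= p n by apply: Rintegral_ge0.
have p1 n : p n <= 1.
  by apply: (Rintegral_le_cst (ichi n)) => w; have /andP[] := chi01 (walk X n w).
pose W n := \int[P]_w (V n w * u (walk X n w)).
pose g n : R := expR (- (a * n%:R / N%:R)).
have step n : `|W n.+1 - W n + t * \int[P]_w V n w| <= t * (g n * (eta + C * p n)).
  rewrite /W (discount_step n (ltW a0) b0 (ltW t0) uU) -/(V n).
  pose r x : R := expR (- ((a + b * (0 <= x)%R%:R) * t)) * transition X 1 u x.
  have rU x : `|r x| <= U.
    rewrite /r normrM -[leRHS]mul1r ler_pM//; last exact: transition_bounded.
    rewrite ger0_norm ?expR_ge0// -expR0 ler_expR oppr_le0 mulr_ge0 ?(ltW t0)//.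
    by rewrite addr_ge0 ?mulr_ge0// ltW.
  rewrite -RintegralB//; [|exact: (intV n r U)|exact: (intV n u U)].
  rewrite -(RintegralZl t measurableT (iV n)).
  have iA : P.-integrable setT (EFin \o (fun w => V n w * r (walk X n w) - V n w * u (walk X n w))).
    by apply: integrable_RB; [exact: (intV n r U)|exact: (intV n u U)].
  rewrite -RintegralD//; last exact: integrable_RZ.
  rewrite (le_trans (le_normr_Rintegral _ _))//.
    by apply: integrable_RD => //; exact: integrable_RZ.
  apply: (@le_trans _ _ (\int[P]_w (t * (g n * (eta + C * chi (walk X n w)))))).
    apply: le_Rintegral => //.
    - have /integrable_norm := integrable_RD iA (integrable_RZ t (iV n)); exact.
    - apply/integrable_RZ/integrable_RZ/integrable_RD; first exact: integrable_Rcst.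
      exact: integrable_RZ.
    move=> w _.
    rewrite -mulrBr [t * _]mulrC -mulrDr normrM mulrCA; apply: ler_pM => //.
    by rewrite ger0_norm//; exact: Vle.
  rewrite RintegralZl//; last first.
    apply/integrable_RZ/integrable_RD; first exact: integrable_Rcst.
    exact: integrable_RZ.
  rewrite RintegralZl//; last first.
    apply/integrable_RD; first exact: integrable_Rcst.
    exact: integrable_RZ.
  rewrite RintegralD//; [|exact: integrable_Rcst|exact: integrable_RZ].
  by rewrite Rintegral_prob_cst RintegralZl.
have W0 : W 0 = (Num.sqrt (a * (a + b)))^-1.
  rewrite -u0 -[RHS](Rintegral_prob_cst P); apply: eq_Rintegral => w _.
  rewrite /V /discount /occupation_time big_ord0 /walk big_nil !mulr0 addr0 mul0r.
  by rewrite oppr0 expR0 mul1r.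
have pM1 n : g n * (C * p n) <= g n * eta + C * (n < M1)%N%:R.
  have gn0 : 0 <= g n by exact: expR_ge0.
  case: ltnP => nM1.
    rewrite [C * true%:R]mulr1 ler_wpDl//; first by apply: mulr_ge0 => //; exact: ltW.
    rewrite (@le_trans _ _ (C * p n)) ?ler_piMr// ler_piMl ?mulr_ge0//.
    exact: g1.
  rewrite [C * false%:R]mulr0 addr0 ler_wpM2l//.
  have := escM1 n nM1; rewrite -/(p n) ler_pdivlMr// => H.
  by apply: le_trans H; rewrite mulrC ler_wpM2l// lerDl.
have tele M : `|W M - W 0 + t * \sum_(n < M) \int[P]_w V n w| <=
    t * \sum_(n < M) (2 * (g n * eta) + C * (n < M1)%N%:R).
  elim: M => [|M IHM]; first by rewrite !big_ord0 subrr mulr0 addr0 normr0.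
  rewrite !big_ord_recr /= !mulrDr.
  have -> : W M.+1 - W 0 + (t * \sum_(n < M) \int[P]_w V n w + t * \int[P]_w V M w) =
    (W M - W 0 + t * \sum_(n < M) \int[P]_w V n w) + (W M.+1 - W M + t * \int[P]_w V M w).
    by ring.
  rewrite (le_trans (ler_normD _ _))// lerD// (le_trans (step M))//.
  rewrite -mulrDr ler_wpM2l ?(ltW t0)// mulrDr.
  by have := pM1 M; set q := C * (_%:R); lra.
have sumM1 M : \sum_(n < M) (n < M1)%N%:R <= M1%:R :> R.
  rewrite -natr_sum ler_nat.
  rewrite -(big_mkord xpredT (fun n => (n < M1)%N : nat)).
  elim: M => [|M]; first by rewrite big_nil.
  rewrite big_nat_recr//=; case: ltnP; last by rewrite addn0.
  move=> MM1 _; apply: leq_trans MM1; rewrite addn1 ltnS.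
  rewrite -[X in (_ <= X)%N](subn0 M) -[X in (_ <= X)%N]muln1 -sum_nat_const_nat.
  by apply: leq_sum => i _; exact: leq_b1.
have err M : t * \sum_(n < M) (2 * (g n * eta) + C * (n < M1)%N%:R) <= 3 * (e / 4).
  rewrite big_split/= -!mulr_sumr -mulr_suml mulrDr.
  have h1 : t * (C * \sum_(n < M) (n < M1)%N%:R) <= e / 4.
    by apply: le_trans CM1; rewrite ler_wpM2l ?(ltW t0)// ler_wpM2l.
  have h2 : t * \sum_(n < M) g n <= a^-1 + 1 by exact: geometric_expR_le.
  have h3 : t * ((\sum_(n < M) g n) * eta) <= e / 4.
    rewrite mulrA (le_trans (ler_wpM2r (ltW eta0) h2))// mulrC /eta divfK//.
    by rewrite gt_eqF.
  rewrite mulrCA; clear -h1 h3; lra.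
(* The boundary term of the telescoping sum is at most U e^(-a M / N); by x <= e^x it falls below e
   / 4 once a M / N >= U / (e / 4). *)
pose M0 := (Num.truncn (N%:R / a * (U / (e / 4)))).+1.
exists M0 => M M0M.
have WM : `|W M| <= e / 4.
  have : `|W M| <= g M * U.
    rewrite (le_trans (le_normr_Rintegral _ _))//; first exact: intV.
    apply: Rintegral_le_cst; first by have /integrable_norm := intV M _ _ uU; exact.
    by move=> w; rewrite normrM ler_pM// ger0_norm//; exact: Vle.
  move/le_trans; apply.
  have UM : U / (e / 4) <= a * M%:R / N%:R.
    rewrite ler_pdivlMr// -ler_pdivrMl// mulrA [_^-1 * _]mulrC mulrAC.
    rewrite [_ * N%:R]mulrC mulrAC.
    by rewrite (le_trans (ltW (truncnS_gt _)))// ler_nat.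
  rewrite /g expRN ler_pdivrMl ?expR_gt0// -ler_pdivrMr ?divr_gt0//.
  by rewrite (le_trans UM)// (le_trans _ (expR_ge1Dx _))// lerDr.
have VE n : \int[P]_w V n w = g n * occupation_laplace b N n.
  rewrite /occupation_laplace -RintegralZl//; last first.
    apply: (@integrable_bounded _ _ _ _ _ 1) => [|w].
      exact: (measurable_occupation_time (fun o => expR (- (b * o%:R / N%:R)))).
    by rewrite ger0_norm ?expR_ge0// -expR0 ler_expR oppr_le0 !mulr_ge0// ltW.
  apply: eq_Rintegral => w _; rewrite /V /discount /g -expRD; congr expR.
  by rewrite mulrDl opprD.
have := le_trans (tele M) (err M); rewrite W0.
under eq_bigr do rewrite VE.
rewrite -/t; set S := t * _; set s := _^-1.
have -> : S - s = (W M - s + S) - W M by ring.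
by move=> H; rewrite (le_trans (ler_normB _ _))//; clear -H WM; lra.
Qed.

End occupation.

(** * The arcsine law *)

Section arcsine_integral.
Context (R : realType).
Implicit Types (a b k u x : R).

Definition arcsine_map u : R := sin (pi / 2 * u) ^+ 2.

Let denom k x := cos x ^+ 2 + k * sin x ^+ 2.

Let denom_gt0 k x : 0 < k -> 0 < denom k x.
Proof.
move=> k0; have c2 := cos2Dsin2 x; rewrite /denom.
have := sqr_ge0 (cos x); have := sqr_ge0 (sin x).
move: (cos x ^+ 2) (sin x ^+ 2) c2 => c s cs s0 c0.
have [s1|s1] := ltP 0 s; first by rewrite ltr_wpDl// mulr_gt0.
have s00 : s = 0 by lra.
by rewrite s00 mulr0; lra.
Qed.

(* x + atan v(x) is a branch of atan (k tan x) without jump at pi / 2. *)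
Let primitive k x := x + atan ((k - 1) * (sin x * cos x) / denom k x).

Let is_derive_primitive k x : 0 < k ->
  is_derive x (1 : R) (primitive k) (k / denom (k ^+ 2) x).
Proof.
move=> k0; have q0 := denom_gt0 x k0; have q20 := denom_gt0 x (exprn_gt0 2 k0).
have dq : is_derive x (1 : R) (denom k) (2 * (k - 1) * (sin x * cos x)).
  by rewrite /denom; apply: is_derive_eq; rewrite /GRing.scale /=; ring.
have dn : is_derive x (1 : R) (fun x => (k - 1) * (sin x * cos x))
   ((k - 1) * (cos x ^+ 2 - sin x ^+ 2)).
  by apply: is_derive_eq; rewrite /GRing.scale /=; ring.
have q0' : denom k x != 0 by rewrite gt_eqF.
have dV := is_deriveV q0' dq.
have dv : is_derive x (1 : R) (fun x => (k - 1) * (sin x * cos x) / denom k x)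
   ((k - 1) * (cos x ^+ 2 - k * sin x ^+ 2) / denom k x ^+ 2).
  apply: is_derive_eq; rewrite /GRing.scale /=.
  have c2 : cos x ^+ 2 = 1 - sin x ^+ 2 by rewrite -(cos2Dsin2 x) addrK.
  move: q0'; rewrite /denom c2.
  have -> : 2 * (k - 1) * (sin x * cos x) = 2 * (k - 1) * sin x * cos x by rewrite mulrA.
  move: c2; move: (sin x) (cos x) => s c c2 q0'.
  have cE : c * c = 1 - s ^+ 2 by rewrite -c2.
  have : s * c * (s * c) = s ^+ 2 * (1 - s ^+ 2) by rewrite -cE; ring.
  move=> sc.
  rewrite mulNr mulrN.
  have -> : (k - 1) * (s * c) * ((1 - s ^+ 2 + k * s ^+ 2) ^- 2 * (2 * (k - 1) * s * c)) =
    2 * (k - 1) ^+ 2 * (s * c * (s * c)) / (1 - s ^+ 2 + k * s ^+ 2) ^+ 2.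
    by field.
  by rewrite sc; field.
have da := @is_derive1_comp _ atan _ x _ _ (is_derive1_atan _) dv.
rewrite /primitive; apply: is_derive_eq.
rewrite expr_div_n.
(* With c = cos^2, s = sin^2 and c + s = 1, this is the identity (c + k s)^2 + (k - 1)^2 c s = c +
   k^2 s. *)
have -> : 1 + ((k - 1) * (sin x * cos x)) ^+ 2 / denom k x ^+ 2 =
   denom (k ^+ 2) x / denom k x ^+ 2.
  have c2 : cos x ^+ 2 = 1 - sin x ^+ 2 by rewrite -(cos2Dsin2 x) addrK.
  apply: (mulIf (expf_neq0 2 q0')); rewrite mulrDl !divfK ?expf_neq0//.
  by rewrite !exprMn /denom c2; ring.
have q20' : denom (k ^+ 2) x != 0 by rewrite gt_eqF.
have c2 : cos x ^+ 2 = 1 - sin x ^+ 2 by rewrite -(cos2Dsin2 x) addrK.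
rewrite invf_div.
have -> : denom k x ^+ 2 / denom (k ^+ 2) x *
   ((k - 1) * (cos x ^+ 2 - k * sin x ^+ 2) / denom k x ^+ 2) =
   (k - 1) * (cos x ^+ 2 - k * sin x ^+ 2) / denom (k ^+ 2) x by field; apply/andP.
apply: (mulIf q20'); rewrite mulrDl !divfK//.
by rewrite /denom c2; ring.
Qed.

Lemma continuous_arcsine_map : continuous arcsine_map.
Proof.
move=> u; apply: (@continuous_comp _ _ _ (fun u => sin (pi / 2 * u)) (fun y => y ^+ 2)).
  apply: (@continuous_comp _ _ _ (fun u => pi / 2 * u) sin); last exact: continuous_sin.
  exact: mulrl_continuous.
exact: exprn_continuous.
Qed.

Lemma arcsine_map01 u : 0 <= arcsine_map u <= 1.
Proof.
rewrite /arcsine_map sqr_ge0 /= -[leRHS](cos2Dsin2 (pi / 2 * u)) lerDr.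
exact: sqr_ge0.
Qed.

Lemma measurable_arcsine_map : measurable_fun setT arcsine_map.
Proof. by apply: continuous_measurable_fun; exact: continuous_arcsine_map. Qed.

Lemma continuous_inv_arcsine a b : 0 < a -> 0 <= b ->
  continuous (fun u => (a + b * arcsine_map u)^-1).
Proof.
move=> a0 b0 u; apply: cvgV.
  by rewrite gt_eqF// ltr_wpDr// mulr_ge0//; have /andP[] := arcsine_map01 u.
apply: cvgD; first exact: cvg_cst.
by apply: cvgM; [exact: cvg_cst|exact: continuous_arcsine_map].
Qed.

(** With k^2 = (a + b) / a, the sum a + b sin^2 equals a (cos^2 + k^2 sin^2), whose inverse has the
    primitive above divided by a k. That primitive grows by pi / 2 over the quarter period, and a k
    is the square root of a (a + b). *)
Lemma Rintegral_arcsine_inv a b : 0 < a -> 0 <= b ->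
  \int[uniform_prob (@ltr01 R)]_u (a + b * arcsine_map u)^-1 = (Num.sqrt (a * (a + b)))^-1.
Proof.
move=> a0 b0.
have ab0 : 0 < a + b by rewrite ltr_wpDr.
have p0 : 0 < a + b -> forall u, 0 < a + b * arcsine_map u.
  by move=> _ u; rewrite ltr_wpDr// mulr_ge0//; have /andP[] := arcsine_map01 u.
pose k := Num.sqrt ((a + b) / a).
have k0 : 0 < k by rewrite sqrtr_gt0 divr_gt0.
have k2 : k ^+ 2 = (a + b) / a by rewrite sqr_sqrtr// divr_ge0// ltW.
have ak : Num.sqrt (a * (a + b)) = a * k.
  have -> : a * (a + b) = (a * k) ^+ 2 by rewrite exprMn k2; field; rewrite gt_eqF.
  by rewrite sqrtr_sqr ger0_norm// ltW// mulr_gt0.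
rewrite ak.
have pi0 : pi != 0 :> R by rewrite gt_eqF// pi_gt0.
pose H u := (a * k)^-1 * (2 / pi) * primitive k (pi / 2 * u).
have dH u : is_derive u (1 : R) H (a + b * arcsine_map u)^-1.
  have d1 : is_derive u (1 : R) (fun u => pi / 2 * u) (pi / 2).
    by apply: is_derive_eq; rewrite /GRing.scale /=; ring.
  have d2 := @is_derive1_comp _ (primitive k) _ u _ _ (is_derive_primitive _ k0) d1.
  rewrite /H; apply: is_derive_eq; rewrite /GRing.scale /=.
  have -> : a + b * arcsine_map u = a * denom (k ^+ 2) (pi / 2 * u).
    rewrite /denom k2 /arcsine_map.
    have -> : cos (pi / 2 * u) ^+ 2 = 1 - sin (pi / 2 * u) ^+ 2.
      by apply/eqP; rewrite eq_sym subr_eq cos2Dsin2.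
    by field; rewrite gt_eqF.
  have := denom_gt0 (pi / 2 * u) (exprn_gt0 2 k0) => /lt0r_neq0.
  move: (denom _ _) => q q0; have k00 := lt0r_neq0 k0; have a00 := lt0r_neq0 a0.
  have := pi0; move: (pi : R) => p p0'.
  by field; rewrite a00 p0' q0 k00.
rewrite /Rintegral integral_uniform; last 2 first.
- apply/measurable_EFinP; apply: continuous_measurable_fun.
  exact: (continuous_inv_arcsine a0 b0).
- by move=> u; rewrite lee_fin invr_ge0 ltW// p0.
rewrite (@continuous_FTC2 _ _ H).
- rewrite subr0 invr1 mul1e /H !mulr0 mulr1 /primitive sin_pihalf cos_pihalf sin0 mul0r.
  rewrite -EFinB /= !(mulr0, mul0r) atan0 !addr0 mulr0 subr0.
  by rewrite -mulrA -invf_div mulVf ?mulr1// mulf_neq0// invr_neq0.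
- exact: ltr01.
- by apply: continuous_subspaceT; exact: continuous_inv_arcsine.
- split.
  + by move=> u _; case: (dH u).
  + by apply: cvg_at_right_filter; apply: differentiable_continuous; apply/derivable1_diffP; case: (dH 0).
  + by apply: cvg_at_left_filter; apply: differentiable_continuous; apply/derivable1_diffP; case: (dH 1).
- by move=> u _; rewrite derive1E; case: (dH u).
Qed.

End arcsine_integral.

(** * Inversion of the Laplace transform *)

Section ramp.
Context (R : realType).
Implicit Types a b x : R.

Definition ramp a b x : R := Num.max 0 (1 - Num.max 0 ((x - a) / (b - a))).

Lemma ramp01 a b x : 0 <= ramp a b x <= 1.
Proof.
by rewrite /ramp le_max lexx/= ge_max ler01 lerBlDr lerDl le_max lexx.
Qed.

Lemma ramp_left a b x : a < b -> x <= a -> ramp a b x = 1.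
Proof.
move=> ab xa; rewrite /ramp (max_idPl (_ : (x - a) / (b - a) <= 0)).
  by rewrite subr0; apply/max_idPr.
by rewrite mulr_le0_ge0 ?subr_le0// invr_ge0 subr_ge0 ltW.
Qed.

Lemma ramp_right a b x : a < b -> b <= x -> ramp a b x = 0.
Proof.
move=> ab bx; apply/max_idPl; rewrite subr_le0 le_max; apply/orP; right.
by rewrite ler_pdivlMr ?subr_gt0// mul1r lerD2r.
Qed.

Lemma continuous_ramp a b : continuous (ramp a b).
Proof.
have c0 : continuous ((fun=> 0) : R -> R) by move=> y; exact: cst_continuous.
move=> x; apply: (@continuous_max _ _ (fun=> (0 : R))
  (fun x : R => (1 - Num.max 0 ((x - a) / (b - a)) : R))); first exact: c0.
apply: cvgB; first exact: cvg_cst.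
apply: (@continuous_max _ _ (fun=> (0 : R)) (fun x : R => ((x - a) / (b - a) : R))).
  exact: c0.
apply: cvgM; last exact: cvg_cst.
by apply: cvgB; [exact: cvg_id|exact: cvg_cst].
Qed.

End ramp.

Section laplace_transform.
Context (R : realType).
Implicit Types (x y a c e : R) (n m M N : nat).

Lemma expRN_dist x y : 0 <= x -> 0 <= y -> `|expR (- x) - expR (- y)| <= `|x - y|.
Proof.
wlog xy : x y / x <= y => [H|] x0 y0.
  have [xy|/ltW yx] := leP x y; first exact: H.
  by rewrite distrC [leRHS]distrC; exact: H.
have e1 : expR (- x) <= 1 by rewrite -expR0 ler_expR oppr_le0.
have xy0 : 0 <= y - x by rewrite subr_ge0.
rewrite [leRHS]distrC (ger0_norm xy0) ger0_norm; last first.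
  by rewrite subr_ge0 ler_expR lerN2.
have -> : expR (- x) - expR (- y) = expR (- x) * (1 - expR (- (y - x))).
  by rewrite mulrBr mulr1 -expRD; congr (_ - expR _); ring.
have := expR_ge1Dx (- (y - x)) => H.
rewrite -[leRHS]mul1r ler_pM ?expR_ge0//; last by clear -H; lra.
by rewrite subr_ge0 -expR0 ler_expR oppr_le0.
Qed.

(** Weierstrass in the variable y = e^(-x), applied to psi(-ln y) / y. The division by [y] yields an
    error proportional to e^(-x), which remains bounded when summed over all n / N, and leaves only
    exponentials with rates at least 1. *)
Lemma exp_polynomial_approximation (psi : R -> R) e : continuous psi ->
  (forall x, 2 <= x -> psi x = 0) -> 0 < e ->
  exists p : {poly R}, forall x, 0 <= x ->
    `|psi x - expR (- x) * p.[expR (- x)]| <= e * expR (- x).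
Proof.
move=> cpsi psi2 e0.
pose q : R := expR (- 2).
have q0 : 0 < q by exact: expR_gt0.
(* Freezing [y] below q = e^(-2) keeps the logarithm continuous down to 0; [f] is 0 there because
   psi vanishes at 2. *)
pose m y : R := Num.max y q.
have m0 y : 0 < m y by rewrite lt_max q0 orbT.
pose f y := psi (- ln (m y)) / m y.
have cm : continuous m.
  move=> y; apply: (@continuous_max _ _ (fun y => y : R^o) (fun=> q : R^o)).
    exact: cvg_id.
  exact: cvg_cst.
have cf : continuous f.
  move=> y; apply: cvgM.
    apply: (@continuous_comp _ _ _ (fun y => - ln (m y)) psi); last exact: cpsi.
    apply: cvgN; apply: (@continuous_comp _ _ _ m (@ln R)); first exact: cm.
    exact: continuous_ln.
  by apply: cvgV; [rewrite gt_eqF|exact: cm].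
have [p fp] := weierstrass_unit_interval cf e0.
exists p => x x0.
have y0 : 0 < expR (- x) by exact: expR_gt0.
have y1 : expR (- x) <= 1 by rewrite -expR0 ler_expR oppr_le0.
have -> : psi x = expR (- x) * f (expR (- x)).
  rewrite /f /m; have [x2|x2] := leP x 2.
    rewrite (max_idPl _) ?expRK ?opprK; last by rewrite ler_expR lerN2.
    by rewrite mulrC divfK// gt_eqF.
  rewrite (max_idPr _) ?expRK ?opprK; last by rewrite ler_expR lerN2 ltW.
  by rewrite !psi2// ?ltW// mul0r mulr0.
rewrite -mulrBr normrM (gtr0_norm y0) mulrC ler_wpM2r ?(ltW y0)//.
by apply: fp; rewrite (ltW y0).
Qed.

(** The threshold for [M] may depend on [N]: infinite Abel sums are handled through their partial
    sums, [M] going to infinity before [N]. *)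
Definition iterated_cvg0 (h : nat -> nat -> R) := forall e, 0 < e ->
  exists N0, forall N, (N0 <= N)%N -> exists M0, forall M, (M0 <= M)%N -> `|h N M| <= e.

Lemma iterated_cvg0D h1 h2 : iterated_cvg0 h1 -> iterated_cvg0 h2 ->
  iterated_cvg0 (fun N M => h1 N M + h2 N M).
Proof.
move=> H1 H2 e e0; have e20 : 0 < e / 2 by rewrite divr_gt0.
have [N1 HN1] := H1 _ e20; have [N2 HN2] := H2 _ e20.
exists (maxn N1 N2) => N; rewrite geq_max => /andP[/HN1[M1 HM1] /HN2[M2 HM2]].
exists (maxn M1 M2) => M; rewrite geq_max => /andP[/HM1 h1e /HM2 h2e].
by rewrite (le_trans (ler_normD _ _))// [leRHS]splitr lerD.
Qed.

Lemma iterated_cvg0Z c h : iterated_cvg0 h -> iterated_cvg0 (fun N M => c * h N M).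
Proof.
move=> H e e0; have c1 : 0 < `|c| + 1 by rewrite ltr_wpDl.
have [N0 HN0] := H _ (divr_gt0 e0 c1).
exists N0 => N /HN0[M0 HM0]; exists M0 => M /HM0 hM.
rewrite normrM (@le_trans _ _ ((`|c| + 1) * `|h N M|))//.
  by rewrite ler_wpM2r// lerDl.
by rewrite mulrC -ler_pdivlMr.
Qed.

Lemma iterated_cvg0_sum k (h : nat -> nat -> nat -> R) :
  (forall i, iterated_cvg0 (h i)) -> iterated_cvg0 (fun N M => \sum_(i < k) h i N M).
Proof.
move=> H; elim: k => [|k IHk] e e0.
  by exists 0%N => N _; exists 0%N => M _; rewrite big_ord0 normr0 ltW.
have [N0 HN0] := iterated_cvg0D IHk (H k) e0; exists N0 => N /HN0[M0 HM0].
by exists M0 => M /HM0; rewrite big_ord_recr.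
Qed.

(* A tent function of n / N at 1 is approximated by polynomials in e^(-n/N), and
   D N varies slowly at scale N, so Abel means of D N control D N N. *)
Lemma laplace_tauberian (D : nat -> nat -> R) (K : R) : 0 <= K ->
  (forall N n, `|D N n| <= 1) ->
  (forall N n m, (0 < N)%N -> `|D N n - D N m| <= K * (`|n%:R - m%:R| / N%:R)) ->
  (forall a, 0 < a -> iterated_cvg0
    (fun N M => N%:R^-1 * \sum_(n < M) expR (- (a * n%:R / N%:R)) * D N n)) ->
  forall e, 0 < e -> exists N0, forall N, (N0 <= N)%N -> `|D N N| <= e.
Proof.
move=> K0 D1 DK Dabel e e0.
(* Half-width of the tent: at most 1/2, so that the tent vanishes beyond 2, and small enough for D N
   to vary by at most e / 2 over it. *)
pose dl := Num.min 2^-1 (e / 2 / (K + 1)).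
have K1 : 0 < K + 1 by rewrite ltr_wpDl.
have dl0 : 0 < dl by rewrite lt_min invr_gt0 ltr0n/= !divr_gt0.
have dl2 : dl <= 2^-1 by rewrite ge_min lexx.
have Kdl : K * dl <= e / 2.
  have : dl <= e / 2 / (K + 1) by rewrite ge_min lexx orbT.
  rewrite ler_pdivlMr//; apply: le_trans; rewrite mulrC ler_wpM2l ?(ltW dl0)//.
  by rewrite lerDl.
pose psi x : R := Num.max 0 (1 - `|x - 1| / dl).
have psi0 x : 0 <= psi x by rewrite le_max lexx.
have cpsi : continuous psi.
  move=> x; apply: (@continuous_max _ _ (fun=> 0 : R^o) (fun x => 1 - `|x - 1| / dl : R^o)).
    exact: cvg_cst.
  apply: cvgB; first exact: cvg_cst.
  apply: cvgM; last exact: cvg_cst.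
  apply: cvg_norm; apply: cvgB; [exact: cvg_id|exact: cvg_cst].
have psi_out x : dl <= `|x - 1| -> psi x = 0.
  by move=> H; apply/max_idPl; rewrite subr_le0 ler_pdivlMr// mul1r.
have psi2 x : 2 <= x -> psi x = 0.
  move=> x2; apply: psi_out; rewrite ger0_norm; last by clear -x2; lra.
  by rewrite (le_trans dl2)//; clear -x2; lra.
have psi_in x : `|x - 1| <= dl / 2 -> 2^-1 <= psi x.
  move=> H; rewrite le_max; apply/orP; right.
  have : `|x - 1| / dl <= 2^-1 by rewrite ler_pdivrMr// mulrC.
  by clear; lra.
(* The mass [S] of the tent will be at least dl / 4, so the total error [3 * et] is at most e S /
   2. *)
pose et := e * dl / 32.
have et0 : 0 < et by rewrite divr_gt0// mulr_gt0.
have [p pE] := exp_polynomial_approximation cpsi psi2 et0.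
(* The factor e^(-n / N) turns the monomial of degree [i] into an Abel mean of rate i + 1, which is
   positive even for the constant term. *)
have polyD : iterated_cvg0 (fun N M => N%:R^-1 * \sum_(n < M)
    expR (- (n%:R / N%:R)) * p.[expR (- (n%:R / N%:R))] * D N n).
  have E N M : N%:R^-1 * \sum_(n < M) expR (- (n%:R / N%:R)) * p.[expR (- (n%:R / N%:R))] * D N n
    = \sum_(i < size p) p`_i * (N%:R^-1 * \sum_(n < M) expR (- (i.+1%:R * n%:R / N%:R)) * D N n).
    under [RHS]eq_bigr do rewrite mulrCA mulr_sumr.
    rewrite -mulr_sumr exchange_big /=; congr (_ * _); apply: eq_bigr => n _.
    rewrite horner_coef mulr_sumr mulr_suml; apply: eq_bigr => i _.
    rewrite mulrCA -!mulrA; congr (_ * _); rewrite mulrA -exprS -expRM_natl.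
    by congr (expR _ * _); ring.
  move=> e1 e10; have [|N0 HN0] := @iterated_cvg0_sum (size p)
    (fun i N M => p`_i * (N%:R^-1 * \sum_(n < M) expR (- (i.+1%:R * n%:R / N%:R)) * D N n)) _ _ e10.
    by move=> i; apply: iterated_cvg0Z; exact: Dabel.
  by exists N0 => N /HN0[M0 HM0]; exists M0 => M /HM0; rewrite E.
have [N0 HN0] := polyD _ et0.
exists (maxn N0 1) => N; rewrite geq_max => /andP[/HN0[M0 HM0] N1].
have NR0 : 0 < N%:R :> R by rewrite ltr0n.
have ratio n : `|n%:R / N%:R - 1| = `|n%:R - N%:R| / N%:R :> R.
  have -> : n%:R / N%:R - 1 = (n%:R - N%:R) / N%:R :> R by rewrite mulrBl divff// gt_eqF.
  by rewrite normrM [ `|_^-1|]ger0_norm ?invr_ge0.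
(* The [J] integers from [N] to [N + J - 1] satisfy |n / N - 1| <= dl / 2, where the tent is at
   least 1/2. As J > dl N / 2, they alone give S >= dl / 4. *)
pose J := (Num.truncn (dl / 2 * N%:R)).+1.
have J0 : 0 <= dl / 2 * N%:R by rewrite mulr_ge0 ?divr_ge0// ltW.
have /andP[J1 J2] := truncn_itv J0.
pose M := maxn M0 (N + J).
have MM0 : (M0 <= M)%N by rewrite leq_maxl.
have MJ : (N + J <= M)%N by rewrite leq_maxr.
have := HM0 M MM0; set A := _ * _ => HA.
pose S := N%:R^-1 * \sum_(n < M) psi (n%:R / N%:R).
have SD : `|N%:R^-1 * \sum_(n < M) psi (n%:R / N%:R) * D N n| <= 3 * et.
  have : `|N%:R^-1 * \sum_(n < M) psi (n%:R / N%:R) * D N n - A| <= 2 * et.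
    rewrite /A -mulrBr -sumrB normrM ger0_norm ?invr_ge0 ?(ltW NR0)//.
    have := geometric_expR_le M (@ltr01 R) N1; rewrite invr1.
    move=> /(ler_wpM2l (ltW et0)); rewrite [et * (1 + 1)]mulrC; apply: le_trans.
    rewrite mulrCA ler_wpM2l ?invr_ge0 ?(ltW NR0)//.
    rewrite (le_trans (ler_norm_sum _ _ _))// mulr_sumr ler_sum// => n _.
    rewrite -mulrBl normrM mul1r -[leRHS]mulr1 ler_pM//.
    by apply: pE; rewrite divr_ge0// ltW.
  move: HA; set B := N%:R^-1 * _ => HA HB.
  have -> : B = (B - A) + A by rewrite subrK.
  by rewrite (le_trans (ler_normD _ _))//; clear -HA HB; lra.
have S_ge : dl / 4 <= S.
  have : J%:R / 2 <= \sum_(n < M) psi (n%:R / N%:R).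
    rewrite -(big_mkord xpredT (fun n => psi (n%:R / N%:R))).
    rewrite (big_cat_nat (n := N)) ?(leq_trans _ MJ) ?leq_addr//=.
    rewrite (big_cat_nat (n := N + J) (m := N)) ?leq_addr//=.
    have h1 : 0 <= \sum_(0 <= n < N) psi (n%:R / N%:R) by exact: sumr_ge0.
    have h2 : 0 <= \sum_(N + J <= n < M) psi (n%:R / N%:R) by exact: sumr_ge0.
    have h3 : J%:R / 2 <= \sum_(N <= n < N + J) psi (n%:R / N%:R).
      have -> : J%:R / 2 = \sum_(N <= n < N + J) 2^-1 :> R.
        by rewrite sumr_const_nat addKn mulr_natl.
      apply: ler_sum_nat => n /andP[Nn nJ]; apply: psi_in.
      rewrite ratio -natrB// ger0_norm// ler_pdivrMr//.
      by rewrite (le_trans _ J1)// ler_nat leq_subLR -ltnS -addnS.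
    by clear -h1 h2 h3; lra.
  move=> /(ler_wpM2l (_ : 0 <= N%:R^-1)) H; rewrite (le_trans _ (H _)) ?invr_ge0//.
  rewrite [leRHS]mulrC ler_pdivlMr//; move/ltW: J2; rewrite -/J; clear; lra.
have S0 : 0 < S by apply: lt_le_trans S_ge; rewrite divr_gt0.
(* Inside the tent [D N n] is replaced by [D N N] at the price K dl; outside it both carry the
   weight 0. *)
have DS : `|D N N| * S <= 3 * et + K * dl * S.
  have -> : `|D N N| * S = `|N%:R^-1 * \sum_(n < M) psi (n%:R / N%:R) * D N N|.
    have -> : N%:R^-1 * \sum_(n < M) psi (n%:R / N%:R) * D N N = S * D N N.
      by rewrite /S -mulrA mulr_suml.
    by rewrite normrM (gtr0_norm S0) mulrC.
  set A1 := N%:R^-1 * _; move: SD; set A2 := N%:R^-1 * _ => SD.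
  have -> : A1 = A2 + (A1 - A2) by rewrite addrC subrK.
  rewrite (le_trans (ler_normD _ _))// lerD// /A1 /A2 -mulrBr -sumrB /S mulrCA.
  rewrite normrM ger0_norm ?invr_ge0// ler_wpM2l ?invr_ge0//.
  rewrite (le_trans (ler_norm_sum _ _ _))// mulr_sumr ler_sum// => n _.
  rewrite -mulrBr normrM ger0_norm// mulrC.
  have [out|inn] := leP dl `|n%:R / N%:R - 1|; first by rewrite psi_out// !mulr0.
  rewrite ler_wpM2r// (le_trans (DK N N n N1))// ler_wpM2l//.
  by move/ltW: inn; rewrite ratio distrC.
have etS : 3 * et <= e / 2 * S.
  have := ler_wpM2l (ltW e0) S_ge; have := mulr_gt0 e0 dl0.
  rewrite /et; clear; lra.
rewrite -(ler_pM2r S0) (le_trans DS)//.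
have := ler_wpM2r (ltW S0) Kdl; clear -etS; lra.
Qed.

End laplace_transform.

Section arcsine_laplace.
Context (R : realType).
Implicit Types (a b t x y u : R) (n m M N : nat).

Let nu := uniform_prob (@ltr01 R).

Definition arcsine_laplace t : R := \int[nu]_u expR (- (t * arcsine_map u)).

Lemma continuous_arcsine_comp (f : R -> R) : continuous f ->
  continuous (fun u => f (arcsine_map u)).
Proof.
by move=> cf u; apply: continuous_comp; [exact: continuous_arcsine_map|exact: cf].
Qed.

Lemma integrable_arcsine_comp (f : R -> R) B : continuous f ->
  (forall x, 0 <= x <= 1 -> `|f x| <= B) ->
  nu.-integrable setT (EFin \o (fun u => f (arcsine_map u))).
Proof.
move=> cf fB; apply: (@integrable_bounded _ _ _ _ _ B) => [|u].
  by apply: continuous_measurable_fun; exact: continuous_arcsine_comp.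
by apply: fB; exact: arcsine_map01.
Qed.

Lemma continuous_laplace_kernel t : continuous (fun x => expR (- (t * x))).
Proof.
move=> x; apply: (@continuous_comp _ _ _ (fun x => - (t * x)) expR).
  by apply: cvgN; exact: mulrl_continuous.
exact: continuous_expR.
Qed.

Lemma integrable_arcsine_laplace t : 0 <= t ->
  nu.-integrable setT (EFin \o (fun u => expR (- (t * arcsine_map u)))).
Proof.
move=> t0; apply: (@integrable_arcsine_comp (fun x => expR (- (t * x))) 1).
  exact: continuous_laplace_kernel.
move=> x /andP[x0 _]; have /andP[h0 h1] := expRN_01 (mulr_ge0 t0 x0).
by rewrite ger0_norm.
Qed.

Lemma arcsine_laplace01 t : 0 <= t -> 0 <= arcsine_laplace t <= 1.
Proof.
move=> t0; apply/andP; split.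
  by apply: Rintegral_ge0 => u _; exact: expR_ge0.
apply: Rintegral_le_cst; first exact: integrable_arcsine_laplace.
by move=> u; have /andP[u0 _] := arcsine_map01 u; have /andP[] := expRN_01 (mulr_ge0 t0 u0).
Qed.

Lemma arcsine_laplace_dist x y : 0 <= x -> 0 <= y ->
  `|arcsine_laplace x - arcsine_laplace y| <= `|x - y|.
Proof.
move=> x0 y0; apply: Rintegral_dist_le; [exact: integrable_arcsine_laplace..|move=> u].
have /andP[u0 u1] := arcsine_map01 u.
apply: le_trans (expRN_dist (mulr_ge0 x0 u0) (mulr_ge0 y0 u0)) _.
rewrite -mulrBl normrM ler_piMr//.
by rewrite ger0_norm.
Qed.

(** If the fraction of time were a fixed random number Y for all n, the Abel mean would be a
    geometric sum close to 1 / (a + b Y). Its expectation is the limit found for the walk, so the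
    difference of the two transforms has vanishing Abel means. *)
Lemma arcsine_laplace_resolvent a b : 0 < a -> 0 <= b -> iterated_cvg0 (fun N M =>
  N%:R^-1 * \sum_(n < M) expR (- (a * n%:R / N%:R)) * arcsine_laplace (b * n%:R / N%:R)
  - (Num.sqrt (a * (a + b)))^-1).
Proof.
move=> a0 b0 e e0.
have a1 : 0 < a^-1 + 1 by rewrite addr_gt0 ?invr_gt0.
have e20 : 0 < e / 2 by rewrite divr_gt0.
pose N0 := (Num.truncn (e / 2)^-1).+1.
exists N0 => N N0N.
have NR0 : 0 < N%:R :> R by rewrite ltr0n; exact: leq_trans N0N.
have Ne : N%:R^-1 <= e / 2.
  rewrite invf_ple ?posrE// (le_trans (ltW (truncnS_gt _)))// ler_nat.
  exact: N0N.
pose M0 := (Num.truncn (N%:R / a * ((a^-1 + 1) / (e / 2)))).+1.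
exists M0 => M M0M.
have eM : expR (- (a * M%:R / N%:R)) * (a^-1 + 1) <= e / 2.
  have UM : (a^-1 + 1) / (e / 2) <= a * M%:R / N%:R.
    rewrite ler_pdivlMr// -ler_pdivrMl// mulrA [_^-1 * _]mulrC mulrAC.
    rewrite [_ * N%:R]mulrC mulrAC.
    by rewrite (le_trans (ltW (truncnS_gt _)))// ler_nat.
  rewrite expRN ler_pdivrMl ?expR_gt0// -ler_pdivrMr//.
  by rewrite (le_trans UM)// (le_trans _ (expR_ge1Dx _))// lerDr.
have ap u : a <= a + b * arcsine_map u.
  by have /andP[u0 _] := arcsine_map01 u; rewrite lerDl mulr_ge0.
pose h n u := expR (- (a * n%:R / N%:R)) * expR (- (b * n%:R / N%:R * arcsine_map u)).
have t0 n : 0 <= b * n%:R / N%:R by rewrite !mulr_ge0// invr_ge0 ltW.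
have ih n : nu.-integrable setT (EFin \o h n).
  by apply: integrable_RZ; exact: integrable_arcsine_laplace.
have iS : nu.-integrable setT (EFin \o (fun u => \sum_(n < M) h n u)).
  exact: (@integrable_Rsum _ _ _ nu _ _ (fun (n : 'I_M) => h n)).
rewrite (_ : N%:R^-1 * _ = \int[nu]_u (N%:R^-1 * \sum_(n < M) h n u)); last first.
  rewrite RintegralZl//.
  have -> : \int[nu]_u (\sum_(n < M) h n u) = \sum_(n < M) \int[nu]_u h n u.
    exact: (@Rintegral_sum _ _ _ nu _ _ (fun (n : 'I_M) => h n)).
  congr (_ * _); apply: eq_bigr => n _; rewrite RintegralZl//; exact: integrable_arcsine_laplace.
rewrite -Rintegral_arcsine_inv//; apply: Rintegral_dist_le => [||u].
- exact: integrable_RZ.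
- apply: (@integrable_bounded _ _ _ _ _ a^-1) => [|u].
    by apply: continuous_measurable_fun; exact: (continuous_inv_arcsine a0 b0).
  rewrite ger0_norm ?invr_ge0 ?(le_trans (ltW a0))//.
  by rewrite lef_pV2 ?posrE ?(lt_le_trans a0).
have c0 : 0 < a + b * arcsine_map u by exact: lt_le_trans (ap u).
have N0' : (0 < N)%N by exact: leq_trans N0N.
rewrite (eq_bigr (fun n : 'I_M => expR (- ((a + b * arcsine_map u) * n%:R / N%:R)))); last first.
  by move=> n _; rewrite /h -expRD; congr expR; ring.
rewrite (le_trans (geometric_expR_dist _ c0 N0'))// [leRHS]splitr lerD//.
apply: le_trans eM; apply: ler_pM; rewrite ?expR_ge0 ?addr_ge0 ?invr_ge0 ?(ltW c0)//.
  by rewrite ler_expR lerN2 ler_wpM2r ?invr_ge0 ?(ltW NR0)// ler_wpM2r.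
by rewrite lerD2r lef_pV2 ?posrE.
Qed.

End arcsine_laplace.

(** * From averages over intervals to linear bounds on sums *)

Section averages.
Context (R : realType).
Implicit Types (F : int -> R) (n v : nat) (a B : R).

Lemma average_image F (h : nat -> int) n (V : set int) : set_bij `I_n V h ->
  average F V = (\sum_(i < n) F (h i)) / n%:R.
Proof.
move=> hV.
have finV : finite_set V.
  by rewrite -(image_eq hV); apply: finite_image; exact: finite_II.
rewrite /average (@reindex_fsbig _ _ _ _ _ h `I_n V _ hV) -(fsbig_ord _ _ (fun i => F (h i))); congr (_ / _).
rewrite card_fset_sum1 natr_sum.
rewrite -(fsbig_finite _ (fun=> 1 : R) finV) (@reindex_fsbig _ _ _ _ _ h `I_n V _ hV).
by rewrite -(fsbig_ord _ _ (fun=> 1 : R)) sumr_const card_ord.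
Qed.

Lemma averages_posE F v :
  averages_pos F v = (\sum_(i < v.+1) F (Posz i)) / v.+1%:R.
Proof.
apply: average_image; split.
- by move=> i /= iv; rewrite in_itv/=; lia.
- by move=> i j _ _ [].
- by move=> [i|i] /=; rewrite in_itv/= => iv; [exists i => //=; lia|lia].
Qed.

Lemma averages_negE F v :
  averages_neg F v = (\sum_(i < v.+1) F (- Posz i)) / v.+1%:R.
Proof.
apply: (@average_image F (fun i => - Posz i)); split.
- by move=> i /= iv; rewrite in_itv/=; lia.
- by move=> i j _ _ /oppr_inj[].
- by move=> x /=; rewrite in_itv/= => xv; exists `|x|%N => /=; lia.
Qed.

(** From rank [v0] on the average is within [a] of its limit; the constant covers the shorter sums,
    term by term. *)
Lemma cesaro_sum_bound (f : nat -> R) (l B a : R) : (forall i, `|f i| <= B) -> 0 < a ->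
  (\sum_(i < v.+1) f i) / v.+1%:R @[v --> \oo] --> l ->
  exists C : R, forall n, `|\sum_(i < n) (f i - l)| <= a * n%:R + C.
Proof.
move=> fB a0 /cvgrPdist_le/(_ _ a0)[v0 _ H].
exists (v0%:R * (B + `|l|)) => n.
have B0 : 0 <= B := le_trans (normr_ge0 _) (fB 0%N).
have C0 : 0 <= v0%:R * (B + `|l|) by rewrite mulr_ge0// addr_ge0.
have an : 0 <= a * n%:R by rewrite mulr_ge0// ltW.
have [nv|nv] := leqP n v0.
  rewrite (le_trans (ler_norm_sum _ _ _))// (@le_trans _ _ (\sum_(i < n) (B + `|l|)))//.
    by apply: ler_sum => i _; rewrite (le_trans (ler_normB _ _))// lerD2r.
  rewrite sumr_const card_ord -[(B + _) *+ n]mulr_natl.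
  by rewrite ler_wpDl// ler_wpM2r ?addr_ge0// ler_nat.
case: n nv an => // n nv an; rewrite ler_wpDr//.
have nR : 0 < n.+1%:R :> R by rewrite ltr0n.
have := H n nv; rewrite distrC /= => Hn.
have -> : \sum_(i < n.+1) (f i - l) = ((\sum_(i < n.+1) f i) / n.+1%:R - l) * n.+1%:R.
  by rewrite mulrBl divfK ?gt_eqF// sumrB sumr_const card_ord mulr_natr.
by rewrite normrM [ `|n.+1%:R|]gtr0_norm// ler_wpM2r// ltW.
Qed.

Definition two_sided_mean F (x : int) : R := mean_neg F + (mean_pos F - mean_neg F) * (0 <= x)%R%:R.

Lemma G_both_averages F B a : (forall x, `|F x| <= B) -> G_both F -> 0 < a ->
  exists C : R, forall n,
    `|\sum_(i < n) (F (Posz i) - two_sided_mean F (Posz i))| <= a * n%:R + C /\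
    `|\sum_(i < n) (F (Negz i) - two_sided_mean F (Negz i))| <= a * n%:R + C.
Proof.
move=> FB [[_ cp] [_ cm]] a0.
have [|C1 HC1] := @cesaro_sum_bound (fun i => F (Posz i)) (mean_pos F) B a (fun i => FB _) a0.
  by under eq_fun do rewrite -averages_posE.
have [|C2 HC2] := @cesaro_sum_bound (fun i => F (- Posz i)) (mean_neg F) B a (fun i => FB _) a0.
  by under eq_fun do rewrite -averages_negE.
(* The averages over [-v, 0] contain the origin, whereas [Negz] starts at -1. The sum is compared
   with one of [n + 1] terms, whence the extra [a], and the term at 0 is then removed. *)
exists (Num.max C1 (C2 + a + `|F 0 - mean_neg F|)) => n; split.
  rewrite (eq_bigr (fun i : 'I_n => F (Posz i) - mean_pos F)); last first.
    by move=> i _; rewrite /two_sided_mean mulr1 [mean_neg F + _]addrC subrK.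
  by rewrite (le_trans (HC1 n))// lerD2l le_max lexx.
rewrite (eq_bigr (fun i : 'I_n => F (Negz i) - mean_neg F)); last first.
  by move=> i _; rewrite /two_sided_mean mulr0 addr0.
have := HC2 n.+1; rewrite big_ord_recl /= oppr0.
under eq_bigr do rewrite -NegzE.
set S := \sum_(i < n) _; set z := F 0 - _ => H.
have -> : S = (z + S) - z by rewrite addrAC subrr add0r.
rewrite (le_trans (ler_normB _ _))//.
have : C2 + a + `|z| <= Num.max C1 (C2 + a + `|z|) by rewrite le_max lexx orbT.
by move: H; rewrite -natr1; clear; lra.
Qed.

End averages.

Lemma bounded_fun_bound (R : realType) (I : Type) (f : I -> R) : bounded_fun f ->
  exists B, forall x, `|f x| <= B.
Proof.
by move=> [B [_ HB]]; exists (B + 1) => x; apply: HB => //; rewrite ltrDl.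
Qed.

(** * The distribution function of the arcsine law *)

Section arcsine_distribution.
Context (R : realType).
Implicit Types (u z x : R).

Let nu := uniform_prob (@ltr01 R).

Lemma uniform_prob01E (A : set R) : measurable A ->
  nu A = lebesgue_measure (A `&` `[0, 1]%classic).
Proof.
move=> mA; have <- : (\int[nu]_x (EFin \o \1_A) x)%E = nu A.
  by rewrite integral_indic// setIT.
rewrite integral_uniform.
- by rewrite subr0 invr1 mul1e integral_indic.
- by apply/measurable_EFinP; exact: measurable_indic.
- by move=> x; rewrite lee_fin.
Qed.

Lemma lebesgue_measure_itv0 (s : R) : 0 <= s -> lebesgue_measure `[0, s]%classic = s%:E.
Proof.
move=> s0; rewrite lebesgue_measure_itv /= lte_fin.
case: ltP => [_|s00]; first by rewrite sube0.
by congr EFin; apply/eqP; rewrite eq_le s0 s00.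
Qed.

Definition arcsine_cdf z : R := 2 / pi * asin (Num.sqrt z).

Lemma arcsine_cdf01 z : 0 <= z <= 1 -> 0 <= arcsine_cdf z <= 1.
Proof.
move=> /andP[z0 z1].
have pi0 : 0 < pi :> R by exact: pi_gt0.
have s1 : 0 <= Num.sqrt z <= 1 by rewrite sqrtr_ge0/= -sqrtr1 ler_wsqrtr.
have s11 : -1 <= Num.sqrt z <= 1.
  by case/andP: s1 => s0 s1; rewrite s1 andbT (le_trans _ s0)// lerN10.
have h0 : 0 <= asin (Num.sqrt z).
  have [h1 h2] := asin_def s11.
  rewrite leNgt; apply/negP => h.
  have : sin (asin (Num.sqrt z)) < 0.
    rewrite -oppr_gt0 -sinN sin_gt0_pi// oppr_gt0 h/=.
    case/andP: h1 => h1 _.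
    by rewrite ltrNl (lt_le_trans _ h1)// ltrN2 ltr_pdivrMr// ltr_pMr// ltr1n.
  by rewrite h2 ltNge; case/andP: s1 => ->.
rewrite /arcsine_cdf mulr_ge0 ?divr_ge0 ?(ltW pi0)//=.
rewrite mulrC mulrA ler_pdivrMr// mul1r -ler_pdivlMr//.
exact: asin_lepi2.
Qed.

Lemma arcsine_map_lt u u' : 0 <= u -> u < u' -> u' <= 1 -> arcsine_map u < arcsine_map u'.
Proof.
move=> u0 uu' u'1; have pi0 : 0 < pi :> R by exact: pi_gt0.
have pi2 : 0 < pi / 2 :> R by rewrite divr_gt0.
have u'0 : 0 < u' by exact: le_lt_trans uu'.
have in2 x : 0 <= x -> x <= 1 -> pi / 2 * x \in `[- (pi / 2), pi / 2].
  move=> x0 x1; rewrite in_itv/= ler_piMr ?(ltW pi2)// andbT.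
  by rewrite (@le_trans _ _ 0) ?oppr_le0 ?(ltW pi2)// mulr_ge0// ltW.
have s : sin (pi / 2 * u) < sin (pi / 2 * u').
  by rewrite ltr_sin ?in2 ?ltr_pM2l ?(ltW u'0) ?(le_trans (ltW uu'))//.
have s0 : 0 <= sin (pi / 2 * u).
  apply: sin_ge0_pi; rewrite mulr_ge0 ?(ltW pi2)//=.
  rewrite (@le_trans _ _ (pi / 2))// ?ler_piMr ?(ltW pi2) ?(le_trans (ltW uu'))//.
  exact: ltW.
  by rewrite invf_le1// ler1n.
by rewrite /arcsine_map ltrXn2r// nnegrE// ltW// (le_lt_trans s0).
Qed.

Lemma arcsine_cdfK z : 0 <= z <= 1 -> arcsine_map (arcsine_cdf z) = z.
Proof.
move=> /andP[z0 z1]; have pi0 : 0 < pi :> R by exact: pi_gt0.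
have pi20 : pi / 2 != 0 :> R by rewrite gt_eqF// divr_gt0.
rewrite /arcsine_map /arcsine_cdf mulrA -[2 / pi]invf_div (mulfV pi20).
rewrite mul1r asinK ?sqr_sqrtr// in_itv/=.
have s1 : Num.sqrt z <= 1 by rewrite -sqrtr1 ler_wsqrtr.
by rewrite s1 andbT (le_trans _ (sqrtr_ge0 z))// lerN10.
Qed.

Lemma arcsine_map_le_cdf u z : 0 <= u <= 1 -> 0 <= z <= 1 ->
  (arcsine_map u <= z) = (u <= arcsine_cdf z).
Proof.
move=> /andP[u0 u1] z01; have /andP[c0 c1] := arcsine_cdf01 z01.
have [uc|uc|->] := ltgtP u (arcsine_cdf z).
- by rewrite -(arcsine_cdfK z01) ltW// arcsine_map_lt.
- by apply/negbTE; rewrite -ltNge -(arcsine_cdfK z01) arcsine_map_lt.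
- by rewrite arcsine_cdfK// lexx.
Qed.

Lemma uniform_prob_arcsine z : 0 <= z <= 1 ->
  nu (@arcsine_map R @^-1` `]-oo, z]%classic) = (arcsine_cdf z)%:E.
Proof.
move=> z01; have /andP[c0 c1] := arcsine_cdf01 z01.
rewrite uniform_prob01E; last first.
  by rewrite -[X in measurable X]setTI; apply: measurable_arcsine_map.
rewrite -(lebesgue_measure_itv0 c0); congr lebesgue_measure.
apply/seteqP; split => u /=; rewrite !in_itv/=.
  by move=> [uz u01]; rewrite -(arcsine_map_le_cdf u01 z01) uz andbT; case/andP: u01.
move=> /andP[u0 uc]; have u01 : 0 <= u <= 1 by rewrite u0 (le_trans uc).
by rewrite arcsine_map_le_cdf.
Qed.

Let arcsine_integralE (f : R -> R) : continuous f -> (forall x, 0 <= f x <= 1) ->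
  (\int[nu]_u f (arcsine_map u))%:E =
  (\int[lebesgue_measure]_(u in `[0%R, 1%R]) (f (arcsine_map u))%:E)%E.
Proof.
move=> cf f01; have mf := continuous_measurable_fun (continuous_arcsine_comp cf).
rewrite /Rintegral fineK; last first.
  apply: integrable_fin_num => //; apply: (@integrable_arcsine_comp _ _ 1) => //.
  by move=> x _; have /andP[? ?] := f01 x; rewrite ger0_norm.
rewrite integral_uniform ?subr0 ?invr1 ?mul1e//.
  by apply/measurable_EFinP.
by move=> u; rewrite lee_fin; have /andP[] := f01 (arcsine_map u).
Qed.

Let integral_indic_itv (s : R) : 0 <= s <= 1 ->
  (\int[lebesgue_measure]_(u in `[0%R, 1%R]) (\1_(`[0, s]%classic : set R) u)%:E)%E = s%:E.
Proof.
move=> /andP[s0 s1]; rewrite integral_indic// -(lebesgue_measure_itv0 s0).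
congr lebesgue_measure; apply/setIidPl => u /=; rewrite !in_itv/= => /andP[-> us].
exact: le_trans s1.
Qed.

(** In the uniform variable the integrand is at most the indicator of [0, s], because [arcsine_map]
    increases on [0, 1]. *)
Lemma Rintegral_arcsine_le (f : R -> R) (s : R) : continuous f -> 0 <= s <= 1 ->
  (forall x, 0 <= f x <= 1) -> (forall x, arcsine_map s <= x -> f x = 0) ->
  \int[nu]_u f (arcsine_map u) <= s.
Proof.
move=> cf s01 f01 fs; rewrite -lee_fin arcsine_integralE// -integral_indic_itv//.
have mf := continuous_measurable_fun (continuous_arcsine_comp cf).
apply: ge0_le_integral => //=.
- by move=> u _; rewrite lee_fin; have /andP[] := f01 (arcsine_map u).
- by apply/measurable_EFinP; apply: measurable_funTS.
- by apply/measurable_EFinP; apply: measurable_funTS; exact: measurable_indic.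
move=> u; rewrite in_itv/= => /andP[u0 u1]; rewrite lee_fin indicE.
have [us|su] := leP u s; last first.
  by rewrite fs// ltW// arcsine_map_lt//; case/andP: s01.
by rewrite mem_set/= ?in_itv/= ?u0//; have /andP[] := f01 (arcsine_map u).
Qed.

Lemma Rintegral_arcsine_ge (f : R -> R) (s : R) : continuous f -> 0 <= s <= 1 ->
  (forall x, 0 <= f x <= 1) -> (forall x, x <= arcsine_map s -> f x = 1) ->
  s <= \int[nu]_u f (arcsine_map u).
Proof.
move=> cf s01 f01 fs; rewrite -lee_fin arcsine_integralE// -integral_indic_itv//.
have mf := continuous_measurable_fun (continuous_arcsine_comp cf).
apply: ge0_le_integral => //=.
- by apply/measurable_EFinP; apply: measurable_funTS; exact: measurable_indic.
- by apply/measurable_EFinP; apply: measurable_funTS.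
move=> u; rewrite in_itv/= => /andP[u0 u1]; rewrite lee_fin indicE.
have [us|su] := leP u s; last first.
  rewrite memNset; first by have /andP[] := f01 (arcsine_map u).
  by rewrite /= in_itv/= u0 leNgt su.
rewrite mem_set/= ?in_itv/= ?u0// fs//.
move: us; rewrite le_eqVlt => /predU1P[->//|us].
by rewrite ltW// arcsine_map_lt//; case/andP: s01.
Qed.

End arcsine_distribution.

Section affine_arcsine.
Context (R : realType).
Implicit Types (m p u : R).

(** The limit of T_N / N when a share [arcsine_map u] of the time is spent on the right, where the
    mean is [p], and the rest on the left, where it is [m]. *)
Definition affine_arcsine m p (u : measurableTypeR R) : R :=
  m + (p - m) * arcsine_map u.

Lemma measurable_affine_arcsine m p : measurable_fun setT (affine_arcsine m p).
Proof.
apply: measurable_funD => //; apply: measurable_funM => //.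
exact: measurable_arcsine_map.
Qed.

HB.instance Definition _ m p := @isMeasurableFun.Build _ _
  (g_sigma_algebraType R.-ocitv.-measurable) R (affine_arcsine m p)
  (measurable_affine_arcsine m p).

Definition affine_arcsine_law m p : probability R R :=
  distribution (uniform_prob (@ltr01 R)) (affine_arcsine m p).

End affine_arcsine.

(** * The limit law *)

Section occupation_limit.
Context d (T : measurableType d) (R : realType) (P : probability T R).
Context (X : nat -> {RV P >-> int}).
Hypothesis X_iid : iid P X.
Hypothesis X_centered : ('E_P[fun w => (X 0%N w)%:~R] = 0)%E.
Hypothesis X_finite_variance : ('V_P[fun w => (X 0%N w)%:~R] < +oo)%E.
Hypothesis X_nondegenerate : nondegenerate_walk P X.
Hypothesis X_aperiodic : aperiodic_walk P X.
Implicit Types (F : int -> R) (f : R -> R) (n m M N : nat) (a b e : R).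

Let nu := uniform_prob (@ltr01 R).

Let integrable_laplace b N n : 0 <= b ->
  P.-integrable setT (EFin \o (fun w => expR (- (b * (occupation_time X n w)%:R / N%:R)))).
Proof.
move=> b0; apply: (@integrable_bounded _ _ _ _ _ 1) => [|w].
  exact: (measurable_occupation_time X (fun o => expR (- (b * o%:R / N%:R)))).
have bo : 0 <= b * (occupation_time X n w)%:R / N%:R by rewrite !mulr_ge0// invr_ge0.
by have /andP[? ?] := expRN_01 bo; rewrite ger0_norm.
Qed.

Lemma occupation_laplace01 b N n : 0 <= b -> 0 <= occupation_laplace X b N n <= 1.
Proof.
move=> b0; apply/andP; split.
  by apply: Rintegral_ge0 => u _; exact: expR_ge0.
apply: Rintegral_le_cst; first exact: integrable_laplace.
move=> w; have bo : 0 <= b * (occupation_time X n w)%:R / N%:R by rewrite !mulr_ge0// invr_ge0.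
by have /andP[] := expRN_01 bo.
Qed.

Lemma occupation_time_dist n m w :
  `|(occupation_time X n w)%:R - (occupation_time X m w)%:R| <= `|n%:R - m%:R| :> R.
Proof.
wlog mn : n m / (m <= n)%N => [H|].
  case/orP: (leq_total m n) => mn; first exact: H.
  by rewrite distrC [leRHS]distrC; exact: H.
have H k : (occupation_time X m w <= occupation_time X (m + k) w <= occupation_time X m w + k)%N.
  elim: k => [|k IHk]; first by rewrite !addn0 leqnn.
  by rewrite addnS occupation_timeS; case: (0 <= _)%R IHk; lia.
have /andP[h1 h2] := H (n - m)%N; rewrite subnKC// in h1 h2.
by rewrite -!natrB// !ger0_norm// ler_nat; lia.
Qed.

Lemma occupation_laplace_dist b N n m : 0 <= b ->
  `|occupation_laplace X b N n - occupation_laplace X b N m| <= b * (`|n%:R - m%:R| / N%:R).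
Proof.
move=> b0; apply: Rintegral_dist_le; [exact: integrable_laplace..|move=> w].
have bo k : 0 <= b * (occupation_time X k w)%:R / N%:R by rewrite !mulr_ge0// invr_ge0.
apply: le_trans (expRN_dist (bo n) (bo m)) _.
rewrite -mulrBl -mulrBr !normrM (ger0_norm b0) [ `|_^-1|]ger0_norm ?invr_ge0// -mulrA.
by rewrite ler_wpM2l// ler_wpM2r ?invr_ge0// occupation_time_dist.
Qed.

(** The Tauberian lemma is applied to the difference of the two transforms: both lie in [0, 1], both
    are Lipschitz at scale [N] with constant [b], and their Abel means have the same limit. At n = N
    the second one is [arcsine_laplace b]. *)
Lemma occupation_laplace_cvg b e : 0 <= b -> 0 < e -> exists N0, forall N, (N0 <= N)%N ->
  `|occupation_laplace X b N N - arcsine_laplace b| <= e.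
Proof.
move=> b0 e0.
pose D N n := occupation_laplace X b N n - arcsine_laplace (b * n%:R / N%:R).
have bnN N n : 0 <= b * n%:R / N%:R by rewrite !mulr_ge0// invr_ge0.
have K0 : 0 <= 2 * b by rewrite mulr_ge0.
have D1 N n : `|D N n| <= 1.
  have /andP[h1 h2] := occupation_laplace01 N n b0.
  have /andP[h3 h4] := arcsine_laplace01 (bnN N n).
  by rewrite /D ler_norml; apply/andP; split; clear -h1 h2 h3 h4; lra.
have DK N n m : (0 < N)%N -> `|D N n - D N m| <= 2 * b * (`|n%:R - m%:R| / N%:R).
  move=> _; have h1 := occupation_laplace_dist N n m b0.
  have h2 : `|arcsine_laplace (b * n%:R / N%:R) - arcsine_laplace (b * m%:R / N%:R)|
      <= b * (`|n%:R - m%:R| / N%:R).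
    apply: le_trans (arcsine_laplace_dist (bnN N n) (bnN N m)) _.
    by rewrite -mulrBl -mulrBr !normrM (ger0_norm b0) [ `|_^-1|]ger0_norm ?invr_ge0// mulrA.
  rewrite /D; move: h1 h2; set p := occupation_laplace _ _ _ _; set q := occupation_laplace _ _ _ _.
  set r := arcsine_laplace _; set s := arcsine_laplace _ => h1 h2.
  have -> : p - r - (q - s) = (p - q) - (r - s) by ring.
  by rewrite (le_trans (ler_normB _ _))//; clear -h1 h2; lra.
have Dabel a : 0 < a -> iterated_cvg0
    (fun N M => N%:R^-1 * \sum_(n < M) expR (- (a * n%:R / N%:R)) * D N n).
  move=> a0 e' e'0.
  have H1 : iterated_cvg0 (fun N M => N%:R^-1 * \sum_(n < M)
      expR (- (a * n%:R / N%:R)) * occupation_laplace X b N n - (Num.sqrt (a * (a + b)))^-1).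
    by move=> e1 e10; exact: occupation_laplace_resolvent.
  have H2 := iterated_cvg0Z (-1) (arcsine_laplace_resolvent a0 b0).
  have [N0 HN0] := iterated_cvg0D H1 H2 e'0.
  exists N0 => N /HN0[M0 HM0]; exists M0 => M /HM0; apply: le_trans.
  rewrite le_eqVlt; apply/orP; left; apply/eqP; congr `|_|.
  under eq_bigr do rewrite /D mulrBr.
  by rewrite sumrB; ring.
have [N0 HN0] := laplace_tauberian K0 D1 DK Dabel e0.
exists (maxn N0 1) => N; rewrite geq_max => /andP[/HN0 + N1].
by rewrite /D mulfK// pnatr_eq0 -lt0n.
Qed.

(** On [0, 1] [f] is uniformly close to a combination of exponentials e^(-(i + 1) x), whose
    expectations converge by [occupation_laplace_cvg]. *)
Lemma occupation_time_cvg (f : R -> R) B e : continuous f -> (forall x, `|f x| <= B) ->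
  0 < e -> exists N0, forall N, (N0 <= N)%N ->
  `|\int[P]_w f ((occupation_time X N w)%:R / N%:R)
    - \int[nu]_u f (arcsine_map u)| <= e.
Proof.
move=> cf fB e0; have e30 : 0 < e / 3 by rewrite divr_gt0.
have lt12 : 1 < 2 :> R by rewrite ltr1n.
(* The ramp provides the vanishing beyond 2 that the approximation asks for. It equals 1 on [0, 1],
   where both variables take their values. *)
have cpsi : continuous (fun x => f x * ramp 1 2 x).
  by move=> x; apply: cvgM; [exact: cf|exact: continuous_ramp].
have [|p pE] := exp_polynomial_approximation cpsi _ e30.
  by move=> x x2; rewrite ramp_right// mulr0.
pose q x := \sum_(i < size p) p`_i * expR (- (i.+1%:R * x)).
have fq x : 0 <= x <= 1 -> `|f x - q x| <= e / 3.
  move=> /andP[x0 x1]; have := pE x x0; rewrite ramp_left// mulr1.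
  have -> : expR (- x) * p.[expR (- x)] = q x.
    rewrite horner_coef mulr_sumr /q; apply: eq_bigr => i _.
    by rewrite mulrCA -exprS -expRM_natl mulrN.
  move=> /le_trans; apply; rewrite ler_piMr ?(ltW e30)//.
  by have /andP[] := expRN_01 x0.
have H : iterated_cvg0 (fun N M => \sum_(i < size p)
    p`_i * (occupation_laplace X i.+1%:R N N - arcsine_laplace i.+1%:R)).
  apply: (@iterated_cvg0_sum _ _ (fun i N M =>
    p`_i * (occupation_laplace X i.+1%:R N N - arcsine_laplace i.+1%:R))) => i.
  apply: iterated_cvg0Z => e1 e10.
  have [N0 HN0] := @occupation_laplace_cvg i.+1%:R e1 (ler0n _ _) e10.
  by exists N0 => N /HN0 HN; exists 0%N.
have [N0 HN0] := H _ e30; exists (maxn N0 1) => N; rewrite geq_max => /andP[/HN0[M0 HM0] N1].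
have NR0 : 0 < N%:R :> R by rewrite ltr0n.
have := HM0 M0 (leqnn _) => {HM0 HN0}.
have iq (i : nat) : P.-integrable setT
    (EFin \o (fun w => p`_i * expR (- (i.+1%:R * ((occupation_time X N w)%:R / N%:R))))).
  apply: integrable_RZ; have := @integrable_laplace i.+1%:R N N (ler0n _ _).
  by under eq_fun do rewrite -mulrA.
have iu (i : nat) : (nu).-integrable setT
    (EFin \o (fun u => p`_i * expR (- (i.+1%:R * arcsine_map u)))).
  by apply: integrable_RZ; exact: integrable_arcsine_laplace.
have -> : \sum_(i < size p) p`_i * (occupation_laplace X i.+1%:R N N - arcsine_laplace i.+1%:R)
   = \int[P]_w q ((occupation_time X N w)%:R / N%:R)
     - \int[nu]_u q (arcsine_map u).
  rewrite /q (@Rintegral_sum _ _ _ _ _ _ (fun (i : 'I_(size p)) w =>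
    p`_i * expR (- (i.+1%:R * ((occupation_time X N w)%:R / N%:R)))))//.
  have -> : \int[nu]_u (\sum_(i < size p)
      p`_i * expR (- (i.+1%:R * arcsine_map u))) =
      \sum_(i < size p) \int[nu]_u (p`_i * expR (- (i.+1%:R * arcsine_map u))).
    exact: (@Rintegral_sum _ _ _ (nu) _ _ (fun (i : 'I_(size p)) u =>
      p`_i * expR (- (i.+1%:R * arcsine_map u)))).
  rewrite -sumrB; apply: eq_bigr => i _; rewrite mulrBr; congr (_ - _).
    rewrite -RintegralZl//; last exact: integrable_laplace.
    by apply: eq_Rintegral => w _; rewrite mulrA.
  by rewrite -RintegralZl//; exact: integrable_arcsine_laplace.
have cq : continuous q.
  move=> x; rewrite /q; elim: (size p) => [|k IHk].
    by under eq_fun do rewrite big_ord0; exact: cvg_cst.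
  under eq_fun do rewrite big_ord_recr /=.
  apply: cvgD => //; apply: cvgM; first exact: cvg_cst.
  exact: (@continuous_laplace_kernel R k.+1%:R x).
have qB x : 0 <= x <= 1 -> `|q x| <= B + e / 3.
  move=> /fq; have := fB x; set a := f x; set b := q x => h1 h2.
  have -> : b = a - (a - b) by ring.
  by rewrite (le_trans (ler_normB _ _))// lerD.
have occ01 w : 0 <= ((occupation_time X N w)%:R / N%:R : R) <= 1.
  apply/andP; split; first by rewrite divr_ge0.
  by rewrite ler_pdivrMr// mul1r ler_nat occupation_time_le.
have moc (g : R -> R) : measurable_fun setT (fun w => g ((occupation_time X N w)%:R / N%:R)).
  exact: (measurable_occupation_time X (fun o => g (o%:R / N%:R))).
have d1 : `|\int[P]_w f ((occupation_time X N w)%:R / N%:R) -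
    \int[P]_w q ((occupation_time X N w)%:R / N%:R)| <= e / 3.
  apply: Rintegral_dist_le => [||w].
  - exact: (@integrable_bounded _ _ _ _ _ B).
  - by apply: (@integrable_bounded _ _ _ _ _ (B + e / 3)) => // w; exact: qB.
  - exact: fq.
have d2 : `|\int[nu]_u f (arcsine_map u) -
    \int[nu]_u q (arcsine_map u)| <= e / 3.
  apply: Rintegral_dist_le => [||u].
  - exact: (@integrable_arcsine_comp _ f B).
  - exact: (@integrable_arcsine_comp _ q (B + e / 3)).
  - by apply: fq; exact: arcsine_map01.
move: d1 d2; set A := Rintegral _ _ _; set A' := Rintegral _ _ _.
set C := Rintegral _ _ _; set C' := Rintegral _ _ _ => d1 d2 d3.
have -> : A - C = (A - A') + (A' - C') - (C - C') by ring.
rewrite (le_trans (ler_normB _ _))//.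
have := ler_normD (A - A') (A' - C'); clear -d1 d2 d3; lra.
Qed.

(** [additive_functional] runs over the times 1, ..., N and [occupation_time] over 0, ..., N - 1.
    Exchanging time 0, at which the walk is at 0 and is counted, for time N changes the count by at
    most 1. *)
Lemma additive_functional_occupation F N w :
  `|additive_functional F X N w -
    (mean_neg F * N%:R + (mean_pos F - mean_neg F) * (occupation_time X N w)%:R)| <=
  `|additive_functional (fun x => F x - two_sided_mean F x) X N w| +
    `|mean_pos F - mean_neg F|.
Proof.
set p := mean_pos F - mean_neg F.
have -> : additive_functional F X N w =
    additive_functional (fun x => F x - two_sided_mean F x) X N w +
    (mean_neg F * N%:R + p * \sum_(1 <= n < N.+1) (0 <= walk X n w)%R%:R).
  rewrite /additive_functional sumrB /two_sided_mean big_split /= -mulr_sumr.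
  by rewrite sumr_const_nat subSS subn0 mulr_natr subrK.
set A := additive_functional _ _ _ _; set Q := \sum_(1 <= n < N.+1) _.
have QE : Q = (occupation_time X N w)%:R + (0 <= walk X N w)%R%:R - 1.
  rewrite -natrD -occupation_timeS /occupation_time.
  rewrite -(big_mkord xpredT (fun k => (0 <= walk X k w)%R : nat)) big_ltn//.
  by rewrite /walk big_nil natrD addrAC subrr add0r natr_sum.
have -> : A + (mean_neg F * N%:R + p * Q) -
    (mean_neg F * N%:R + p * (occupation_time X N w)%:R) =
    A + p * ((0 <= walk X N w)%R%:R - 1) by rewrite QE; ring.
rewrite (le_trans (ler_normD _ _))// lerD2l normrM ler_piMr//.
by case: (0 <= _)%R; rewrite ?subrr ?normr0// sub0r normrN1.
Qed.

Lemma additive_functional_L1 F B e : (forall x, `|F x| <= B) -> G_both F -> 0 < e ->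
  exists N0, forall N, (N0 <= N)%N ->
  \int[P]_w `|additive_functional F X N w / N%:R -
    (mean_neg F + (mean_pos F - mean_neg F) * ((occupation_time X N w)%:R / N%:R))| <= e.
Proof.
move=> FB GF e0; have e20 : 0 < e / 2 by rewrite divr_gt0.
set p := mean_pos F - mean_neg F.
pose G x := F x - two_sided_mean F x.
have GB x : `|G x| <= B + (`|mean_neg F| + `|p|).
  rewrite (le_trans (ler_normB _ _))// lerD// (le_trans (ler_normD _ _))// lerD2l.
  by rewrite normrM ler_piMr// ger0_norm// lern1 leq_b1.
have [N1 HN1] := additive_functional_zero_average X_iid X_centered X_finite_variance
  X_nondegenerate X_aperiodic GB e20 (fun=> G_both_averages FB GF).
pose N2 := (Num.truncn (`|p| / (e / 2))).+1.
exists (maxn N1 N2) => N; rewrite geq_max => /andP[/HN1 HN N2N].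
have NR0 : 0 < N%:R :> R by rewrite ltr0n; exact: leq_trans N2N.
have pN : `|p| <= e / 2 * N%:R.
  rewrite mulrC -ler_pdivrMr// (le_trans (ltW (truncnS_gt _)))// ler_nat.
  exact: N2N.
have mA (h : int -> R) : measurable_fun setT (additive_functional h X N).
  exact: measurable_additive_functional.
have iG : P.-integrable setT (EFin \o (fun w => `|additive_functional G X N w|)).
  apply: (@integrable_bounded _ _ _ _ _ (N%:R * (B + (`|mean_neg F| + `|p|)))).
    by apply: measurableT_comp.
  by move=> w; rewrite normr_id additive_functional_bounded.
have iGp : P.-integrable setT (EFin \o (fun w => (`|additive_functional G X N w| + `|p|))).
  by apply: integrable_RD => //; exact: integrable_Rcst.
have pw w : `|additive_functional F X N w / N%:R -
    (mean_neg F + p * ((occupation_time X N w)%:R / N%:R))| <=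
    N%:R^-1 * (`|additive_functional G X N w| + `|p|).
  have -> : additive_functional F X N w / N%:R -
    (mean_neg F + p * ((occupation_time X N w)%:R / N%:R)) = N%:R^-1 *
    (additive_functional F X N w - (mean_neg F * N%:R + p * (occupation_time X N w)%:R)).
    by field; rewrite gt_eqF.
  rewrite normrM ger0_norm ?invr_ge0 ?(ltW NR0)// ler_wpM2l ?invr_ge0 ?(ltW NR0)//.
  exact: additive_functional_occupation.
apply: (@le_trans _ _ (\int[P]_w (N%:R^-1 * (`|additive_functional G X N w| + `|p|)))).
  apply: le_Rintegral => //; last exact: integrable_RZ.
  apply: (@le_integrable _ _ _ P _ measurableT _ _ _ _ (integrable_RZ N%:R^-1 iGp)).
    apply/measurable_EFinP; apply: measurableT_comp => //; apply: measurable_funB.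
      by apply: measurable_funM.
    apply: measurable_funD => //; apply: measurable_funM => //.
    exact: (measurable_occupation_time X (fun o => o%:R / N%:R : R)).
  by move=> w _; rewrite lee_fin normr_id (le_trans (pw w))// ler_norm.
rewrite RintegralZl// RintegralD//; last exact: integrable_Rcst.
rewrite Rintegral_prob_cst ler_pdivrMl// (le_trans (lerD HN pN))//.
by rewrite -mulrDl -splitr mulrC.
Qed.

(** For [x] in [-B, B] and any [y], |f x - f y| <= e / 4 + (2 M / D) |x - y|: uniform continuity
    covers the distances below [D], the bound [M] the others. This converts the L^1 estimate for T_N
    / N into closeness of expectations. *)
Lemma additive_functional_cvg F f e : G_both F -> continuous f -> bounded_fun f ->
  0 < e -> exists N0, forall N, (N0 <= N)%N ->
  `|\int[P]_w f (additive_functional F X N w / N%:R) -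
    \int[nu]_u f (affine_arcsine (mean_neg F) (mean_pos F) u)| <= e.
Proof.
move=> GF cf /bounded_fun_bound[M fM] e0.
have [B FB] : exists B, forall x, `|F x| <= B by apply: bounded_fun_bound; exact: GF.1.1.
set m := mean_neg F; set p := mean_pos F.
have M0 : 0 <= M := le_trans (normr_ge0 _) (fM 0).
have B0 : 0 <= B := le_trans (normr_ge0 _) (FB 0).
have e20 : 0 < e / 2 by rewrite divr_gt0.
have e40 : 0 < e / 4 by rewrite divr_gt0.
have [D D0 fD] := @uniform_continuity_segment R f (- B) B _ cf e40.
have fD2 x y : `|x| <= B -> `|f x - f y| <= e / 4 + 2 * M / D * `|x - y|.
  move=> xB; have r0 : 0 <= 2 * M / D * `|x - y|.
    by rewrite mulr_ge0// divr_ge0 ?(ltW D0)// mulr_ge0.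
  have [xyD|Dxy] := ltP `|x - y| D.
    by rewrite ler_wpDr// fD// -ler_norml.
  rewrite ler_wpDl ?(ltW e40)// (le_trans (ler_normB _ _))//.
  rewrite (le_trans (lerD (fM x) (fM y)))//.
  have -> : 2 * M / D * `|x - y| = (M + M) * (`|x - y| / D) by ring.
  by rewrite ler_peMr ?addr_ge0// ler_pdivlMr// mul1r.
pose e' := e / 4 / (2 * M / D + 1).
have MD0 : 0 <= 2 * M / D by rewrite divr_ge0 ?(ltW D0)// mulr_ge0.
have MD1 : 0 < 2 * M / D + 1 by rewrite ltr_wpDl.
have e'0 : 0 < e' by rewrite divr_gt0.
have e'E : 2 * M / D * e' <= e / 4.
  have : (2 * M / D + 1) * e' = e / 4 by rewrite mulrC divfK// gt_eqF.
  by move=> <-; rewrite ler_wpM2r ?(ltW e'0)// lerDl.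
have [N1 HN1] := additive_functional_L1 FB GF e'0.
pose g x := f (m + (p - m) * x).
have cg : continuous g.
  move=> x; apply: (@continuous_comp _ _ _ (fun x => m + (p - m) * x) f); last exact: cf.
  by apply: cvgD; [exact: cvg_cst|exact: mulrl_continuous].
have [N2 HN2] := occupation_time_cvg cg (fun x => fM _) e20.
exists (maxn (maxn N1 N2) 1) => N; rewrite !geq_max => /andP[/andP[/HN1 H1 /HN2 H2] N0].
have NR0 : 0 < N%:R :> R by rewrite ltr0n.
set Y := fun w => additive_functional F X N w / N%:R in H1 *.
set Z := fun w => (occupation_time X N w)%:R / N%:R : R in H1 H2 *.
have mf : measurable_fun setT f by exact: continuous_measurable_fun.
have mY : measurable_fun setT Y.
  by apply: measurable_funM => //; exact: measurable_additive_functional.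
have mZ (h : R -> R) : measurable_fun setT (fun w => h (Z w)).
  exact: (measurable_occupation_time X (fun o => h (o%:R / N%:R))).
have YB w : `|Y w| <= B.
  rewrite normrM [ `|_^-1|]ger0_norm ?invr_ge0// ler_pdivrMr// mulrC.
  exact: additive_functional_bounded.
have Z01 w : `|Z w| <= 1.
  rewrite ger0_norm ?divr_ge0// ler_pdivrMr// mul1r ler_nat.
  exact: occupation_time_le.
have iYZ : P.-integrable setT (EFin \o (fun w => `|Y w - (m + (p - m) * Z w)|)).
  apply: (@integrable_bounded _ _ _ _ _ (B + (`|m| + `|p - m|))) => [|w].
    apply: measurableT_comp => //; apply: measurable_funB => //.
    exact: (mZ (fun z => m + (p - m) * z)).
  rewrite normr_id (le_trans (ler_normB _ _))// lerD// (le_trans (ler_normD _ _))//.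
  by rewrite lerD2l normrM ler_piMr.
have ifY : P.-integrable setT (EFin \o (fun w => f (Y w))).
  by apply: (@integrable_bounded _ _ _ _ _ M) => //; apply: measurableT_comp.
have igZ : P.-integrable setT (EFin \o (fun w => g (Z w))).
  by apply: (@integrable_bounded _ _ _ _ _ M) => // w; exact: fM.
have d1 : `|\int[P]_w f (Y w) - \int[P]_w g (Z w)| <= e / 2.
  rewrite -RintegralB// (le_trans (le_normr_Rintegral _ _))//.
    exact: integrable_RB.
  apply: (@le_trans _ _ (\int[P]_w (e / 4 + 2 * M / D * `|Y w - (m + (p - m) * Z w)|))).
    apply: le_Rintegral => //.
    - by have /integrable_norm := integrable_RB ifY igZ; apply.
    - by apply: integrable_RD; [exact: integrable_Rcst|exact: integrable_RZ].
    - by move=> w _; exact: fD2.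
  rewrite RintegralD//; [|exact: integrable_Rcst|exact: integrable_RZ].
  rewrite Rintegral_prob_cst RintegralZl//.
  have := le_trans (ler_wpM2l MD0 H1) e'E.
  set I := 2 * M / D * _ => HI.
  by rewrite (_ : e / 2 = e / 4 + e / 4) ?lerD2l//; field.
move: d1 H2; rewrite /g -/(nu) => d1 d2.
rewrite (le_trans (ler_distD (\int[P]_w f (m + (p - m) * Z w)) _ _))//.
by rewrite [leRHS]splitr lerD.
Qed.

Lemma additive_functional_cvg_in_law F : G_both F ->
  cvg_in_law P (fun N w => additive_functional F X N w / N%:R)
    (affine_arcsine_law (mean_neg F) (mean_pos F)).
Proof.
move=> GF f cf bf.
have [M fM] := bounded_fun_bound bf.
have mf : measurable_fun setT f by exact: continuous_measurable_fun.
have iu : nu.-integrable setT (EFin \o (fun u => f (affine_arcsine (mean_neg F) (mean_pos F) u))).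
  apply: (@integrable_bounded _ _ _ _ _ M) => //.
  by apply: measurableT_comp => //; exact: measurable_affine_arcsine.
rewrite /affine_arcsine_law integral_distribution//; last exact/measurable_EFinP.
rewrite -(fineK (integrable_fin_num measurableT iu)).
have iY N : P.-integrable setT (EFin \o (fun w => f (additive_functional F X N w / N%:R))).
  apply: (@integrable_bounded _ _ _ _ _ M) => //; apply: measurableT_comp => //.
  by apply: measurable_funM => //; exact: measurable_additive_functional.
rewrite (_ : (fun N => 'E_P[_])%E =
    EFin \o (fun N => \int[P]_w f (additive_functional F X N w / N%:R))); last first.
  apply/funext => N; rewrite unlock /= /Rintegral fineK//.
  exact: (integrable_fin_num measurableT (iY N)).
apply: cvg_EFin; first exact: nearW.
apply/cvgrPdist_le => e e0.
have [N0 HN0] := additive_functional_cvg GF cf bf e0.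
by exists N0 => // N /= /HN0; rewrite distrC.
Qed.

(* The ramps end at values of arcsine_map, so that no continuity of the
   distribution function is needed. *)
Lemma additive_functional_arcsine F z : G_both F -> mean_neg F = 0 -> mean_pos F = 1 ->
  0 <= z <= 1 ->
  P [set w | additive_functional F X N w / N%:R <= z] @[N --> \oo] --> (arcsine_cdf z)%:E.
Proof.
move=> GF m0 p1 z01.
have map01 u : affine_arcsine (mean_neg F) (mean_pos F) u = arcsine_map u.
  by rewrite /affine_arcsine m0 p1 add0r subr0 mul1r.
pose Y N w := additive_functional F X N w / N%:R.
have mY N : measurable_fun setT (Y N).
  by apply: measurable_funM => //; exact: measurable_additive_functional.
pose A N := [set w | Y N w <= z].
have mA N : measurable (A N).
  rewrite (_ : A N = setT `&` Y N @^-1` `]-oo, z]%classic); first exact: mY.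
  by rewrite setTI; apply/seteqP; split => w /=; rewrite in_itv.
have iA N : P.-integrable setT (EFin \o \1_(A N)).
  by apply: (@integrable_bounded _ _ _ _ _ 1) => // w; rewrite ger0_norm// indicE lern1 leq_b1.
pose q N := \int[P]_w \1_(A N) w.
have PA N : P (A N) = (q N)%:E.
  rewrite /q /Rintegral fineK; last exact: (integrable_fin_num measurableT (iA N)).
  by rewrite integral_indic// setIT.
rewrite (_ : (fun N => P _) = EFin \o q); last by apply/funext.
have q1 N : q N <= 1 by apply: Rintegral_le_cst => // w; rewrite indicE lern1 leq_b1.
have q0 N : 0 <= q N by apply: Rintegral_ge0.
have ir (a b : R) N : P.-integrable setT (EFin \o (fun w => ramp a b (Y N w))).
  apply: (@integrable_bounded _ _ _ _ _ 1) => [|w].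
    apply: measurableT_comp => //; apply: continuous_measurable_fun.
    exact: continuous_ramp.
  by have /andP[? ?] := ramp01 a b (Y N w); rewrite ger0_norm.
have cvg_ramp (a b e : R) : 0 < e -> exists N0, forall N, (N0 <= N)%N ->
    `|\int[P]_w ramp a b (Y N w) - \int[nu]_u ramp a b (arcsine_map u)| <= e.
  move=> e0; have br : bounded_fun (ramp a b).
    exists 1; split; first exact: num_real.
    move=> B B1 x _; have /andP[r0 r1] := ramp01 a b x.
    by rewrite /= ger0_norm// (le_trans r1)// ltW.
  have [N0 HN0] := additive_functional_cvg GF (@continuous_ramp R a b) br e0.
  exists N0 => N /HN0; rewrite (_ : \int[nu]_u ramp a b (affine_arcsine _ _ u) =
    \int[nu]_u ramp a b (arcsine_map u))//.
  by apply: eq_Rintegral => u _; rewrite map01.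
have /andP[c0 c1] := arcsine_cdf01 z01.
set c := arcsine_cdf z in c0 c1 *.
have Yc : arcsine_map c = z by exact: arcsine_cdfK.
apply: cvg_EFin; first exact: nearW.
apply/cvgrPdist_le => e e0; have e20 : 0 < e / 2 by rewrite divr_gt0.
have upper : exists N0, forall N, (N0 <= N)%N -> q N <= c + e.
  (* [arcsine_map] is monotone only on [0, 1]; when the level exceeds 1 the bound is trivial, since
     a probability is at most 1. *)
  have [s1|s1] := ltP 1 (c + e / 2).
    exists 0%N => N _; rewrite (le_trans (q1 N))// (le_trans (ltW s1))// lerD2l.
    by rewrite ler_pdivrMr// ler_peMr ?ler1n// ltW.
  have zs : z < arcsine_map (c + e / 2) by rewrite -Yc arcsine_map_lt// ltrDl.
  have [N0 HN0] := cvg_ramp z (arcsine_map (c + e / 2)) _ e20.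
  exists N0 => N /HN0 H.
  have h1 : q N <= \int[P]_w ramp z (arcsine_map (c + e / 2)) (Y N w).
    apply: le_Rintegral => // w _; rewrite indicE.
    have [Az|Az] := boolP (w \in A N); last by have /andP[] := ramp01 z (arcsine_map (c + e / 2)) (Y N w).
    by rewrite ramp_left//; move: Az; rewrite inE.
  have h2 : \int[nu]_u ramp z (arcsine_map (c + e / 2)) (arcsine_map u) <= c + e / 2.
    apply: Rintegral_arcsine_le; first exact: continuous_ramp.
    - by rewrite s1 andbT addr_ge0// ltW.
    - exact: ramp01.
    - by move=> x; exact: ramp_right.
  move: H; rewrite ler_norml => /andP[_]; move: h1 h2.
  set I := Rintegral _ _ _; set J := Rintegral _ _ _ => h1 h2 h3.
  rewrite (le_trans h1)// -(subrK J I) (le_trans (lerD h3 h2))//.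
  by rewrite addrCA -splitr.
have lower : exists N0, forall N, (N0 <= N)%N -> c - e <= q N.
  have [s0|s0] := ltP (c - e / 2) 0.
    exists 0%N => N _; rewrite (le_trans _ (q0 N))// (le_trans _ (ltW s0))// lerD2l lerN2.
    by rewrite ler_pdivrMr// ler_peMr ?ler1n// ltW.
  have sz : arcsine_map (c - e / 2) < z.
    by rewrite -Yc arcsine_map_lt// ltrBlDr ltrDl.
  have [N0 HN0] := cvg_ramp (arcsine_map (c - e / 2)) z _ e20.
  exists N0 => N /HN0 H.
  have h1 : \int[P]_w ramp (arcsine_map (c - e / 2)) z (Y N w) <= q N.
    apply: le_Rintegral => // w _; rewrite indicE.
    have [Az|Az] := boolP (w \in A N).
      by have /andP[] := ramp01 (arcsine_map (c - e / 2)) z (Y N w).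
    rewrite ramp_right//; move: Az; rewrite notin_setE /A /= => /negP.
    by rewrite -ltNge => /ltW.
  have h2 : c - e / 2 <= \int[nu]_u ramp (arcsine_map (c - e / 2)) z (arcsine_map u).
    apply: Rintegral_arcsine_ge; first exact: continuous_ramp.
    - by rewrite s0 (le_trans _ c1)// gerBl ltW.
    - exact: ramp01.
    - by move=> x; exact: ramp_left.
  move: H; rewrite ler_norml => /andP[+ _]; move: h1 h2.
  set I := Rintegral _ _ _; set J := Rintegral _ _ _ => h1 h2 h3.
  rewrite (le_trans _ h1)// -(subrK J I) (le_trans _ (lerD h3 h2))//.
  by rewrite addrCA -opprD -splitr.
have [N1 HN1] := upper; have [N2 HN2] := lower.
exists (maxn N1 N2) => // N /=; rewrite geq_max => /andP[/HN1 h1 /HN2 h2].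
by rewrite ler_distl lerBlDr h1 -lerBlDr h2.
Qed.

End occupation_limit.

Theorem theorem1p2 (R : realType) (d : measure_display)
    (T : measurableType d) (P : probability T R) (X : nat -> {RV P >-> int})
    (X_iid : iid P X)
    (X_nondegenerate : nondegenerate_walk P X)
    (X_aperiodic : aperiodic_walk P X)
    (X_centered : ('E_P[fun w => (X 0%N w)%:~R] = 0)%E)
    (X_finite_variance : ('V_P[fun w => (X 0%N w)%:~R] < +oo)%E)
    (F : int -> R) (F_G : G_both F) :
  exists mu : probability R R,
    cvg_in_law P (fun N w => additive_functional F X N w / N%:R) mu /\
    (mean_neg F = 0 -> mean_pos F = 1 ->
     forall z : R, 0 <= z <= 1 ->
       mu `]-oo, z]%classic = (2 / pi * asin (Num.sqrt z))%:E /\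
       P [set w | additive_functional F X N w / N%:R <= z] @[N --> \oo]
         --> (2 / pi * asin (Num.sqrt z))%:E).
Proof.
(* For the means 0 and 1 the affine map is the identity, and the law of sin^2 (pi U / 2) is left. *)
exists (affine_arcsine_law (mean_neg F) (mean_pos F)); split.
  exact: additive_functional_cvg_in_law.
move=> m0 p1 z z01; split; last exact: additive_functional_arcsine.
rewrite -[RHS](uniform_prob_arcsine z01) /affine_arcsine_law /distribution /pushforward.
congr uniform_prob; apply/seteqP; split => u /=;
  by rewrite /affine_arcsine m0 p1 add0r subr0 mul1r.
Qed.
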